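(* For all integers $q\ge3$ and all integers $a$ such that $(q,a)=1$ and $a\not\equiv1\bmod q$, the value of the constant $c(q,a)$ is given by $$c(q,a)=\Pi(q,a)\ \prod_{b\in\mathcal{B}(q,a)}\ \prod_{p\equiv b\bmod q}\exp\Bigl(\varphi(q)f_{t_b,s_b}\Bigl(\frac1p\Bigr)\Bigr)\times\exp\bigl(\varphi(q)B(q,a)\bigr)\,\exp\Bigl(\varphi(q)\sum_{p\equiv a\bmod q}\Bigl(f_{t_a,1}\Bigl(\frac1p\Bigr)-\frac1p\Bigr)\Bigr),$$ where $\mathcal{B}(q,a)=\{b\in\mathbb{Z}_q^*\setminus\{1,a\}\colon \text{the equation } b^y\equiv a\bmod q \text{ has a solution}\}$, $$B(q,a)=\sum_{p\equiv a\bmod q}\Bigl(\frac1p+\log\Bigl(1-\frac1p\Bigr)\Bigr),\qquad \Pi(q,a)=\prod_{\substack{\chi \bmod q\\ \chi\neq\chi_0}}L(1,\chi)^{-\overline{\chi}(a)},$$ $$f_{t,s}(x)=\sum_{\substack{n\ge1\\ n\equiv s\bmod t}}\frac{x^n}{n}\qquad(1\le s\le t,\ |x|<1),$$ $t_a$ is the order of $a$ in $\mathbb{Z}_q^*$, and for $b\in\mathcal{B}(q,a)$ the integers $t_b$ and $s_b$ with $1\le s_b\le t_b$ are such that the solution set of $b^y\equiv a\bmod q$ is the congruence class $y\equiv s_b\bmod t_b$ (so $t_b$ is the order of $b$ in $\mathbb{Z}_q^*$).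
   Context: Throughout, $p$ denotes a prime number, $\varphi$ is the Euler totient function, $\gamma$ is Euler's constant, $\mathbb{Z}_q^*$ is the group of reduced residue classes modulo $q$, $\chi$ ranges over Dirichlet characters modulo $q$, $\chi_0$ is the principal character modulo $q$, and $L(s,\chi)$ is the Dirichlet $L$-function of $\chi$. Complex powers: for $\chi\ne\chi_0$, $L(1,\chi)^{w}$ means $\exp(w\log L(1,\chi))$ with $\log L(1,\chi)=-\lim_{x\to+\infty}\sum_{p\le x}\log(1-\chi(p)/p)$, principal branch of the logarithm in each summand; that is, $L(1,\chi)^{w}=\lim_{x\to+\infty}\prod_{p\le x}(1-\chi(p)/p)^{-w}$. For $(q,a)=1$, the Mertens constant is $$C(q,a)=\lim_{x\to+\infty}(\log x)^{1/\varphi(q)}\prod_{\substack{p\le x\\ p\equiv a \bmod q}}\Bigl(1-\frac1p\Bigr),$$ a positive real number. The constant $c(q,a)$ is defined by $$C(q,a)^{\varphi(q)}=e^{-\gamma}\,\frac{q}{\varphi(q)}\,c(q,a);$$ equivalently (it is known that) $$c(q,a)=\prod_{p\nmid q}\Bigl(1-\frac1p\Bigr)^{\alpha(p;q,a)}=\lim_{x\to+\infty}\prod_{\substack{p\le x\\ p\nmid q}}\Bigl(1-\frac1p\Bigr)^{\alpha(p;q,a)},$$ where $\alpha(p;q,a)=\varphi(q)-1$ if $p\equiv a\bmod q$ and $\alpha(p;q,a)=-1$ otherwise; this product converges (conditionally) when taken over primes in increasing order. *)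

(* Defs.v *)
From HB Require Import structures.
From mathcomp Require Import all_boot all_order all_algebra all_fingroup.
From mathcomp Require Import complex.
From mathcomp Require Import all_classical all_reals all_analysis.

Set Implicit Arguments.
Unset Strict Implicit.
Unset Printing Implicit Defensive.

Import Order.TTheory GRing.Theory Num.Theory numFieldNormedType.Exports.

Local Open Scope ring_scope.
Local Open Scope complex_scope.

(* Limits of sequences and functions are the total operator [lim]; an infinite
   series or product indexed by primes in increasing order is the limit of its
   partial sums or products over [p < n]. *)

Section ComplexExpLog.
Variable R : realType.

Definition cexp (z : R[i]) : R[i] :=
  let: x +i* y := z in (expR x * cos y) +i* (expR x * sin y).

Definition cmod (z : R[i]) : R := let: x +i* y := z in Num.sqrt (x ^+ 2 + y ^+ 2).

(* The principal argument, in ]-pi, pi]. *)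
Definition carg (z : R[i]) : R :=
  let: x +i* y := z in
  if 0 <= y then acos (x / cmod z) else - acos (x / cmod z).

(* The principal branch of the logarithm (for z <> 0). *)
Definition clog (z : R[i]) : R[i] := ln (cmod z) +i* carg z.

End ComplexExpLog.

Section Constants.
Variable R : realType.

Definition euler_gamma : R :=
  limn (fun n : nat => \sum_(1 <= k < n.+1) k%:R^-1 - ln n%:R : R).

Variable q : nat.
Implicit Types a b : {unit 'Z_q}.

(* The class modulo q of an integer coprime to q, as an element of the group of
   units of Z/qZ (the value is 1 for an integer that is not coprime to q). *)
Definition residue (k : int) : {unit 'Z_q} := insubd (1%g : {unit 'Z_q}) k%:~R.

Definition prime_in a (p : nat) : bool := prime p && (p%:R == val a :> 'Z_q).

Definition mertensC a : R :=
  lim ((fun x : R => ln x `^ (totient q)%:R^-1 *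
          \prod_(0 <= p < (Num.truncn x).+1 | prime_in a p) (1 - p%:R^-1))
       @ +oo%R)%classic.

(* C(q,a)^phi(q) = e^(-gamma) (q / phi(q)) c(q,a), solved for c(q,a). *)
Definition mertensc a : R :=
  mertensC a ^+ totient q / (expR (- euler_gamma) * (q%:R / (totient q)%:R)).

(* Dirichlet characters modulo q, as functions on Z/qZ: chi(n) for an integer n
   is [chi n%:R]. The condition chi(1) = 1 follows. *)
Definition dirichlet_character (chi : {ffun 'Z_q -> R[i]}) : Prop :=
  (forall x y, chi (x * y) = chi x * chi y) /\
  (forall x, (chi x != 0) = (x \is a GRing.unit)).

Definition principal_character : {ffun 'Z_q -> R[i]} :=
  [ffun x => (x \is a GRing.unit)%:R].

Definition nonprincipal_characters : set {ffun 'Z_q -> R[i]} :=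
  [set chi | dirichlet_character chi /\ chi <> principal_character]%classic.

(* For a non-principal chi this branch of log L(1, chi) is read off the
   conditionally convergent Euler product at 1; it fixes the meaning of the
   complex power L(1, chi)^w. *)
Definition logL1 (chi : {ffun 'Z_q -> R[i]}) : R[i] :=
  - (\big[+%R/0]_(0 <= p <oo | prime p)
       (clog (1 - chi p%:R / p%:R) : (R[i] : numFieldType))).

Definition powL1 (chi : {ffun 'Z_q -> R[i]}) (w : R[i]) : R[i] :=
  cexp (w * logL1 chi).

(* The set of characters modulo q is finite, so this finitely supported product
   is the product over all the non-principal characters. *)
Definition PiL1 a : R[i] :=
  \big[*%R/1]_(chi \in nonprincipal_characters) powL1 chi (- (chi (val a))^*).

Definition Bsum a : R :=
  \big[+%R/0]_(0 <= p <oo | prime_in a p) (p%:R^-1 + ln (1 - p%:R^-1)).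

Definition fseries (t s : nat) (x : R) : R :=
  \big[+%R/0]_(1 <= n <oo | (n == s %[mod t])%N) (x ^+ n / n%:R).

(* The exponent y ranges over all integers; val b is a unit of Z/qZ. *)
Definition power_solutions b a (y : int) : Prop := val b ^ y = val a :> 'Z_q.

Definition Bset a : {set {unit 'Z_q}} :=
  [set b | [&& b != 1%g, b != a & `[< exists y : int, power_solutions b a y >]]].

End Constants.

(* Main.v *)
(* Orthogonality of characters, applied to the Taylor series of the logarithm,
   gives for every prime p and every unit a modulo q
     sum_chi conj(chi(a)) log(1 - chi(p)/p) = - phi(q) sum_{n, p^n = a} 1/(n p^n).
   Only the classes b having a as a power contribute on the right, and the
   class b then contributes f_{t_b,s_b}(1/p). Summing over p <= x and splitting
   off the principal character turns log Pi(q,a) into the limit of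
     phi(q) sum_{p <= x, p = a} log(1 - 1/p) - sum_{p <= x, p not dividing q} log(1 - 1/p)
   up to the absolutely convergent sums of the statement; Mertens' theorem
   sum_{p <= x} log(1 - 1/p) = - log log x - gamma + o(1) gives the asymptotics
   of the second sum, hence C(q,a).

   The series of log L(1,chi) converges because sum_{p <= x} chi(p) log p / p is
   bounded, which follows from L(1,chi) <> 0. For real chi, the Lambert series
   sum_n chi(n) t^n / (1 - t^n) has coefficients sum_{d | n} chi(d), which are
   nonnegative and at least 1 at squares, so that it is of order at least
   (1 - t)^(-1/2) as t tends to 1, whereas it would stay bounded if L(1,chi) were
   0. For complex chi, the product of the L(1 + e, psi) over all psi is bounded
   below, whereas zeros at chi and at its conjugate would outweigh the simple
   pole of the zeta function.

   The constant in Mertens' theorem is found by comparing, as e tends to 0, the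
   Euler product of zeta(1 + e) with the Abel means of the sums of 1/p over
   dyadic blocks, minus the harmonic series. *)
Require Import Defs.
From HB Require Import structures.
From mathcomp Require Import all_boot all_order all_algebra all_fingroup.
From mathcomp Require Import cyclic separable algC cyclotomic classfun character.
From mathcomp Require Import complex.
From mathcomp Require Import all_classical all_reals all_analysis.
From mathcomp Require Import ring lra zify.

Set Implicit Arguments.
Unset Strict Implicit.
Unset Printing Implicit Defensive.

Import Order.TTheory GRing.Theory Num.Theory numFieldNormedType.Exports.

Local Open Scope ring_scope.
Local Open Scope complex_scope.

(** * Dirichlet characters *)

(** L(1,chi) occurs in two guises: the Euler product that defines the powers in the statement, and
    the sum of chi(n)/n. They are handled separately. The sum enters through its non-vanishing, used
    once, to divide by it in [sum_chi_prime_ln_bounded]; Dirichlet's test with weights 1/ln p then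
    makes the series of chi(p)/p converge, and with it the Euler product. The points 1 + e are real:
    values there come from weighting the terms with n^(-e), and a zero at 1 means partial sums that
    are O(1/N), whence a value O(e) at 1 + e.

    Real characters need their own argument because such a chi is its own conjugate: a single zero
    merely balances the pole of zeta, and the product over all characters then stays bounded on both
    sides without contradiction.

    Summation by parts yields the existence of the constant in Mertens' theorem but not its value.
    Dyadic blocks give access to the value since the primes in ]2^(m-1), 2^m] have a sum of 1/p that
    is close to 1/m on average, which brings in the harmonic series and hence gamma. *)

Lemma closed_field_prim_root (F : numClosedFieldType) n :
  (0 < n)%N -> exists w : F, n.-primitive_root w.
Proof.
move=> n_gt0; pose p : {poly F} := 'X^n - 1.
have [r Dp] := closed_field_poly_normal p.
rewrite (monicP _) ?monicXnsubC // scale1r in Dp.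
have rn1 : all n.-unity_root r by apply/allP => z; rewrite -root_prod_XsubC -Dp.
have sz_r : (n < (size r).+1)%N.
  by rewrite -(size_prod_XsubC r id) -Dp size_XnsubC.
have [|z] := hasP (has_prim_root n_gt0 rn1 _ sz_r); last by exists z.
by rewrite -separable_prod_XsubC -Dp separable_Xn_sub_1 // pnatr_eq0 -lt0n.
Qed.

(* The irreducible characters of the library take values in [algC]; they are
   carried over to [F] by sending a primitive root of unity to another one. *)
Lemma abelian_separation (gT : finGroupType) (F : numClosedFieldType) (g : gT) :
  abelian [set: gT]%g -> g != 1%g ->
  exists f : gT -> F, [/\ forall x y, f (x * y)%g = f x * f y,
    forall x, f x != 0 & f g != 1].
Proof.
move=> abG g1.
have [i gi] : exists i : Iirr [set: gT]%g, g \notin cfker 'chi_i.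
  apply/existsP; rewrite -negb_forall; apply: contra g1 => /forallP H.
  have : g \in (\bigcap_i cfker 'chi[[set: gT]]_i)%g by apply/bigcapP => i _.
  by rewrite TI_cfker_irr => /set1P ->.
have lin : 'chi_i \is a linear_char by apply/char_abelianP.
pose n := #|[set: gT]%g|; have n0 : (0 < n)%N by exact: cardG_gt0.
have [z pz] := C_prim_root_exists n0.
have [w pw] := closed_field_prim_root F n0.
have xn x : 'chi_i x ^+ n = 1.
  rewrite -(lin_charX lin) ?inE//; have -> : (x ^+ n = 1)%g.
    by apply: expg_cardG; rewrite inE.
  exact: lin_char1.
have lg x : exists k : 'I_n, 'chi_i x == z ^+ k.
  by have [k ->] := prim_rootP pz (xn x); exists k.
pose k x := xchoose (lg x).
have kE x : 'chi_i x = z ^+ k x by apply/eqP/(xchooseP (lg x)).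
exists (fun x => w ^+ k x); split=> [x y|x|].
- apply/eqP; rewrite -exprD (eq_prim_root_expr pw) -(eq_prim_root_expr pz).
  by rewrite exprD -!kE (lin_charM lin) ?inE.
- by rewrite expf_neq0// (prim_root_eq0 pw) -lt0n.
- apply: contra gi => wk.
  have : w ^+ k g == w ^+ 0 by rewrite expr0.
  rewrite (eq_prim_root_expr pw) -(eq_prim_root_expr pz) -kE expr0 => /eqP gg.
  by rewrite cfkerEchar ?irr_char// !inE gg (lin_char1 lin) eqxx.
Qed.

Section Characters.
Variables (R : realType) (q : nat).
Hypothesis q1 : (1 < q)%N.
Local Notation DC := (@dirichlet_character R q).

Definition char_of_hom (f : {unit 'Z_q} -> R[i]) : {ffun 'Z_q -> R[i]} :=
  [ffun x => if insub x is Some u then f u else 0].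

Lemma char_of_homP (f : {unit 'Z_q} -> R[i]) :
  (forall x y, f (x * y)%g = f x * f y) -> (forall x, f x != 0) ->
  DC (char_of_hom f) /\ forall u, char_of_hom f (val u) = f u.
Proof.
move=> fM f0; have fE u : char_of_hom f (val u) = f u by rewrite ffunE valK.
have f1 x : x \isn't a GRing.unit -> char_of_hom f x = 0.
  by move=> xu; rewrite ffunE insubN.
have unitE (x : 'Z_q) : x \is a GRing.unit -> exists u : {unit 'Z_q}, x = val u.
  by move=> xu; exists (Sub x xu); rewrite SubK.
split=> //; split=> [x y|x]; last first.
  have [/unitE[u ->]|xu] := boolP (x \is a GRing.unit); last by rewrite f1// eqxx.
  by rewrite fE f0.
have [/unitE[u ->]|xu] := boolP (x \is a GRing.unit); last first.
  by rewrite f1 ?unitrM ?(negbTE xu)// f1// mul0r.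
have [/unitE[v ->]|yu] := boolP (y \is a GRing.unit); last first.
  by rewrite f1 ?unitrM ?(negbTE yu) ?andbF// (f1 y)// mulr0.
by rewrite !fE -fM -fE.
Qed.

Lemma dirichlet_character1 chi : DC chi -> chi 1 = 1.
Proof.
move=> [chiM chi0]; have : chi 1 != 0 by rewrite chi0 unitr1.
by move=> h; apply: (mulfI h); rewrite -chiM !mulr1.
Qed.

Lemma dirichlet_characterX chi x n : DC chi -> chi (x ^+ n) = chi x ^+ n.
Proof.
move=> h; elim: n => [|n IH]; first by rewrite !expr0 dirichlet_character1.
by rewrite !exprS h.1 IH.
Qed.

Lemma dirichlet_character_root chi (x : 'Z_q) : DC chi -> x \is a GRing.unit ->
  chi x ^+ totient q = 1.
Proof.
move=> h xu; rewrite -dirichlet_characterX//.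
pose u : {unit 'Z_q} := Sub x xu.
have -> : x = val u by rewrite SubK.
rewrite -FinRing.val_unitX.
have -> : (u ^+ totient q = 1)%g.
  rewrite -(card_units_Zp (ltnW q1)); apply: expg_cardG; rewrite inE //.
by rewrite FinRing.val_unit1 dirichlet_character1.
Qed.

Lemma principal_characterP : DC (principal_character R q).
Proof.
split=> [x y|x]; rewrite !ffunE ?unitrM.
  by case: (x \is a _); case: (y \is a _); rewrite ?mulr1 ?mul0r ?mulr0.
by case: (x \is a _); rewrite ?oner_eq0 ?eqxx.
Qed.

(** Every value is 0 or a power of one primitive root [w] of order [totient q]. A character is thus
    coded by a function into the finite type [option 'I_(totient q)], where [None] stands for 0; all
    codes are decoded and the characters among the results are kept. *)
Lemma dirichlet_charactersP : exists X : seq {ffun 'Z_q -> R[i]},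
  uniq X /\ forall chi, chi \in X <-> DC chi.
Proof.
have n0 : (0 < totient q)%N by rewrite totient_gt0 ltnW.
have [w pw] := closed_field_prim_root R[i] n0.
pose dec (f : {ffun 'Z_q -> option 'I_(totient q)}) : {ffun 'Z_q -> R[i]} :=
  [ffun x => if f x is Some k then w ^+ k else 0].
exists [seq chi <- undup [seq dec f | f : {ffun 'Z_q -> option 'I_(totient q)}] |
   `[< DC chi >]].
split; first by rewrite filter_uniq// undup_uniq.
move=> chi; rewrite mem_filter; split=> [/andP[/asboolP]//|h].
apply/andP; split; first exact/asboolP.
rewrite mem_undup; apply/mapP.
have H x : exists o : option 'I_(totient q),
    chi x == if o is Some k then w ^+ k else 0.
  have [xu|xu] := boolP (x \is a GRing.unit); last first.
    by exists None; have := h.2 x; rewrite (negbTE xu) => /negbFE.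
  have [k ->] := prim_rootP pw (dirichlet_character_root h xu).
  by exists (Some k).
exists [ffun x => xchoose (H x)]; first by rewrite mem_enum.
by apply/ffunP => x; rewrite !ffunE; apply/eqP/(xchooseP (H x)).
Qed.

Lemma dirichlet_characterM chi psi : DC chi -> DC psi ->
  DC [ffun x => chi x * psi x].
Proof.
move=> h1 h2; split=> [x y|x]; rewrite !ffunE.
  by rewrite h1.1 h2.1 mulrACA.
by rewrite mulf_eq0 negb_or h1.2 h2.2 andbb.
Qed.

Lemma conjc_dirichlet_character chi : DC chi -> DC [ffun x => (chi x)^*].
Proof.
move=> h; split=> [x y|x]; rewrite !ffunE; first by rewrite h.1 rmorphM.
by rewrite conjc_eq0 h.2.
Qed.

Lemma dirichlet_character_norm chi (x : 'Z_q) : DC chi ->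
  x \is a GRing.unit -> `|chi x| = 1.
Proof.
move=> h xu; have n0 : (0 < totient q)%N by rewrite totient_gt0 ltnW.
apply/eqP; rewrite -(@pexpr_eq1 _ _ (totient q))//.
by rewrite -normrX (dirichlet_character_root h xu) normr1.
Qed.

Lemma sum_character_values chi : DC chi -> chi <> principal_character R q ->
  \sum_x chi x = 0.
Proof.
move=> h npr.
have [u uu nu] : exists2 u, u \is a GRing.unit & chi u != 1.
  apply: contrapT => H; apply: npr; apply/ffunP => x; rewrite ffunE.
  have [xu|xu] := boolP (x \is a GRing.unit).
    by apply/eqP/negPn/negP => /negP nx; apply: H; exists x => //; apply/negP.
  by have := h.2 x; rewrite (negbTE xu) => /negbFE/eqP.
have : chi u * \sum_x chi x = \sum_x chi x.
  rewrite mulr_sumr [RHS](reindex_inj (@mulrI _ _ uu))/=.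
  by apply: eq_bigr => x _; rewrite h.1.
move/eqP; rewrite -subr_eq0 -{2}[\sum_x _]mul1r -mulrBl mulf_eq0 subr_eq0.
by rewrite (negbTE nu) => /eqP.
Qed.

Variable X : seq {ffun 'Z_q -> R[i]}.
Hypothesis uX : uniq X.
Hypothesis XP : forall chi, chi \in X <-> DC chi.

(** Multiplication by a character [psi] with [psi u <> 1] maps the list [X] injectively into itself,
    hence permutes it, so the sum is multiplied by [psi u] and yet unchanged. *)
Lemma sum_characters_1 (u : {unit 'Z_q}) : u != 1%g -> \sum_(chi <- X) chi (val u) = 0.
Proof.
move=> u1.
have abG : abelian [set: {unit 'Z_q}]%g by exact: units_Zp_abelian.
have [f [fM f0 fu]] := abelian_separation R[i] abG u1.
have [psi [psiP psiE]] := ex_intro (fun psi => DC psi /\ forall v, psi (val v) = f v)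
  _ (char_of_homP fM f0).
pose m (chi : {ffun 'Z_q -> R[i]}) := [ffun x => psi x * chi x] : {ffun 'Z_q -> R[i]}.
have mI : {in X &, injective m}.
  move=> c1 c2 /XP h1 /XP h2 /ffunP E; apply/ffunP => x.
  have [xu|xu] := boolP (x \is a GRing.unit).
    have := E x; rewrite !ffunE; apply: mulfI; by rewrite psiP.2.
  by have := h1.2 x; have := h2.2 x; rewrite (negbTE xu) => /negbFE/eqP -> /negbFE/eqP ->.
have mX : {subset map m X <= X}.
  by move=> c /mapP[d /XP hd ->]; apply/XP/dirichlet_characterM.
have um : uniq (map m X) by rewrite map_inj_in_uniq// => c1 c2 c1X _; exact: mI.
have [_ Em] := uniq_min_size um mX (eq_leq (esym (size_map _ _))).
have pX : perm_eq (map m X) X by apply: uniq_perm.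
have : psi (val u) * \sum_(chi <- X) chi (val u) = \sum_(chi <- X) chi (val u).
  rewrite mulr_sumr -[RHS](perm_big _ pX)/= big_map.
  by apply: eq_bigr => chi _; rewrite ffunE.
rewrite psiE => /eqP; rewrite -subr_eq0 -{2}[\sum_(chi <- X) _]mul1r -mulrBl mulf_eq0.
by rewrite subr_eq0 (negbTE fu) => /eqP.
Qed.

(** The double sum of chi(x) is evaluated in both orders: summed over x first, only the principal
    character survives; summed over chi first, only x = 1. *)
Lemma size_characters : (size X)%:R = (totient q)%:R :> R[i].
Proof.
have : \sum_(chi <- X) \sum_x chi x = \sum_x \sum_(chi <- X) chi x by rewrite exchange_big.
rewrite (bigD1_seq (principal_character R q)) ?uX//=; last by apply/XP; exact: principal_characterP.
rewrite [X in _ + X]big_seq_cond [X in _ + X]big1 ?addr0; last first.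
  by move=> chi /andP[cX /eqP n]; apply: sum_character_values => //; exact/XP.
rewrite [RHS](bigD1 1)//= [X in _ + X]big1 ?addr0; last first.
  move=> x x1; have [xu|xu] := boolP (x \is a GRing.unit).
    have := @sum_characters_1 (Sub x xu); rewrite SubK; apply.
    by apply: contra x1 => /eqP/(congr1 val); rewrite SubK => ->.
  rewrite big_seq big1// => chi cX; have h := (XP chi).1 cX; have := h.2 x.
  by rewrite (negbTE xu) => /negbFE/eqP.
have -> : \sum_(chi <- X) chi 1 = (size X)%:R.
  rewrite (eq_big_seq (fun=> 1)) => [|chi cX].
    by rewrite big_const_seq count_predT iter_addr_0.
  by have h := (XP chi).1 cX; rewrite dirichlet_character1.
move=> <-.
rewrite (eq_bigr (fun x => if x \is a GRing.unit then 1 else 0)); last first.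
  by move=> x _; rewrite ffunE; case: (x \is a _).
rewrite -big_mkcond sumr_const; congr (_ *+ _).
by rewrite -(card_units_Zp (ltnW q1)) cardsT card_sub.
Qed.

Lemma character_orthogonality (a : {unit 'Z_q}) (x : 'Z_q) :
  \sum_(chi <- X) conjc (chi (val a)) * chi x = if x == val a then (totient q)%:R else 0.
Proof.
have conjV chi : DC chi -> (chi (val a))^* = chi (val a^-1%g).
  move=> h; have au : val a \is a GRing.unit by exact: valP.
  apply: (@mulfI _ (chi (val a))); first by rewrite h.2.
  rewrite -h.1 FinRing.val_unitV divrr// dirichlet_character1//.
  by rewrite -sqr_normc dirichlet_character_norm// expr1n.
transitivity (\sum_(chi <- X) chi (val a^-1%g * x)).
  rewrite big_seq [RHS]big_seq; apply: eq_bigr => chi cX; have h := (XP chi).1 cX.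
  by rewrite conjV// h.1.
case: eqP => [->|/eqP xa].
  rewrite -size_characters (eq_big_seq (fun=> 1)) => [|chi cX].
    by rewrite big_const_seq count_predT iter_addr_0.
   have h := (XP chi).1 cX; rewrite FinRing.val_unitV mulVr ?dirichlet_character1//.
  exact: valP.
have [xu|xu] := boolP (x \is a GRing.unit); last first.
  rewrite big_seq big1// => chi cX; have h := (XP chi).1 cX; rewrite h.1; have := h.2 x.
  by rewrite (negbTE xu) => /negbFE/eqP ->; rewrite mulr0.
have -> : val a^-1%g * x = val (a^-1 * Sub x xu)%g by rewrite FinRing.val_unitM SubK.
apply: sum_characters_1; rewrite -eq_mulVg1; apply: contra xa => /eqP ->.
by rewrite SubK.
Qed.
End Characters.

Local Open Scope classical_set_scope.

Lemma sum_multiples (V : nmodType) (d N : nat) (F : nat -> V) : (0 < d)%N ->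
  \sum_(1 <= n < N.+1 | (d %| n)%N) F n = \sum_(1 <= k < (N %/ d).+1) F (d * k)%N.
Proof.
move=> d0; elim: N => [|N IH]; first by rewrite div0n !big_geq.
rewrite big_mkcond big_nat_recr//= -big_mkcond/= IH divnS//.
case: ifPn => [/dvdnP[m Nm]|_]; last by rewrite add0n addr0.
rewrite add1n [RHS]big_nat_recr//=; congr (_ + F _).
have : (N.+1 %/ d)%N = m by rewrite Nm mulnK.
by rewrite divnS// Nm dvdn_mull// add1n => ->; rewrite mulnC.
Qed.

(** * Summation by parts *)

Section Abel.
Variables (R : realType) (a b : nat -> R) (M : R) (m : nat).
Hypothesis aM : forall k, `|\sum_(0 <= i < k) a i| <= M.
Hypothesis b0 : forall n, (m <= n)%N -> 0 <= b n.
Hypothesis bd : forall n, (m <= n)%N -> b n.+1 <= b n.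

(** The partial sums of [a] start at 0 while the sum starts at [m]. The boundary term at [m]
    therefore costs [M * b m] on top of the usual [M * b m], whence the factor 2. *)
Lemma abel_bound N : `|\sum_(m <= i < N) a i * b i| <= 2 * M * b m.
Proof.
have M0 : 0 <= M by apply: le_trans (aM 0).
have [mN|Nm] := leqP m N; last first.
  by rewrite big_geq ?normr0 ?mulr_ge0 ?b0// ltnW.
(* With the boundary term at [n] removed, each step adds [A * (b n - b n.+1)], whose bounds
   telescope. *)
suff H n : (m <= n)%N -> `|\sum_(m <= i < n) a i * b i -
    (\sum_(0 <= i < n) a i) * b n| <= M * (2 * b m - b n).
  have bN := b0 mN; have := ler_wpM2r bN (aM N); have := H _ mN.
  set s := \sum_(0 <= i < N) _; set T := \sum_(m <= i < N) _ => h1 h2.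
  rewrite -[T](subrK (s * b N)); apply: (le_trans (ler_normD _ _)).
  by rewrite [X in _ + X]normrM (ger0_norm bN); lra.
elim: n => [|n IH].
  rewrite leqn0 => /eqP m0; rewrite !big_geq// ?m0// mul0r subr0 normr0.
  by have := mulr_ge0 M0 (b0 (leqnn m)); rewrite m0; lra.
rewrite leq_eqVlt => /predU1P[<-|mn].
  rewrite [X in X - _]big_geq// sub0r normrN normrM (ger0_norm (b0 _))//.
  by have := ler_wpM2r (b0 (leqnn m)) (aM m); lra.
have {}mn : (m <= n)%N by [].
rewrite big_nat_recr//=.
set s := \sum_(m <= i < n) _; set A := \sum_(0 <= i < n.+1) a i.
have -> : s + a n * b n - A * b n.+1 =
    (s - (\sum_(0 <= i < n) a i) * b n) + A * (b n - b n.+1).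
  by rewrite /A big_nat_recr//=; ring.
apply: (le_trans (ler_normD _ _)).
have h : `|A * (b n - b n.+1)| <= M * (b n - b n.+1).
  have hb : 0 <= b n - b n.+1 by rewrite subr_ge0 bd.
  by rewrite normrM (ger0_norm hb); exact: ler_wpM2r (aM _).
by apply: (le_trans (lerD (IH mn) h)); lra.
Qed.

End Abel.

(** The tail estimate accompanies the convergence because the rate 1/N in [Lpartial_cvg] is read off
    from it. *)
Lemma dirichlet_test (R : realType) (a b : nat -> R) (M : R) (m : nat) :
  (forall k, `|\sum_(0 <= i < k) a i| <= M) ->
  (forall n, (m <= n)%N -> b n.+1 <= b n) ->
  (b @ \oo --> (0 : R))%classic ->
  cvgn (series (fun i => a i * b i)) /\
  forall N, (m <= N)%N ->
    `|limn (series (fun i => a i * b i)) - \sum_(0 <= i < N) a i * b i| <= 2 * M * b N.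
Proof.
move=> aM bd bcvg.
have M0 : 0 <= M by apply: le_trans (aM 0).
have b0 n : (m <= n)%N -> 0 <= b n.
  move=> mn; rewrite -(cvg_lim (@Rhausdorff R) bcvg).
  apply: limr_le; first exact: cvgP bcvg.
  exists n => // k /= nk; elim: k nk => [|k IH]; first by rewrite leqn0 => /eqP ->.
  rewrite leq_eqVlt => /predU1P[->//|nk].
  by apply: le_trans (IH nk); apply: bd; exact: (leq_trans mn).
have bb N k : (m <= N)%N -> `|\sum_(N <= i < k) a i * b i| <= 2 * M * b N.
  move=> mN; apply: abel_bound => // n Nn; [apply: b0|apply: bd]; exact: leq_trans Nn.
have cv : cvgn (series (fun i => a i * b i)).
  apply/cauchy_cvgP/cauchy_seriesP => e e0.
  have : (\forall n \near \oo, b n < e / (2 * M + 1))%classic.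
    have e1 : 0 < e / (2 * M + 1) by apply: divr_gt0 => //; lra.
    move/cvgrPdist_lt : bcvg => /(_ _ e1); apply: filterS => n.
    by rewrite sub0r normrN => /ltr_normlP[].
  case=> n0 _ hn0.
  near=> x => /=.
  have mx : (maxn m n0 <= x.1)%N.
    by near: x; exists ([set n | (maxn m n0 <= n)%N], setT) => /=;
      [split; exists (maxn m n0)|case=> ? ? []].
  move: mx; rewrite geq_max => /andP[mx nx].
  apply: le_lt_trans (bb _ _ mx) _.
  have := hn0 _ nx => /=; rewrite ltr_pdivlMr; last lra.
  by have := b0 _ mx; nra.
split=> // N mN.
have -> : limn (series (fun i => a i * b i)) - \sum_(0 <= i < N) a i * b i =
   limn (fun k => series (fun i => a i * b i) k - \sum_(0 <= i < N) a i * b i).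
  by rewrite (limB cv (is_cvg_cst _)) lim_cst.
rewrite -lim_norm; last by exact: is_cvgB cv (is_cvg_cst _).
apply: limr_le; first by exact: is_cvg_norm (is_cvgB cv (is_cvg_cst _)).
exists N => // k /= Nk.
by rewrite /series/= (big_cat_nat (leq0n N) Nk)//= addrAC subrr add0r; exact: bb.
Unshelve. all: by end_near. Qed.

(** * The complex logarithm *)

Section ComplexLog.
Variable R : realType.
Implicit Types (z w : R[i]) (t : R).

Lemma Re_sum I (r : seq I) (P : pred I) (F : I -> R[i]) :
  complex.Re (\sum_(i <- r | P i) F i) = \sum_(i <- r | P i) complex.Re (F i).
Proof. by apply: (big_morph (@complex.Re R)) => // -[a b] [c d]. Qed.
Lemma Im_sum I (r : seq I) (P : pred I) (F : I -> R[i]) :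
  complex.Im (\sum_(i <- r | P i) F i) = \sum_(i <- r | P i) complex.Im (F i).
Proof. by apply: (big_morph (@complex.Im R)) => // -[a b] [c d]. Qed.

Lemma cmodE z : `|z| = (cmod z)%:C.
Proof. by case: z => x y; rewrite normc_def. Qed.
Lemma cmod_ge0 z : 0 <= cmod z. Proof. by case: z => x y; exact: sqrtr_ge0. Qed.
Lemma cmodM z w : cmod (z * w) = cmod z * cmod w.
Proof. by apply: (@complexI R); rewrite -cmodE normrM !cmodE rmorphM. Qed.
Lemma cmodD z w : cmod (z + w) <= cmod z + cmod w.
Proof. by rewrite -lecR -cmodE (le_trans (ler_normD _ _))// !cmodE rmorphD. Qed.
Lemma cmodN z : cmod (- z) = cmod z.
Proof. by apply: (@complexI R); rewrite -!cmodE normrN. Qed.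
Lemma cmodX z n : cmod (z ^+ n) = cmod z ^+ n.
Proof. by apply: (@complexI R); rewrite -cmodE normrX cmodE rmorphXn. Qed.
Lemma cmodV z : cmod (z^-1) = (cmod z)^-1.
Proof. by apply: (@complexI R); rewrite -cmodE normfV cmodE fmorphV. Qed.
Lemma cmod0 : cmod (0 : R[i]) = 0.
Proof. by apply: (@complexI R); rewrite -cmodE normr0. Qed.
Lemma cmod1 : cmod (1 : R[i]) = 1.
Proof. by apply: (@complexI R); rewrite -cmodE normr1. Qed.
Lemma cmod_real (x : R) : cmod x%:C = `|x|.
Proof. by rewrite /cmod/= expr0n/= addr0 sqrtr_sqr. Qed.
Lemma cmod_eq0 z : (cmod z == 0) = (z == 0).
Proof. by rewrite -(inj_eq (@complexI R)) -cmodE normr_eq0. Qed.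
Lemma cmod_sum I (r : seq I) (P : pred I) (F : I -> R[i]) :
  cmod (\sum_(i <- r | P i) F i) <= \sum_(i <- r | P i) cmod (F i).
Proof.
elim/big_ind2 : _ => [|x a y b xa yb|//]; first by rewrite cmod0.
by rewrite (le_trans (cmodD _ _)) ?lerD.
Qed.
Lemma cmod_prod I (r : seq I) (P : pred I) (F : I -> R[i]) :
  cmod (\prod_(i <- r | P i) F i) = \prod_(i <- r | P i) cmod (F i).
Proof. exact: (big_morph _ cmodM cmod1). Qed.
Lemma Re_le_cmod z : `|complex.Re z| <= cmod z.
Proof. by rewrite -lecR -cmodE normc_ge_Re. Qed.
Lemma Im_le_cmod z : `|complex.Im z| <= cmod z.
Proof.
have -> : complex.Im z = complex.Re (- 'i * z) by case: z => x y; simpc.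
rewrite (le_trans (Re_le_cmod _))// cmodM cmodN.
by rewrite [cmod 'i]/cmod/= expr0n/= add0r expr1n sqrtr1 mul1r.
Qed.
Lemma cmod_le z : cmod z <= `|complex.Re z| + `|complex.Im z|.
Proof.
have {1}-> : z = (complex.Re z)%:C + 'i * (complex.Im z)%:C by exact: complexE.
apply: le_trans (cmodD _ _) _; rewrite cmodM !cmod_real.
by rewrite [cmod 'i]/cmod/= expr0n/= add0r expr1n sqrtr1 mul1r.
Qed.
Lemma ReD z w : complex.Re (z + w) = complex.Re z + complex.Re w.
Proof. by case: z w => ? ? []. Qed.
Lemma ImD z w : complex.Im (z + w) = complex.Im z + complex.Im w.
Proof. by case: z w => ? ? []. Qed.

Lemma cexpD z w : cexp (z + w) = cexp z * cexp w.
Proof.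
case: z w => [a b] [c d]; rewrite /cexp/=; simpc.
by rewrite expRD cosD sinD; congr (_ +i* _); ring.
Qed.
Lemma cexp_real (x : R) : cexp x%:C = (expR x)%:C.
Proof. by rewrite /cexp/= cos0 sin0 mulr1 mulr0. Qed.
Lemma cexp_sum I (r : seq I) (P : pred I) (F : I -> R[i]) :
  cexp (\sum_(i <- r | P i) F i) = \prod_(i <- r | P i) cexp (F i).
Proof. by apply: (big_morph _ cexpD); rewrite (cexp_real 0) expR0. Qed.

(** On the right half-plane the argument, defined through [acos], is an arctangent, a form that is
    easy to differentiate. *)
Lemma clog_atan z : 0 < complex.Re z ->
  clog z = ln (cmod z) +i* atan (complex.Im z / complex.Re z).
Proof.
case: z => x y /= x0; congr (_ +i* _).
rewrite /carg /cmod; set m := Num.sqrt (x ^+ 2 + y ^+ 2); set v := y / x.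
have xn : x != 0 by rewrite gt_eqF.
have m2 : m ^+ 2 = x ^+ 2 + y ^+ 2 by rewrite sqr_sqrtr ?addr_ge0 ?sqr_ge0.
have m0 : 0 < m by rewrite sqrtr_gt0 ltr_pwDl ?exprn_gt0 ?sqr_ge0.
have cv : cos (atan v) = x / m.
  have -> : x / m = (m / x)^-1 by rewrite invf_div.
  rewrite cos_atan; congr (_^-1).
  have -> : 1 + v ^+ 2 = (m / x) ^+ 2 by rewrite /v !expr_div_n m2 mulrDl divff ?expf_neq0.
  by rewrite sqrtr_sqr gtr0_norm ?divr_gt0.
have at2 := atan_ltpi2 v; have atN2 := atan_gtNpi2 v; have pi0 := pi_gt0 R.
rewrite -cv; case: ifPn => y0.
  rewrite cosK// in_itv/=; apply/andP; split; last by lra.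
  by rewrite -(atan0 R) le_atan// divr_ge0// ltW.
rewrite cosKN ?opprK//; apply/andP; split; first by lra.
by rewrite -(atan0 R) le_atan// nmulr_rle0 ?invr_ge0 ?ltNge ?(ltW x0)//.
Qed.

Lemma is_derive_psum (c : nat -> R) n (t : R) :
  is_derive t (1 : R) (fun t => \sum_(1 <= k < n.+1) c k * t ^+ k / k%:R)
    (\sum_(1 <= k < n.+1) c k * t ^+ k.-1).
Proof.
elim: n => [|n IH].
  rewrite big_geq//; under [X in is_derive _ _ X _]funext do rewrite big_geq//.
  exact: is_derive_cst.
rewrite big_nat_recr//=; under [X in is_derive _ _ X _]funext do rewrite big_nat_recr//=.
apply: is_deriveD.
have -> : (fun x => c n.+1 * x ^+ n.+1 / n.+1%:R) = (c n.+1 / n.+1%:R) \*: ((id : R -> R) ^+ n.+1).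
  by apply/funext => x /=; rewrite exprfctE mulrAC.
apply: is_derive_eq; rewrite /GRing.scale/= mulr1.
by rewrite mulrA divfK ?pnatr_eq0.
Qed.

Lemma derive_bound (f df : R -> R) (B : R) :
  (forall t, 0 <= t <= 1 -> is_derive t (1 : R) f (df t)) ->
  (forall t, 0 <= t <= 1 -> `|df t| <= B) -> `|f 1 - f 0| <= B.
Proof.
move=> fd dB.
have [t||c] := @MVT_segment R f df 0 1 ler01.
- by rewrite in_itv/= => /andP[t0 t1]; apply: fd; rewrite !ltW.
- apply: derivable_within_continuous => t; rewrite in_itv/= => t01.
  by have := fd t t01; case.
- by rewrite in_itv/= => c01 ->; rewrite subr0 mulr1; apply: dB.
Qed.

(** The left-hand side is the derivative in [t] of log (1 - t z) + sum_k z^k t^k / k. The geometric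
    sum cancels all of it but a term of order n + 1 in z. *)
Lemma geometric_remainder z (t : R) n : t%:C * z != 1 ->
  - z / (1 - t%:C * z) + \sum_(1 <= k < n.+1) z ^+ k * t%:C ^+ k.-1 =
  - z * (t%:C * z) ^+ n / (1 - t%:C * z).
Proof.
move=> tz1; have w0 : 1 - t%:C * z != 0 by rewrite subr_eq0 eq_sym.
elim: n => [|n IH]; first by rewrite big_geq// addr0 expr0 mulr1.
rewrite big_nat_recr//= addrA IH !exprS exprMn; field.
by rewrite w0.
Qed.

Lemma divc_formula (x y t : R) : 0 < (1 - t * x) ^+ 2 + (t * y) ^+ 2 ->
  - (x +i* y) / (1 - t%:C * (x +i* y)) =
  ((t * y ^+ 2 - x * (1 - t * x)) / ((1 - t * x) ^+ 2 + (t * y) ^+ 2)) +i*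
  (- y / ((1 - t * x) ^+ 2 + (t * y) ^+ 2)).
Proof.
move=> D0; have Dn : (1 - t * x) ^+ 2 + (t * y) ^+ 2 != 0 by rewrite gt_eqF.
have -> : 1 - t%:C * (x +i* y) = (1 - t * x) +i* (- (t * y)) by simpc.
apply: (canLR (mulfK _)); last by simpc; congr (_ +i* _); field; rewrite gt_eqF.
rewrite eq_complex/= oppr_eq0; apply: contra Dn => /andP[/eqP -> /eqP ->].
by rewrite !expr0n/= addr0.
Qed.

Lemma is_derive_quad (a b c t : R) :
  is_derive t (1 : R) (fun t => a + b * t + c * t ^+ 2) (b + c * (2 * t)).
Proof.
have -> : (fun t => a + b * t + c * t ^+ 2) =
    (cst a + b \*: (id : R -> R)) + c \*: ((id : R -> R) ^+ 2).
  by apply/funext => u.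
apply: is_derive_eq; rewrite add0r /GRing.scale/= !mulr1; ring.
Qed.

(** The quadratic polynomial is |1 - t z|^2 for z = x + i y, so the function is the real part of log
    (1 - t z). The imaginary part is treated in [is_derive_atan_arg]. *)
Lemma is_derive_ln_cmod (x y t : R) : 0 < 1 - t * x ->
  is_derive t (1 : R) (fun t => ln (1 + (- (2 * x)) * t + (x ^+ 2 + y ^+ 2) * t ^+ 2) / 2)
    (complex.Re (- (x +i* y) / (1 - t%:C * (x +i* y)))).
Proof.
move=> u0; pose D t := 1 + (- (2 * x)) * t + (x ^+ 2 + y ^+ 2) * t ^+ 2.
have DE : D t = (1 - t * x) ^+ 2 + (t * y) ^+ 2 by rewrite /D; ring.
have D0 : 0 < D t by rewrite DE ltr_pwDl ?exprn_gt0 ?sqr_ge0.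
rewrite divc_formula/= -?DE//.
have -> : (fun t => ln (1 + (- (2 * x)) * t + (x ^+ 2 + y ^+ 2) * t ^+ 2) / 2) =
    2^-1 \*: ((@ln R) \o D) by apply/funext => s /=; rewrite mulrC.
have dD := is_derive_quad 1 (- (2 * x)) (x ^+ 2 + y ^+ 2) t.
have dl := is_derive1_ln D0.
apply: is_derive_eq; rewrite /GRing.scale/=; field.
by rewrite gt_eqF.
Qed.

Lemma is_derive_atan_arg (x y t : R) : 0 < 1 - t * x ->
  is_derive t (1 : R) (fun t => atan (- (t * y) / (1 - t * x)))
    (complex.Im (- (x +i* y) / (1 - t%:C * (x +i* y)))).
Proof.
move=> u0; have D0 : 0 < (1 - t * x) ^+ 2 + (t * y) ^+ 2.
  by rewrite ltr_pwDl ?exprn_gt0 ?sqr_ge0.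
rewrite divc_formula//=.
pose g t := 0 + (- y) * t + 0 * t ^+ 2; pose h t := 1 + (- x) * t + 0 * t ^+ 2.
have dg := is_derive_quad 0 (- y) 0 t; have dh := is_derive_quad 1 (- x) 0 t.
have hn : h t != 0.
  by have -> : h t = 1 - t * x; [rewrite /h; ring|rewrite gt_eqF].
have dV := is_deriveV hn dh.
have -> : (fun t => atan (- (t * y) / (1 - t * x))) =
    (@atan R) \o (g * (fun t => (h t)^-1)).
  by apply/funext => s /=; congr (atan (_ / _)); rewrite /g /h; ring.
apply: is_derive_eq; rewrite /GRing.scale/=.
have -> : (g * (fun t => (h t)^-1)) t = - (t * y) / (1 - t * x).
  by rewrite /= mulrfctE/=; congr (_ / _); rewrite /g /h; ring.
have -> : h t = 1 - t * x by rewrite /h; ring.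
have -> : g t = - (t * y) by rewrite /g; ring.
field; rewrite !gt_eqF//.
Qed.

Lemma Re_mulr_real z (t : R) : complex.Re (z * t%:C) = complex.Re z * t.
Proof. by case: z => a b /=; rewrite mulr0 subr0. Qed.
Lemma Im_mulr_real z (t : R) : complex.Im (z * t%:C) = complex.Im z * t.
Proof. by case: z => a b /=; rewrite mulr0 add0r. Qed.

(** The mean value theorem is applied along the segment from 0 to z, to the real and the imaginary
    part separately since it fails for complex-valued functions; the factor 2 comes from adding the
    two bounds. *)
Lemma clog_taylor z n : cmod z < 1 ->
  cmod (clog (1 - z) + \sum_(1 <= k < n.+1) z ^+ k / k%:R) <=
  2 * (cmod z ^+ n.+1 / (1 - cmod z)).
Proof.
move=> z1; case Ez : z => [x y]; rewrite -Ez.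
have z10 : 0 < 1 - cmod z by rewrite subr_gt0.
have xz : `|x| < 1 by apply: le_lt_trans z1; rewrite Ez; exact: (Re_le_cmod (x +i* y)).
have u0 t : 0 <= t <= 1 -> 0 < 1 - t * x.
  by move=> /andP[t0 t1]; have /ltr_normlP[] := xz; nra.
have tz t : 0 <= t <= 1 -> cmod (t%:C * z) <= cmod z.
  move=> /andP[t0 t1]; rewrite cmodM cmod_real ger0_norm//.
  by rewrite ler_piMl ?cmod_ge0.
have w2 t : 0 <= t <= 1 -> 1 - cmod z <= cmod (1 - t%:C * z).
  move=> /tz h; have := cmodD (1 - t%:C * z) (t%:C * z).
  by rewrite subrK cmod1; lra.
have dB t : 0 <= t <= 1 ->
    cmod (- z * (t%:C * z) ^+ n / (1 - t%:C * z)) <= cmod z ^+ n.+1 / (1 - cmod z).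
  move=> t01; rewrite !cmodM cmodN cmodV cmodX.
  have h : cmod (t%:C * z) ^+ n <= cmod z ^+ n.
    apply: lerXn2r; rewrite ?nnegrE ?cmod_ge0// cmodM cmod_real.
    by case/andP: t01 => t0 t1; rewrite ger0_norm// ler_piMl ?cmod_ge0.
  have h2 : (cmod (1 - t%:C * z))^-1 <= (1 - cmod z)^-1.
    by rewrite lef_pV2 ?posrE ?w2// (lt_le_trans z10)// w2.
  rewrite exprS; apply: ler_pM => //.
  - by rewrite mulr_ge0 ?cmod_ge0 ?exprn_ge0 ?cmod_ge0.
  - by rewrite invr_ge0 cmod_ge0.
  - by rewrite ler_wpM2l ?cmod_ge0.
have dE t : 0 <= t <= 1 -> - z / (1 - t%:C * z) +
    \sum_(1 <= k < n.+1) z ^+ k * t%:C ^+ k.-1 = - z * (t%:C * z) ^+ n / (1 - t%:C * z).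
  move=> t01; apply: geometric_remainder; apply/eqP => E.
  by have := w2 _ t01; rewrite E subrr cmod0; lra.
have clogE : clog (1 - z) = (ln (1 + (- (2 * x)) * 1 + (x ^+ 2 + y ^+ 2) * 1 ^+ 2) / 2) +i*
    (atan (- (1 * y) / (1 - 1 * x))).
  have Rz : complex.Re (1 - z) = 1 - 1 * x by rewrite Ez /= mul1r.
  rewrite clog_atan ?Rz ?u0 ?lexx ?ler01//.
  have -> : complex.Im (1 - z) = - (1 * y) by rewrite Ez /= mul1r sub0r.
  congr (_ +i* _); have w0 : 0 < cmod (1 - z).
    by have := w2 1; rewrite mul1r lexx ler01 => /(_ isT); apply: lt_le_trans.
  have -> : 1 + (- (2 * x)) * 1 + (x ^+ 2 + y ^+ 2) * 1 ^+ 2 = cmod (1 - z) ^+ 2.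
    rewrite Ez /cmod/= sqr_sqrtr ?addr_ge0 ?sqr_ge0//; ring.
  by rewrite lnXn// -[_ *+ 2]mulr_natr mulfK ?pnatr_eq0.
have natC k : (k%:R : R[i]) = (k%:R : R)%:C by rewrite rmorph_nat.
have ReE : `|complex.Re (clog (1 - z) + \sum_(1 <= k < n.+1) z ^+ k / k%:R)| <=
  cmod z ^+ n.+1 / (1 - cmod z).
  pose f t := ln (1 + (- (2 * x)) * t + (x ^+ 2 + y ^+ 2) * t ^+ 2) / 2 +
    \sum_(1 <= k < n.+1) complex.Re (z ^+ k) * t ^+ k / k%:R.
  have -> : complex.Re (clog (1 - z) + \sum_(1 <= k < n.+1) z ^+ k / k%:R) = f 1 - f 0.
    have -> : f 0 = 0.
      rewrite /f big_nat big1 => [|k /andP[k0 _]].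
        by rewrite !mulr0 expr0n/= mulr0 !addr0 ln1 mul0r.
      by rewrite expr0n gtn_eqF// mulr0 mul0r.
    rewrite subr0 ReD clogE /f Re_sum/=; congr (_ + _); apply: eq_bigr => k _.
    by rewrite natC -fmorphV Re_mulr_real expr1n mulr1.
  apply: (@derive_bound f (fun t => complex.Re (- z * (t%:C * z) ^+ n / (1 - t%:C * z)))).
    move=> t t01; rewrite -dE// ReD Re_sum.
    apply: is_deriveD; first by rewrite Ez; apply: is_derive_ln_cmod; exact: u0.
    have := is_derive_psum (fun k => complex.Re (z ^+ k)) n t.
    congr (is_derive _ _ _ _); apply: eq_bigr => k _.
    by rewrite -rmorphXn Re_mulr_real.
  by move=> t t01; apply: le_trans (Re_le_cmod _) (dB _ t01).
have ImE : `|complex.Im (clog (1 - z) + \sum_(1 <= k < n.+1) z ^+ k / k%:R)| <=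
  cmod z ^+ n.+1 / (1 - cmod z).
  pose f t := atan (- (t * y) / (1 - t * x)) +
    \sum_(1 <= k < n.+1) complex.Im (z ^+ k) * t ^+ k / k%:R.
  have -> : complex.Im (clog (1 - z) + \sum_(1 <= k < n.+1) z ^+ k / k%:R) = f 1 - f 0.
    have -> : f 0 = 0.
      rewrite /f big_nat big1 => [|k /andP[k0 _]].
        by rewrite !mul0r oppr0 mul0r addr0 atan0.
      by rewrite expr0n gtn_eqF// mulr0 mul0r.
    rewrite subr0 ImD clogE /f Im_sum/=; congr (_ + _); apply: eq_bigr => k _.
    by rewrite natC -fmorphV Im_mulr_real expr1n mulr1.
  apply: (@derive_bound f (fun t => complex.Im (- z * (t%:C * z) ^+ n / (1 - t%:C * z)))).
    move=> t t01; rewrite -dE// ImD Im_sum.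
    apply: is_deriveD; first by rewrite Ez; apply: is_derive_atan_arg; exact: u0.
    have := is_derive_psum (fun k => complex.Im (z ^+ k)) n t.
    congr (is_derive _ _ _ _); apply: eq_bigr => k _.
    by rewrite -rmorphXn Im_mulr_real.
  by move=> t t01; apply: le_trans (Im_le_cmod _) (dB _ t01).
by apply: (le_trans (cmod_le _)); lra.
Qed.

Lemma clog_taylor_half z n : cmod z <= 2^-1 ->
  cmod (clog (1 - z) + \sum_(1 <= k < n.+1) z ^+ k / k%:R) <= 4 * cmod z ^+ n.+1.
Proof.
move=> z2; apply: le_trans (clog_taylor _ _) _; first by lra.
have -> : 4 * cmod z ^+ n.+1 = 2 * (cmod z ^+ n.+1 * 2) by ring.
rewrite ler_wpM2l// ler_wpM2l ?exprn_ge0 ?cmod_ge0//.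
by rewrite -[leRHS]invrK lef_pV2 ?posrE ?invr_gt0//; lra.
Qed.

Lemma clog_real (x : R) : x < 1 -> clog (1 - x%:C) = (ln (1 - x))%:C.
Proof.
move=> x1; have -> : 1 - x%:C = (1 - x)%:C by rewrite rmorphB.
rewrite clog_atan /= ?subr_gt0// mul0r atan0.
by rewrite expr0n addr0 sqrtr_sqr gtr0_norm ?subr_gt0.
Qed.

Lemma ln_taylor (x : R) n : 0 <= x < 1 ->
  `|ln (1 - x) + \sum_(1 <= k < n.+1) x ^+ k / k%:R| <= 2 * (x ^+ n.+1 / (1 - x)).
Proof.
move=> /andP[x0 x1]; have := @clog_taylor x%:C n.
rewrite cmod_real ger0_norm// clog_real// => /(_ x1).
have -> : \sum_(1 <= k < n.+1) x%:C ^+ k / k%:R = (\sum_(1 <= k < n.+1) x ^+ k / k%:R)%:C.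
  by rewrite rmorph_sum; apply: eq_bigr => k _; rewrite rmorphM fmorphV rmorph_nat rmorphXn.
by rewrite -rmorphD cmod_real.
Qed.
End ComplexLog.

(** The hypothesis is the identity ln n = sum of ln p over the prime powers p^k, k >= 1, dividing n.
    [L] takes its values in an arbitrary commutative ring so that the lemma serves both for the
    logarithm of N! and for complex character sums. *)
Lemma log_sum_exchange (K : comPzRingType) (F L : nat -> K) (N : nat) :
  (forall n, (0 < n <= N)%N ->
     L n = \sum_(0 <= p < N.+1 | prime p) \sum_(1 <= k < N.+1 | (p ^ k %| n)%N) L p) ->
  \sum_(1 <= n < N.+1) F n * L n =
  \sum_(0 <= p < N.+1 | prime p) \sum_(1 <= k < N.+1)
     L p * \sum_(1 <= j < (N %/ p ^ k).+1) F (p ^ k * j)%N.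
Proof.
move=> H; under eq_big_nat => n /andP[n0 nN].
  rewrite H ?n0// mulr_sumr; under eq_bigr do rewrite mulr_sumr big_mkcond/=.
  over.
rewrite exchange_big/=; apply: eq_bigr => p pp.
rewrite exchange_big/=; apply: eq_bigr => k _.
rewrite -big_mkcond/= -mulr_suml mulrC sum_multiples// expn_gt0.
by rewrite prime_gt0.
Qed.

(** * Chebyshev's bound and Mertens' first theorem *)

Section Primes.
Variable R : realType.

Lemma ln_natM (m n : nat) : (0 < m)%N -> (0 < n)%N ->
  ln (m * n)%:R = ln m%:R + ln n%:R :> R.
Proof. by move=> m0 n0; rewrite natrM lnM ?posrE ?ltr0n. Qed.

Lemma ln_nat_ge0 n : 0 <= ln n%:R :> R.
Proof. by case: n => [|n]; [rewrite ln0|rewrite ln_ge0// ler1n]. Qed.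

Lemma ln_nat_sum (N n : nat) : (0 < n <= N)%N ->
  ln n%:R = \sum_(0 <= p < N.+1 | prime p)
    \sum_(1 <= k < N.+1 | (p ^ k %| n)%N) ln p%:R :> R.
Proof.
move=> /andP[n0 nN]; apply: expR_inj; rewrite lnK ?posrE ?ltr0n//.
rewrite expR_sum -{1}(partnT n0) (@widen_partn N predT n nN) natr_prod.
rewrite [LHS]big_mkcond [RHS]big_mkcond; apply: eq_bigr => p _ /=.
case: ifPn => [pp|npp]; last by rewrite lognE (negbTE npp) expn0.
have p0 : (0 < p)%N by exact: prime_gt0.
have l1 : (logn p n <= N)%N.
  apply: leq_trans nN; apply: ltnW; apply: leq_trans (ltn_expl _ (prime_gt1 pp)) _.
  by apply: dvdn_leq => //; exact: pfactor_dvdnn.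
rewrite (eq_bigl (fun k => predT k && (k < (logn p n).+1)%N)); last first.
  by move=> k; rewrite pfactor_dvdn.
rewrite -big_nat_widen ?ltnS// sumr_const_nat subn1/=.
by rewrite -[X in expR X]mulr_natl expRM_natl lnK ?posrE ?ltr0n// natrX.
Qed.

Lemma central_binomial_le n : ('C(n.*2, n) <= 4 ^ n)%N.
Proof.
have : (\sum_(i < n.*2.+1) 'C(n.*2, i) = 2 ^ n.*2)%N.
  rewrite (_ : 2 = 1 + 1)%N // expnDn; apply: eq_bigr => i _.
  by rewrite !exp1n !muln1.
rewrite -mul2n expnM => <-.
have h : (n < (2 * n).+1)%N by lia.
by rewrite (bigD1 (Ordinal h))//= leq_addr.
Qed.

Definition theta (N : nat) : R := \sum_(0 <= p < N.+1 | prime p) ln p%:R.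

(** A prime in ]n, 2n] divides (2n)! but not n!, hence divides the central binomial coefficient; the
    product of these primes is then at most 4^n. *)
Lemma theta_double n : theta n.*2 <= theta n + (n%:R * ln 4).
Proof.
have -> : theta n.*2 = theta n + \sum_(n.+1 <= p < n.*2.+1 | prime p) ln p%:R.
  by rewrite /theta -(@big_cat_nat _ _ _ n.+1)//= ltnS -addnn leq_addr.
rewrite lerD2l -ler_expR expR_sum expRM_natl lnK ?posrE//.
rewrite (eq_bigr (fun p => p%:R)); last by move=> p /prime_gt0 p0; rewrite lnK ?posrE ?ltr0n.
rewrite -natr_prod -natrX ler_nat; apply: leq_trans (central_binomial_le n).
apply: dvdn_leq; first by rewrite bin_gt0 -addnn leq_addr.
apply/unstable.Gauss_dvd_prod => [|p].
  rewrite map_id; set s := [seq i <- _ | _].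
  have us : uniq s by rewrite filter_uniq// iota_uniq.
  rewrite uniq_pairwise in us; apply: (sub_in_pairwise (P := prime)) us; last first.
    by apply/allP => p; rewrite mem_filter => /andP[].
  by move=> p1 p2 pp1 pp2 /= np; rewrite prime_coprime// dvdn_prime2.
rewrite mem_index_iota => /andP[np pn] pp.
have : (p %| (n.*2)`!)%N by rewrite dvdn_fact// prime_gt0//= -ltnS.
have nn : (n <= n.*2)%N by rewrite -addnn leq_addr.
rewrite -(bin_fact nn) -addnn addnK !Euclid_dvdM// => /orP[//|].
have h : logn p n`! = 0%N.
  rewrite logn_fact// big_nat big1// => k /andP[k0 _]; apply: divn_small.
  by rewrite (leq_trans np)// -{1}(expn1 p) leq_pexp2l// prime_gt0.
by rewrite orbb -(expn1 p) pfactor_dvdn ?fact_gt0// h.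
Qed.

Lemma theta_le N : theta N <= N%:R * (2 * ln 4).
Proof.
have l4 : 0 <= ln 4 :> R by rewrite ln_ge0// ler1n.
elim/ltn_ind: N => N IH.
have [N1|N1] := leqP N 1.
  rewrite /theta big_nat_cond big1 ?mulr_ge0//= => p /andP[pN /prime_gt1 p1].
  by move: pN; rewrite ltnS leqNgt (leq_ltn_trans N1 p1).
pose m := uphalf N.
have mN : (m < N)%N by rewrite /m; lia.
have Nm : (N <= m.*2)%N by rewrite /m; lia.
apply: (@le_trans _ _ (theta m.*2)).
  rewrite /theta [leRHS](@big_cat_nat _ _ _ N.+1)//= lerDl sumr_ge0// => p _.
  exact: ln_nat_ge0.
apply: (le_trans (theta_double m)); apply: (le_trans (lerD (IH _ mN) (lexx _))).
(* The induction gives at most 3 m ln 4. The factor 2 in the statement absorbs the rounding in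
   [m = uphalf N], given that N >= 2 here. *)
have : (3 * m)%N%:R <= (2 * N)%N%:R :> R by rewrite ler_nat /m; lia.
rewrite !natrM; nra.
Qed.

Lemma ln_fact_lower N : N%:R * ln N%:R - N%:R <= \sum_(1 <= n < N.+1) ln n%:R :> R.
Proof.
elim: N => [|N IH]; first by rewrite big_geq// mul0r subr0.
rewrite big_nat_recr//=; case: N IH => [_|N IH].
  by rewrite big_geq// ln1 mulr0; lra.
set a := N.+1 in IH *; have a0 : 0 < a%:R :> R by rewrite ltr0n.
have h : ln a.+1%:R - ln a%:R <= a%:R^-1 :> R.
  rewrite -ln_div ?posrE ?ltr0n// -natr1 mulrDl divff ?gt_eqF// mul1r.
  by apply: le_ln1Dx; apply: lt_trans (_ : 0 < _); rewrite ?invr_gt0 ?ltrN10.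
have : a%:R * (ln a.+1%:R - ln a%:R) <= 1 :> R.
  by rewrite mulrC -ler_pdivlMr// mul1r.
rewrite -natr1; move: IH; lra.
Qed.

Lemma ln_fact_upper N : \sum_(1 <= n < N.+1) ln n%:R <= N%:R * ln N%:R :> R.
Proof.
apply: (@le_trans _ _ (\sum_(1 <= n < N.+1) ln N%:R)).
  apply: ler_sum_nat => n /andP[n0 nN].
  by rewrite ler_ln ?posrE ?ltr0n ?ler_nat// (leq_trans n0).
by rewrite sumr_const_nat subn1 mulr_natl.
Qed.

Lemma sum_inv_consecutive N : \sum_(2 <= n < N.+1) (n%:R * n.-1%:R)^-1 <= 1 :> R.
Proof.
have [N1|N1] := ltnP N 1; first by rewrite big_geq// ltnW// ltnS.
suff -> : \sum_(2 <= n < N.+1) (n%:R * n.-1%:R)^-1 = 1 - N%:R^-1 :> R.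
  by rewrite gerBl invr_ge0.
elim: N N1 => // -[_ _|N IH _]; first by rewrite big_geq// invr1 subrr.
rewrite big_nat_recr//= IH// -[N.+2%:R]natr1; set a : R := N.+1%:R.
have a0 : 0 < a by rewrite ltr0n.
by field; apply/andP; split; rewrite gt_eqF//; lra.
Qed.

Lemma sum_ln_consecutive N : \sum_(2 <= n < N.+1) ln n%:R / (n%:R * n.-1%:R) <= 2 :> R.
Proof.
have [N1|N1] := ltnP N 1; first by rewrite big_geq// ltnW// ltnS.
(* -(ln x + 1) / x is an antiderivative of ln x / x^2; the additional sum of 1 / (n (n - 1)) absorbs
   the error of the comparison. *)
suff H : \sum_(2 <= n < N.+1) ln n%:R / (n%:R * n.-1%:R) <=
    1 - (ln N%:R + 1) / N%:R + \sum_(2 <= n < N.+1) (n%:R * n.-1%:R)^-1 :> R.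
  have := sum_inv_consecutive N; have : 0 <= (ln N%:R + 1) / N%:R :> R.
    by rewrite divr_ge0// addr_ge0 ?ln_nat_ge0.
  by lra.
elim: N N1 => // -[_ _|N IH _]; first by rewrite !big_geq// ln1 divr1; lra.
rewrite !(@big_nat_recr _ _ _ N.+2 2)//=.
set S := \sum_(2 <= n < N.+2) ln _ / _ in IH *; set T := \sum_(2 <= n < N.+2) _ in IH *.
have := IH isT; set a : R := N.+1%:R; set b : R := N.+2%:R.
have a0 : 1 <= a by rewrite ler1n.
have ab : b = a + 1 by rewrite /a /b natr1.
have h : ln b - ln a <= a^-1.
  have a1 : 0 < a by lra.
  rewrite -ln_div ?posrE ?ltr0n// ab mulrDl divff ?gt_eqF// mul1r.
  by apply: le_ln1Dx; rewrite (lt_trans (ltrN10 R))// invr_gt0.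
have h2 : ln b / (b * a) <= (ln a + 1) / a - (ln b + 1) / b + (b * a)^-1.
  rewrite -subr_ge0.
  have -> : (ln a + 1) / a - (ln b + 1) / b + (b * a)^-1 - ln b / (b * a) =
      (2 - b * (ln b - ln a)) / (a * b).
    by rewrite ab; field; apply/andP; split; rewrite gt_eqF//; lra.
  apply: divr_ge0; last by rewrite mulr_ge0//; lra.
  have h3 : b * (ln b - ln a) <= b * a^-1 by rewrite ler_wpM2l//; lra.
  by rewrite subr_ge0 (le_trans h3)// ler_pdivrMr; lra.
by clearbody a b S T; lra.
Qed.

Lemma sum_inv_pow (x : R) N : 2 <= x ->
  \sum_(2 <= k < N.+1) (x ^+ k)^-1 <= (x * (x - 1))^-1.
Proof.
move=> x2; have x0 : 0 < x by lra.
(* The remainder is that of the geometric series; [maxn N 1] covers [N = 0], where the sum is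
   already empty. *)
suff H : \sum_(2 <= k < N.+1) (x ^+ k)^-1 <= (x * (x - 1))^-1 - (x ^+ maxn N 1 * (x - 1))^-1.
  apply: le_trans H _; rewrite gerBl invr_ge0 mulr_ge0 ?exprn_ge0//; lra.
elim: N => [|[|N] IH].
- by rewrite big_geq// expr1 subrr.
- by rewrite big_geq// expr1 subrr.
have mx k : maxn k.+1 1 = k.+1 by rewrite (maxn_idPl _).
move: IH; rewrite !mx => IH; rewrite big_nat_recr//=.
apply: (le_trans (lerD IH (lexx _))); rewrite -addrA lerD2l.
rewrite [x ^+ N.+2]exprS; set y := x ^+ N.+1.
have y0 : 0 < y by rewrite exprn_gt0.
by rewrite le_eqVlt; apply/orP; left; apply/eqP; field; rewrite !gt_eqF//; lra.
Qed.

Lemma sum_primes_le (F : nat -> R) N : (forall n, (2 <= n)%N -> 0 <= F n) ->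
  \sum_(0 <= p < N | prime p) F p <= \sum_(2 <= n < N) F n.
Proof.
move=> F0; have [N2|N2] := leqP N 2.
  rewrite [leRHS]big_geq// big_nat_cond big1// => p /andP[/andP[_ pN] /prime_gt1 p1].
  by rewrite ltnNge (leq_trans N2) in pN.
rewrite [leLHS]big_mkcond/= [leLHS](@big_cat_nat _ _ _ 2)//=; last exact: ltnW.
rewrite [X in X + _]big_nat [X in X + _]big1 ?add0r => [|[|[|p]]//].
by apply: ler_sum_nat => p /andP[p2 _]; case: ifP => // _; exact: F0.
Qed.

Lemma sum_ln_prime_consecutive N :
  \sum_(0 <= p < N.+1 | prime p) ln p%:R / (p%:R * p.-1%:R) <= 2 :> R.
Proof.
apply: le_trans (sum_ln_consecutive N); apply: sum_primes_le => p _.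
by rewrite divr_ge0 ?ln_nat_ge0// mulr_ge0.
Qed.

(** ln N! is evaluated by weak Stirling bounds and by prime powers with the integer parts of N /
    p^k. In the constant, [2 * ln 4] bounds [theta N / N], the price of dropping the integer parts
    for k = 1, and 3 is the sum of 2 for the powers k >= 2 and 1 for the Stirling lower bound. *)
Lemma mertens1 : exists C : R, forall N : nat, (0 < N)%N ->
  `|\sum_(0 <= p < N.+1 | prime p) ln p%:R / p%:R - ln N%:R| <= C.
Proof.
exists (2 * ln 4 + 3) => N N0.
have l4 : 0 <= ln 4 :> R by rewrite ln_ge0// ler1n.
have Nr : 0 < N%:R :> R by rewrite ltr0n.
set S := \sum_(0 <= p < N.+1 | prime p) _.
have E := @log_sum_exchange R (fun=> 1) (fun n => ln n%:R) N (@ln_nat_sum N).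
rewrite (eq_bigr (fun n => ln n%:R)) in E; last by move=> *; rewrite mul1r.
have lo := ln_fact_lower N; have up := ln_fact_upper N; rewrite E in lo up.
set T := \sum_(0 <= p < N.+1 | prime p) \sum_(1 <= k < N.+1) _ in lo up.
have TE : T = \sum_(0 <= p < N.+1 | prime p) \sum_(1 <= k < N.+1) ln p%:R * (N %/ p ^ k)%N%:R.
  apply: eq_bigr => p pp; apply: eq_bigr => k _; congr (_ * _).
  by rewrite sumr_const_nat subn1.
have divle p k : (0 < p)%N -> (N %/ p ^ k)%N%:R <= N%:R / p%:R ^+ k :> R.
  move=> p0; rewrite ler_pdivlMr ?exprn_gt0 ?ltr0n// -natrX -natrM ler_nat.
  exact: leq_trunc_div.
have h1 : N%:R * S <= T + theta N.
  rewrite TE /theta -big_split/= mulr_sumr; apply: ler_sum => p pp.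
  have p0 := prime_gt0 pp; have pr : 0 < p%:R :> R by rewrite ltr0n.
  rewrite (big_ltn (n := N.+1))//= expn1.
  apply: (@le_trans _ _ (ln p%:R * (N %/ p)%N%:R + ln p%:R)).
    rewrite mulrCA -[X in _ + X]mulr1 -mulrDr ler_wpM2l ?ln_nat_ge0//.
    by rewrite natr1 ler_pdivrMr// -natrM ler_nat ltnW// ltn_ceil.
  by rewrite lerD2r lerDl sumr_ge0// => k _; rewrite mulr_ge0 ?ln_nat_ge0.
have h2 : T <= N%:R * S + N%:R * 2.
  apply: (@le_trans _ _ (N%:R * S + N%:R * \sum_(0 <= p < N.+1 | prime p) ln p%:R / (p%:R * p.-1%:R))).
    rewrite TE !mulr_sumr -big_split/=; apply: ler_sum => p pp.
    have p0 := prime_gt0 pp; have pr : 0 < p%:R :> R by rewrite ltr0n.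
    rewrite (big_ltn (n := N.+1))//= lerD//.
      by rewrite mulrCA ler_wpM2l ?ln_nat_ge0//; have := divle p 1 p0; rewrite expr1.
    apply: (@le_trans _ _ (ln p%:R * (N%:R * \sum_(2 <= k < N.+1) (p%:R ^+ k)^-1))).
      rewrite !mulr_sumr; apply: ler_sum => k _.
      by rewrite ler_wpM2l ?ln_nat_ge0// divle.
    rewrite mulrCA ler_wpM2l// ler_wpM2l ?ln_nat_ge0//.
    have : 2 <= p%:R :> R by rewrite ler_nat prime_gt1.
    move/(sum_inv_pow N); suff -> : p%:R - 1 = p.-1%:R :> R by [].
    by rewrite -[in LHS](prednK p0) -natr1 addrK.
  by rewrite lerD2l ler_wpM2l// sum_ln_prime_consecutive.
have th := theta_le N; have Nl4 := mulr_ge0 (ltW Nr) l4.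
move: S T lo up h1 h2 {E TE} => S T lo up h1 h2.
rewrite ler_norml; apply/andP; split.
- suff : N%:R * (ln N%:R - S) <= N%:R * (2 * ln 4 + 3).
    by rewrite ler_pM2l//; lra.
  by lra.
- suff : N%:R * (S - ln N%:R) <= N%:R * (2 * ln 4 + 3).
    by rewrite ler_pM2l//; lra.
  by lra.
Qed.
End Primes.

(** * Elementary limits and monotonicity for the logarithm *)

Section Limits.
Variable R : realType.

Lemma cvg_invn : ((fun n : nat => n%:R^-1 : R) @ \oo --> (0 : R)).
Proof. by rewrite -cvg_shiftS; exact: cvg_harmonic. Qed.

Lemma ln_nat_large (M : R) : exists n0 : nat, forall n, (n0 <= n)%N -> M <= ln n%:R.
Proof.
exists (Num.truncn (expR M)).+1 => n nn.
have h : expR M <= n%:R.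
  by apply: le_trans (ltW (truncnS_gt _)) _; rewrite ler_nat.
by rewrite -[M]expRK ler_ln ?posrE ?expR_gt0// (lt_le_trans _ h) ?expR_gt0.
Qed.

Lemma ln_natS_le (n : nat) : (0 < n)%N -> ln n.+1%:R - ln n%:R <= n%:R^-1 :> R.
Proof.
move=> n0; have nr : 0 < n%:R :> R by rewrite ltr0n.
rewrite -ln_div ?posrE ?ltr0n// -natr1 mulrDl divff ?gt_eqF// mul1r.
by apply: le_ln1Dx; rewrite (lt_trans (ltrN10 R))// invr_gt0.
Qed.

Lemma ln_natS_ge (n : nat) : (0 < n)%N -> n.+1%:R^-1 <= ln n.+1%:R - ln n%:R :> R.
Proof.
move=> n0; rewrite -lerN2 opprB -ln_div ?posrE ?ltr0n//.
have -> : n%:R / n.+1%:R = 1 + (- n.+1%:R^-1) :> R.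
  by rewrite -[n%:R](addrK 1) natr1 mulrBl divff ?pnatr_eq0 ?mul1r.
by apply: le_ln1Dx; rewrite ltrN2 invf_lt1 ?ltr1n ?ltr0n.
Qed.

Lemma ler_ln_natS (n : nat) : ln n%:R <= ln n.+1%:R :> R.
Proof.
case: n => [|n]; first by rewrite ln0// ln_nat_ge0.
by rewrite ler_ln ?posrE ?ltr0n// ler_nat.
Qed.

Lemma cvg_inv_ln : ((fun n : nat => (ln n%:R)^-1 : R) @ \oo --> (0 : R)).
Proof.
apply/cvgrPdist_le => e e0; have [n0 h] := ln_nat_large e^-1.
exists n0 => // n /= /h hn; rewrite sub0r normrN.
have e1 : 0 < e^-1 by rewrite invr_gt0.
by rewrite ger0_norm ?invr_ge0 ?ln_nat_ge0// invf_ple ?posrE// (lt_le_trans e1).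
Qed.

Lemma inv_ln_decr n : (2 <= n)%N -> (ln n.+1%:R)^-1 <= (ln n%:R)^-1 :> R.
Proof.
move=> n2; rewrite lef_pV2 ?posrE ?ln_gt0 ?ltr1n ?ler_ln_natS//.
exact: ltnW.
Qed.

(** The inequality amounts to n (ln (n + 1) - ln n) <= ln n, and its left-hand side is at most 1.
    The range starts at 4 because [1 <= ln 4] follows from the crude bound 1/2 <= ln 2. *)
Lemma ln_div_decr n : (4 <= n)%N -> ln n.+1%:R / n.+1%:R <= ln n%:R / n%:R :> R.
Proof.
move=> n4; have n0 : (0 < n)%N by apply: leq_trans n4.
have nr : 0 < n%:R :> R by rewrite ltr0n.
have ln2 : 2^-1 <= ln 2 :> R.
  have : ln (1 + (- 2^-1)) <= - 2^-1 :> R by apply: le_ln1Dx; lra.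
  have -> : 1 + - 2^-1 = 2^-1 :> R by lra.
  by rewrite lnV ?posrE//; lra.
have l1 : 1 <= ln n%:R :> R.
  apply: (@le_trans _ _ (ln 4)); last by rewrite ler_ln ?posrE// ler_nat.
  by have -> : 4 = 2 * 2 :> R; [lra|rewrite lnM ?posrE//; lra].
rewrite ler_pdivrMr ?ltr0n// mulrAC ler_pdivlMr// -natr1.
have := ln_natS_le n0; rewrite -[_^-1]mul1r ler_pdivlMr// -natr1; lra.
Qed.
End Limits.

(** * Partial sums and Euler products of L-series *)

Section CharacterSums.
Variables (R : realType) (chi : nat -> R[i]) (Q : R).
Hypothesis chiM : forall m n, chi (m * n)%N = chi m * chi n.
Hypothesis chi_le1 : forall n, cmod (chi n) <= 1.
Hypothesis chiQ : forall N, cmod (\sum_(0 <= n < N) chi n) <= Q.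

Definition Lpartial (N : nat) : R[i] := \sum_(1 <= n < N.+1) chi n / n%:R.

Let Q0 : 0 <= Q. Proof. by apply: le_trans (chiQ 0); exact: cmod_ge0. Qed.

Let ReQ N : `|\sum_(0 <= n < N) complex.Re (chi n)| <= Q.
Proof. by rewrite -Re_sum (le_trans (Re_le_cmod _)). Qed.
Let ImQ N : `|\sum_(0 <= n < N) complex.Im (chi n)| <= Q.
Proof. by rewrite -Im_sum (le_trans (Im_le_cmod _)). Qed.

Lemma natC_inv (n : nat) : (n%:R : R[i])^-1 = (n%:R^-1 : R)%:C.
Proof. by rewrite fmorphV rmorph_nat. Qed.

(** Dirichlet's test is applied to the real and the imaginary parts, with an error 2 Q / (N + 1) for
    each. The rate matters in [sum_chi_prime_ln_bounded], where the errors at N / p are summed over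
    all primes up to N. *)
Lemma Lpartial_cvg : exists L : R[i], forall N, cmod (L - Lpartial N) <= 4 * Q / N.+1%:R.
Proof.
have decr n : (1 <= n)%N -> n.+1%:R^-1 <= n%:R^-1 :> R.
  by move=> n1; rewrite lef_pV2 ?posrE ?ltr0n// ler_nat.
have [_ hR] := dirichlet_test ReQ decr (@cvg_invn R).
have [_ hI] := dirichlet_test ImQ decr (@cvg_invn R).
move: hR hI; set LR := limn _; set LI := limn _ => hR hI.
exists (LR +i* LI) => N; apply: le_trans (cmod_le _) _.
(* The term of index 0 vanishes because the inverse of 0 is 0. *)
have E (u : nat -> R) : \sum_(0 <= i < N.+1) u i * i%:R^-1 = \sum_(1 <= i < N.+1) u i * i%:R^-1.
  by rewrite big_ltn//= invr0 mulr0 add0r.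
have -> : complex.Re ((LR +i* LI) - Lpartial N) =
    LR - \sum_(0 <= i < N.+1) complex.Re (chi i) * i%:R^-1.
  rewrite -[- Lpartial N]mulN1r ReD -[-1](rmorphN1 (real_complex R)) mulrC Re_mulr_real mulrN1.
  rewrite Re_sum E; congr (_ - _).
  by apply: eq_bigr => i _; rewrite natC_inv Re_mulr_real.
have -> : complex.Im ((LR +i* LI) - Lpartial N) =
    LI - \sum_(0 <= i < N.+1) complex.Im (chi i) * i%:R^-1.
  rewrite -[- Lpartial N]mulN1r ImD -[-1](rmorphN1 (real_complex R)) mulrC Im_mulr_real mulrN1.
  rewrite Im_sum E; congr (_ - _).
  by apply: eq_bigr => i _; rewrite natC_inv Im_mulr_real.
have := hR _ (ltn0Sn N); have := hI _ (ltn0Sn N).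
by move=> {}hI {}hR; apply: le_trans (lerD hR hI) _; rewrite -!mulrDl -natrD.
Qed.

Variable L : R[i].
Variable C : R.
Hypothesis LC : forall N, cmod (L - Lpartial N) <= C / N.+1%:R.

Lemma Lpartial_bounded N : cmod (Lpartial N) <= cmod L + C.
Proof.
have C0 : 0 <= C by have := LC 0; rewrite divr1; apply: le_trans; exact: cmod_ge0.
have -> : Lpartial N = L - (L - Lpartial N) by rewrite opprB addrC subrK.
apply: le_trans (cmodD _ _) _; rewrite cmodN lerD2l (le_trans (LC N))//.
by rewrite ler_pdivrMr ?ltr0n// ler_peMr// ler1n.
Qed.

Lemma cmod_chi_div n : cmod (chi n / n%:R) <= n%:R^-1.
Proof.
by rewrite natC_inv cmodM cmod_real ger0_norm ?invr_ge0// ler_piMl ?invr_ge0.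
Qed.

Lemma sum_chi_ln_bounded : exists K : R, forall N,
  cmod (\sum_(1 <= n < N.+1) chi n / n%:R * (ln n%:R)%:C) <= K.
Proof.
pose b n := ln n%:R / n%:R : R.
have b0 n : 0 <= b n by rewrite divr_ge0 ?ln_nat_ge0.
have E n : chi n / n%:R * (ln n%:R)%:C = chi n * (b n)%:C.
  by rewrite /b natC_inv rmorphM -mulrA [X in _ * X]mulrC.
have hb n : cmod (chi n * (b n)%:C) <= b n.
  by rewrite cmodM cmod_real (ger0_norm (b0 n)) ler_piMl.
exists (\sum_(1 <= n < 4) b n + 4 * Q * b 4) => N.
under eq_bigr do rewrite E.
have h4 : 0 <= 4 * Q * b 4 by apply: mulr_ge0 => //; apply: mulr_ge0.
have small M : (M <= 4)%N -> cmod (\sum_(1 <= n < M) chi n * (b n)%:C) <= \sum_(1 <= n < 4) b n.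
  move=> M4; apply: le_trans (cmod_sum _ _ _) _.
  apply: (@le_trans _ _ (\sum_(1 <= n < M) b n)); first exact: ler_sum.
  have [M1|M1] := leqP M 1; first by rewrite big_geq// sumr_ge0.
  by rewrite [leRHS](@big_cat_nat _ _ _ M)//= ?lerDl ?sumr_ge0// ltnW.
have [N4|N4] := leqP N.+1 4; first by apply: le_trans (small _ N4) _; rewrite lerDl.
rewrite (@big_cat_nat _ _ _ 4)//=; last exact: ltnW.
apply: le_trans (cmodD _ _) _; apply: lerD; first exact: small.
have h (a : nat -> R) : (forall N, `|\sum_(0 <= n < N) a n| <= Q) ->
    `|\sum_(4 <= n < N.+1) a n * b n| <= 2 * Q * b 4.
  by move=> aQ; apply: abel_bound => // n n4; apply: ln_div_decr.
apply: le_trans (cmod_le _) _; rewrite Re_sum Im_sum.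
under eq_bigr do rewrite Re_mulr_real.
under [X in _ + `|X|]eq_bigr do rewrite Im_mulr_real.
by apply: le_trans (lerD (h _ ReQ) (h _ ImQ)) _; rewrite -!mulrDl -natrD.
Qed.

(** Expand ln n over prime powers in the bounded sum of chi(n) ln n / n. The prime p contributes
    chi(p) ln p / p times the partial sum of the series up to N / p, which is [L] up to O(p / N);
    these errors add up to O(theta(N) / N), which is bounded by Chebyshev. It remains to divide by
    [L]. *)
Lemma sum_chi_prime_ln_bounded : L != 0 -> exists K : R, forall N,
  cmod (\sum_(0 <= p < N | prime p) chi p * (ln p%:R / p%:R)%:C) <= K.
Proof.
move=> L0; have [K hK] := sum_chi_ln_bounded.
have C0 : 0 <= C by have := LC 0; rewrite divr1; apply: le_trans; exact: cmod_ge0.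
have cL : 0 < cmod L by rewrite lt_neqAle cmod_ge0 eq_sym cmod_eq0 L0.
pose CB := cmod L + C; have CB0 : 0 <= CB by rewrite addr_ge0// cmod_ge0.
have K0 : 0 <= K by apply: le_trans (hK 0); exact: cmod_ge0.
have l4 : 0 <= ln 4 :> R by rewrite ln_ge0// ler1n.
(* [K] bounds the sum with ln n, [CB * 2] the prime powers of exponent at least 2, and
   [C * (2 * ln 4)] the replacement of the partial sums by [L]. *)
exists ((K + CB * 2 + C * (2 * ln 4)) / cmod L).
have B0 : 0 <= K + CB * 2 + C * (2 * ln 4).
  by apply: addr_ge0; [apply: addr_ge0|]; rewrite ?mulr_ge0.
case=> [|N]; first by rewrite big_geq// cmod0; apply: divr_ge0 => //; exact: ltW.
rewrite ler_pdivlMr// mulrC -cmodM.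
set D := \sum_(0 <= p < _ | _) _.
have inner d : (0 < d)%N -> \sum_(1 <= j < (N %/ d).+1) chi (d * j)%N / (d * j)%N%:R =
    chi d / d%:R * Lpartial (N %/ d).
  move=> d0; rewrite /Lpartial mulr_sumr; apply: eq_bigr => j _.
  by rewrite chiM natrM invfM mulrACA.
have := hK N; rewrite (@log_sum_exchange _ (fun n => chi n / n%:R) (fun n => (ln n%:R)%:C));
  last first.
  move=> n nN; rewrite (ln_nat_sum _ nN) rmorph_sum; apply: eq_bigr => p _.
  by rewrite rmorph_sum.
set W := \sum_(0 <= p < _ | _) _ => hW.
pose T := \sum_(0 <= p < N.+1 | prime p) (ln p%:R)%:C * (chi p / p%:R * Lpartial (N %/ p)).
pose U := \sum_(0 <= p < N.+1 | prime p) \sum_(2 <= k < N.+1)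
   (ln p%:R)%:C * (chi (p ^ k)%N / (p ^ k)%N%:R * Lpartial (N %/ p ^ k)).
have WE : W = T + U.
  rewrite /W /T /U -big_split/= [LHS]big_nat_cond [RHS]big_nat_cond.
  apply: eq_bigr => p /andP[/andP[_ pN] pp].
  have p0 := prime_gt0 pp.
  have N0 : (0 < N)%N by apply: leq_trans (prime_gt0 pp) _; rewrite -ltnS.
  rewrite big_ltn// expn1 inner//; congr (_ + _); apply: eq_bigr => k _.
  by rewrite inner// expn_gt0 p0.
have hU : cmod U <= CB * 2.
  apply: le_trans (cmod_sum _ _ _) _.
  apply: (@le_trans _ _ (CB * \sum_(0 <= p < N.+1 | prime p) ln p%:R / (p%:R * p.-1%:R))).
    rewrite mulr_sumr; apply: ler_sum => p pp.
    have p0 := prime_gt0 pp.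
    apply: le_trans (cmod_sum _ _ _) _.
    apply: (@le_trans _ _ (CB * (ln p%:R * \sum_(2 <= k < N.+1) (p%:R ^+ k)^-1))).
      rewrite !mulr_sumr; apply: ler_sum => k _.
      rewrite cmodM cmod_real ger0_norm ?ln_nat_ge0// mulrCA ler_wpM2l ?ln_nat_ge0//.
      rewrite cmodM mulrC -natrX; apply: ler_pM; rewrite ?cmod_ge0//.
        exact: Lpartial_bounded.
      exact: cmod_chi_div.
    rewrite ler_wpM2l// ler_wpM2l ?ln_nat_ge0//.
    have : 2 <= p%:R :> R by rewrite ler_nat prime_gt1.
    move/(sum_inv_pow N); suff -> : p%:R - 1 = p.-1%:R :> R by [].
    by rewrite -[in LHS](prednK p0) -natr1 addrK.
  rewrite ler_wpM2l//; exact: sum_ln_prime_consecutive.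
have hD : cmod (L * D - T) <= C * (2 * ln 4).
  rewrite /D /T mulr_sumr -sumrB; apply: le_trans (cmod_sum _ _ _) _.
  case: N hK @D @W hW @T @U WE hU inner => [|N] hK D W hW T U WE hU inner.
    rewrite big_nat_cond big1 ?mulr_ge0// => p /andP[/andP[_]].
    by rewrite ltnS leqn0 => /eqP ->.
  have Nr : 0 < N.+1%:R :> R by rewrite ltr0n.
  apply: (@le_trans _ _ (C * (theta R N.+1 / N.+1%:R))); last first.
    by rewrite ler_wpM2l// ler_pdivrMr// mulrC theta_le.
  rewrite /theta mulr_suml mulr_sumr; apply: ler_sum => p pp.
  have p0 := prime_gt0 pp; have pr : 0 < p%:R :> R by rewrite ltr0n.
  have -> : L * (chi p * (ln p%:R / p%:R)%:C) -
    (ln p%:R)%:C * (chi p / p%:R * Lpartial (N.+1 %/ p)) =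
     (ln p%:R)%:C * (chi p / p%:R * (L - Lpartial (N.+1 %/ p))).
    by rewrite natC_inv rmorphM; ring.
  rewrite cmodM cmod_real ger0_norm ?ln_nat_ge0// [leRHS]mulrCA ler_wpM2l ?ln_nat_ge0//.
  rewrite cmodM.
  apply: (@le_trans _ _ (p%:R^-1 * (C / (N.+1 %/ p).+1%:R))).
    apply: ler_pM; [exact: cmod_ge0|exact: cmod_ge0|exact: cmod_chi_div|exact: LC].
  (* The error of the partial sum has the integer part plus one in its denominator, and p times that
     exceeds the upper limit of the sum. *)
  rewrite mulrCA ler_wpM2l// -invfM lef_pV2 ?posrE ?mulr_gt0 ?ltr0n//.
  by rewrite -natrM ler_nat mulnC ltnW// ltn_ceil.
have -> : L * D = (L * D - T) + (W - U) by rewrite WE addrK subrK.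
apply: le_trans (cmodD _ _) _; rewrite addrC lerD//.
by apply: le_trans (cmodD _ _) _; rewrite cmodN lerD.
Qed.
End CharacterSums.

(** * Limits of complex sequences by real and imaginary parts *)

Section ComplexLimits.
Variable R : realType.
Implicit Types (u : nat -> R[i]) (l : R[i]).

Lemma cvg_complex u l :
  ((fun n => complex.Re (u n)) @ \oo --> complex.Re l) ->
  ((fun n => complex.Im (u n)) @ \oo --> complex.Im l) ->
  (u : nat -> (R[i] : numFieldType)) @ \oo --> (l : (R[i] : numFieldType)).
Proof.
move=> /cvgrPdist_lt hR /cvgrPdist_lt hI; apply/cvgrPdist_lt => e e0.
have [Ie Re0] : complex.Im e = 0 /\ 0 < complex.Re e.
  by move: e0; rewrite ltcE /= => /andP[/eqP -> ->].
have e2 : 0 < complex.Re e / 2 by rewrite divr_gt0.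
near=> n.
rewrite cmodE ltcE Ie eqxx/=; apply: le_lt_trans (cmod_le _) _.
have h1 : `|complex.Re l - complex.Re (u n)| < complex.Re e / 2 by near: n; exact: hR.
have h2 : `|complex.Im l - complex.Im (u n)| < complex.Re e / 2 by near: n; exact: hI.
rewrite [complex.Re e]splitr ltrD//.
  by case: (l) (u n) h1 => [? ?] [].
by case: (l) (u n) h2 => [? ?] [].
Unshelve. all: by end_near. Qed.

Lemma cvg_complexP u l (e : R) :
  (u : nat -> (R[i] : numFieldType)) @ \oo --> (l : (R[i] : numFieldType)) -> 0 < e ->
  \forall n \near \oo, cmod (l - u n) < e.
Proof.
move=> /cvgrPdist_lt h e0; have := h e%:C; rewrite ltcR => /(_ e0).
by apply: filterS => n; rewrite cmodE ltcR.
Qed.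
End ComplexLimits.

Section PrimeSums.
Variables (R : realType).

(** Dirichlet's test with the weights 1 / ln n, nonincreasing from n = 2 on, removes the factor ln
    p. *)
Lemma dirichlet_prime_sum (r : nat -> R) (K : R) :
  (forall N, `|\sum_(0 <= p < N | prime p) r p * (ln p%:R / p%:R)| <= K) ->
  cvgn (fun N => \sum_(0 <= p < N | prime p) r p / p%:R).
Proof.
move=> h; pose a n : R := if prime n then r n * (ln n%:R / n%:R) else 0.
have [||cv _] := @dirichlet_test R a (fun n => (ln n%:R)^-1) K 2 _ _ (@cvg_inv_ln R).
- by move=> N; rewrite /a -big_mkcond.
- by move=> n; exact: inv_ln_decr.
suff -> : (fun N => \sum_(0 <= p < N | prime p) r p / p%:R) =
  series (fun i => a i * (ln i%:R)^-1) by [].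
apply/funext => N; rewrite /series/= big_mkcond; apply: eq_bigr => p _.
rewrite /a; case: ifPn => pp; last by rewrite mul0r.
have lp : ln p%:R != 0 :> R by rewrite gt_eqF// ln_gt0// ltr1n prime_gt1.
by rewrite mulrA mulrAC mulfK.
Qed.
End PrimeSums.

(** * Truncated Euler products of completely multiplicative functions *)

Section EulerProduct.
Variables (R : realType) (f : nat -> R[i]) (w : nat -> R) (W : R).
Hypothesis f1 : f 1%N = 1.
Hypothesis fM : forall m n, f (m * n)%N = f m * f n.
Hypothesis fw : forall n, (0 < n)%N -> cmod (f n) <= w n.
Hypothesis wW : forall N, \sum_(1 <= n < N.+1) w n <= W.

(** The k-rough integers of sieve theory; among the positive ones below k, only 1 qualifies. *)
Definition rough (k n : nat) := all (fun p => ~~ (prime p && (p %| n)%N)) (iota 0 k).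

Let w0 n : (0 < n)%N -> 0 <= w n.
Proof. by move=> n0; apply: le_trans (fw n0); exact: cmod_ge0. Qed.

Lemma roughS k n : rough k.+1 n = rough k n && ~~ (prime k && (k %| n)%N).
Proof. by rewrite /rough -addn1 iotaD all_cat/= add0n andbT. Qed.

Lemma rough_ge k n : (2 <= n)%N -> rough k n -> (k <= n)%N.
Proof.
move=> n2 /allP h; rewrite leqNgt; apply/negP => nk.
have := h (pdiv n); rewrite mem_iota add0n leq0n/= pdiv_prime// pdiv_dvd => /(_ _)/= H.
have : (pdiv n < k)%N by apply: leq_ltn_trans nk; apply: pdiv_leq; apply: leq_trans n2.
by move=> /H.
Qed.

Lemma rough_mul k j : prime k -> rough k (k * j) = rough k j.
Proof.
move=> pk; apply: eq_in_all => p; rewrite mem_iota/= add0n => pk'.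
case pp : (prime p) => //=; congr (~~ _).
by rewrite Euclid_dvdM// dvdn_prime2// ltn_eqF.
Qed.

Let T k N := \sum_(1 <= n < N.+1 | rough k n) f n.

(** One step of the sieve: for a prime k, the multiple k j is k-rough exactly when j is, and f (k j)
    = f k * f j. *)
Lemma rough_sumS k N : prime k -> T k.+1 N = T k N - f k * T k (N %/ k).
Proof.
move=> pk; apply/eqP; rewrite eq_sym subr_eq; apply/eqP.
have -> : f k * T k (N %/ k) = \sum_(1 <= n < N.+1 | (k %| n)%N) (if rough k n then f n else 0).
  rewrite sum_multiples ?prime_gt0// /T big_mkcond mulr_sumr; apply: eq_bigr => j _.
  by rewrite rough_mul// fM; case: ifP => //; rewrite mulr0.
rewrite /T [LHS]big_mkcond [X in _ = X +
  _]big_mkcond [X in _ = _ + X]big_mkcond -big_split/=; apply: eq_bigr => n _.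
rewrite roughS pk/=; case: (rough k n) => /=; case: (k %| n)%N; rewrite /= ?addr0 ?add0r//.
Qed.

Lemma rough_sum1 k N : (1 < k)%N -> (0 < N)%N ->
  cmod (T k N - 1) <= W - \sum_(1 <= n < k) w n.
Proof.
move=> k1 N0.
have r1 : rough k 1.
  by apply/allP => p _; apply/negP => /andP[pp]; rewrite dvdn1 => /eqP p1; rewrite p1 in pp.
have -> : T k N - 1 = \sum_(2 <= n < N.+1 | rough k n) f n.
  by rewrite /T big_ltn_cond ?ltnS// r1 f1 addrAC subrr add0r.
apply: le_trans (cmod_sum _ _ _) _.
apply: (@le_trans _ _ (\sum_(1 <= n < N.+1 | (k <= n)%N) w n)).
  rewrite [leLHS]big_mkcond [leRHS]big_mkcond [leRHS]big_ltn ?ltnS//= leqNgt k1/= add0r.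
  apply: ler_sum_nat => n /andP[n2 _]; case: ifPn => [/(rough_ge n2) ->|_].
    by apply: fw; apply: leq_trans n2.
  by case: ifP => // _; apply: w0; apply: leq_trans n2.
rewrite lerBrDl; have [kN|Nk] := leqP k N.+1.
  apply: le_trans (wW N); rewrite [leRHS](@big_cat_nat _ _ _ k)//=; last exact: ltnW.
  rewrite lerD2l big_mkcond [leLHS](@big_cat_nat _ _ _ k)//=; last exact: ltnW.
  rewrite big_nat big1 ?add0r => [|n /andP[_ nk]]; last by rewrite leqNgt nk.
  by apply: ler_sum_nat => n /andP[kn _]; rewrite kn.
rewrite [X in _ + X]big_nat_cond [X in _ + X]big1 ?addr0 => [|n /andP[/andP[_ nN]]]; last first.
  by rewrite leqNgt (ltn_trans nN Nk).
by have := wW k.-1; rewrite prednK// ltnW.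
Qed.

Variable S : R[i].
Hypothesis fS : (fun N => \sum_(1 <= n < N.+1) f n : (R[i] : numFieldType)) @ \oo --> (S : (R[i] : numFieldType)).

Let E k := S * \prod_(0 <= p < k | prime p) (1 - f p).

Lemma rough_cvg k :
  (T k : nat -> (R[i] : numFieldType)) @ \oo --> (E k : (R[i] : numFieldType)).
Proof.
elim: k => [|k IH].
  have E0 : E 0 = S by rewrite /E big_geq ?mulr1.
  have T0 : T 0 = fun N => \sum_(1 <= n < N.+1) f n by [].
  by rewrite E0 T0.
have [pk|npk] := boolP (prime k); last first.
  have EE : E k.+1 = E k by rewrite /E big_mkcond big_nat_recr//= -big_mkcond/= (negbTE npk) mulr1.
  have TT : T k.+1 = T k.
    by apply/funext => N; apply: eq_bigl => n; rewrite roughS (negbTE npk) andbT.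
  by rewrite EE TT.
have EE : E k.+1 = E k - f k * E k.
  by rewrite /E big_mkcond big_nat_recr//= -big_mkcond/= pk; ring.
have TT : T k.+1 = fun N => T k N - f k * T k (N %/ k) by apply/funext => N; exact: rough_sumS.
rewrite EE TT; apply: cvgB; first exact: IH.
apply: cvgM; first exact: cvg_cst.
apply: (@cvg_comp _ _ _ (fun N => N %/ k)%N (T k) _ _ _ _ IH).
move=> A [n0 _ hA]; exists (n0 * k)%N => // n /= hn; apply: hA => /=.
by rewrite leq_divRL// prime_gt0.
Qed.

(** Multiplying the series by 1 - f p for all primes p < k leaves the sum over the k-rough integers.
    Apart from 1 these are at least k, so the distance to 1 is controlled by a tail of the majorant
    [w]. *)
Lemma euler_product_dist k : (1 < k)%N -> cmod (E k - 1) <= W - \sum_(1 <= n < k) w n.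
Proof.
move=> k1; apply/ler_addgt0Pr => e e0.
have := cvg_complexP (@rough_cvg k) e0; case=> n0 _ h.
have /= hN := h (maxn 1 n0) (leq_maxr _ _).
have -> : E k - 1 = (E k - T k (maxn 1 n0)) + (T k (maxn 1 n0) - 1) by rewrite addrA subrK.
apply: le_trans (cmodD _ _) _; rewrite [leLHS]addrC; apply: lerD; last exact: ltW.
by apply: rough_sum1 => //; rewrite leq_maxl.
Qed.
End EulerProduct.

(** * The zeta series at 1 + e *)

Section Zeta.
Variable R : realType.

(* n^(-e) for n > 0; the value is 1 for n = 0, since [ln 0 = 0]. *)
Definition npow (e : R) (n : nat) : R := expR (- e * ln n%:R).

Lemma npow1 e : npow e 1 = 1. Proof. by rewrite /npow ln1 mulr0 expR0. Qed.
Lemma npow_gt0 e n : 0 < npow e n. Proof. exact: expR_gt0. Qed.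
Lemma npow_ge0 e n : 0 <= npow e n. Proof. exact: expR_ge0. Qed.
Lemma npowM e m n : (0 < m)%N -> (0 < n)%N -> npow e (m * n) = npow e m * npow e n.
Proof. by move=> m0 n0; rewrite /npow ln_natM// mulrDr expRD. Qed.

Lemma npow_le1 e n : 0 <= e -> npow e n <= 1.
Proof. by move=> e0; rewrite -expR0 ler_expR mulNr oppr_le0 mulr_ge0 ?ln_nat_ge0. Qed.

Lemma npow_decr e m n : 0 <= e -> (m <= n)%N -> npow e n <= npow e m.
Proof.
move=> e0; elim: n => [|n IH]; first by rewrite leqn0 => /eqP ->.
rewrite leq_eqVlt => /predU1P[->//|/IH]; apply: le_trans.
by rewrite ler_expR !mulNr lerN2 ler_wpM2l// ler_ln_natS.
Qed.

(** With [npow_diff_ge], a discrete form of the comparison with an integral: n^(-e) - (n + 1)^(-e)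
    lies between e (n + 1)^(-1-e) and e n^(-1-e). After telescoping, zeta(1 + e) lies between 1/e
    and 1 + 1/e. *)
Lemma npow_diff_le e n : 0 <= e -> (0 < n)%N -> npow e n - npow e n.+1 <= e * (npow e n / n%:R).
Proof.
move=> e0 n0; have -> : npow e n.+1 = npow e n * expR (- e * (ln n.+1%:R - ln n%:R)).
  by rewrite /npow -expRD; congr expR; ring.
have := expR_ge1Dx (- e * (ln n.+1%:R - ln n%:R)); have := npow_gt0 e n.
have := ler_wpM2l e0 (ln_natS_le R n0).
set d := ln _ - ln _; set E := expR _; set v := npow _ _; set x := _^-1 => h1 h2 h3.
clearbody d E v x.
have h4 : v * (1 - E) <= v * (e * x) by apply: ler_wpM2l; [exact: ltW|lra].
by lra.
Qed.

Lemma npow_diff_ge e n : 0 <= e -> (0 < n)%N ->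
  e * (npow e n.+1 / n.+1%:R) <= npow e n - npow e n.+1.
Proof.
move=> e0 n0; have -> : npow e n = npow e n.+1 * expR (e * (ln n.+1%:R - ln n%:R)).
  by rewrite /npow -expRD; congr expR; ring.
have := expR_ge1Dx (e * (ln n.+1%:R - ln n%:R)); have := npow_gt0 e n.+1.
have hn := ln_natS_ge R n0.
have := ler_wpM2l e0 hn.
move: (ln _ - ln _) (expR _) (npow _ _) (_^-1) {hn} => d E v x h1 h2 h3.
have h4 : v * (e * x) <= v * (E - 1) by apply: ler_wpM2l; [exact: ltW|lra].
by lra.
Qed.

Lemma zeta_lower e N : 0 < e ->
  (1 - npow e N.+1) / e <= \sum_(1 <= n < N.+1) npow e n / n%:R.
Proof.
move=> e0; rewrite ler_pdivrMr// mulrC mulr_sumr.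
elim: N => [|N IH]; first by rewrite big_geq// npow1 subrr.
rewrite big_nat_recr//=; apply: le_trans (lerD IH (npow_diff_le (ltW e0) (ltn0Sn N))).
by rewrite addrA subrK.
Qed.

Lemma zeta_upper e N : 0 < e -> \sum_(1 <= n < N.+1) npow e n / n%:R <= 1 + e^-1.
Proof.
move=> e0; case: N => [|N]; first by rewrite big_geq// addr_ge0// invr_ge0 ltW.
suff H : e * \sum_(1 <= n < N.+2) npow e n / n%:R <= e + 1 - npow e N.+1.
  rewrite -(ler_pM2l e0); apply: (le_trans H); rewrite mulrDr divff ?gt_eqF//.
  by have := npow_gt0 e N.+1; lra.
elim: N => [|N IH]; first by rewrite big_nat1 npow1; lra.
rewrite big_nat_recr//= mulrDr; apply: (le_trans (lerD IH (npow_diff_ge (ltW e0) (ltn0Sn N)))).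
by rewrite addrA subrK.
Qed.
End Zeta.

(** * From partial sums at 1 to values at 1 + e *)

Section PerturbedSeries.
Variables (R : realType) (chi : nat -> R[i]) (e : R).
Hypothesis e0 : 0 <= e.

Lemma Lpartial_abel N : \sum_(1 <= n < N.+1) chi n / n%:R * (npow e n)%:C =
  \sum_(1 <= n < N.+1) Lpartial chi n * (npow e n - npow e n.+1)%:C +
  Lpartial chi N * (npow e N.+1)%:C.
Proof.
elim: N => [|N IH]; first by rewrite /Lpartial !big_geq// mul0r addr0.
rewrite big_nat_recr//= [X in _ = X + _]big_nat_recr//= IH.
have -> : Lpartial chi N.+1 = Lpartial chi N + chi N.+1 / N.+1%:R by rewrite /Lpartial big_nat_recr.
by rewrite rmorphB/=; ring.
Qed.

Let d0 n : 0 <= npow e n - npow e n.+1.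
Proof. by rewrite subr_ge0 npow_decr. Qed.

(** Summation by parts writes the sum as a combination of values of [Lpartial] with nonnegative
    weights of total 1. *)
Lemma perturbed_bound B N : (forall n, cmod (Lpartial chi n) <= B) ->
  cmod (\sum_(1 <= n < N.+1) chi n / n%:R * (npow e n)%:C) <= B.
Proof.
move=> LB; rewrite Lpartial_abel.
have B0 : 0 <= B by apply: le_trans (LB 0); exact: cmod_ge0.
apply: le_trans (cmodD _ _) _.
apply: (@le_trans _ _ (B * (1 - npow e N.+1) + B * npow e N.+1)); last first.
  by rewrite -mulrDr subrK mulr1.
apply: lerD; last first.
  rewrite cmodM cmod_real (ger0_norm (npow_ge0 _ _)); exact: ler_wpM2r (npow_ge0 _ _) _ _ (LB N).
apply: le_trans (cmod_sum _ _ _) _.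
have -> : 1 - npow e N.+1 = \sum_(1 <= n < N.+1) (npow e n - npow e n.+1).
  elim: N => [|N IH]; first by rewrite big_geq// npow1 subrr.
  by rewrite big_nat_recr//= -IH; ring.
rewrite mulr_sumr; apply: ler_sum => n _; rewrite cmodM cmod_real ger0_norm//.
exact: ler_wpM2r.
Qed.

(** The hypothesis expresses that the series vanishes at 1, and the bound is the trace of that zero
    at 1 + e: each weight n^(-e) - (n + 1)^(-e) is at most e / n, and multiplied by B / (n + 1) it
    becomes summable. *)
Lemma perturbed_bound0 B N : (forall n, cmod (Lpartial chi n) <= B / n.+1%:R) ->
  cmod (\sum_(1 <= n < N.+1) chi n / n%:R * (npow e n)%:C) <= B * e + B / N.+1%:R.
Proof.
move=> LB; rewrite Lpartial_abel.
have B0 : 0 <= B by have := LB 0; rewrite divr1; apply: le_trans; exact: cmod_ge0.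
apply: le_trans (cmodD _ _) _; apply: lerD; last first.
  rewrite cmodM cmod_real (ger0_norm (npow_ge0 _ _)); apply: le_trans (LB N).
  by rewrite ler_piMr ?cmod_ge0// npow_le1.
apply: le_trans (cmod_sum _ _ _) _.
apply: (@le_trans _ _ (B * e * \sum_(2 <= n < N.+2) (n%:R * n.-1%:R)^-1)); last first.
  by rewrite ler_piMr ?mulr_ge0// sum_inv_consecutive.
rewrite mulr_sumr [leRHS]big_add1/=; apply: ler_sum_nat => n /andP[n0 _].
rewrite cmodM cmod_real ger0_norm//.
have -> : B * e * (n.+1%:R * n%:R)^-1 = (B / n.+1%:R) * (e / n%:R) by rewrite invfM mulrACA.
apply: ler_pM => //; first exact: cmod_ge0.
apply: (le_trans (npow_diff_le e0 n0)); rewrite ler_wpM2l// ler_piMl ?invr_ge0//.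
exact: npow_le1.
Qed.
End PerturbedSeries.

(** * Bounds for character sums, and orthogonality for logarithms *)

Section CharacterFacts.
Variables (R : realType) (q : nat).
Hypothesis q1 : (1 < q)%N.
Local Notation DC := (@dirichlet_character R q).
Definition natchar (chi : {ffun 'Z_q -> R[i]}) (n : nat) : R[i] := chi n%:R.

Lemma natcharM chi m n : DC chi -> natchar chi (m * n) = natchar chi m * natchar chi n.
Proof. by move=> h; rewrite /natchar natrM h.1. Qed.

Lemma cmod_character_le1 chi (x : 'Z_q) : DC chi -> cmod (chi x) <= 1.
Proof.
move=> h; have [xu|xu] := boolP (x \is a GRing.unit).
  by rewrite -lecR -cmodE (dirichlet_character_norm q1 h xu).
by have := h.2 x; rewrite (negbTE xu) => /negbFE/eqP ->; rewrite cmod0.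
Qed.

Lemma natchar1 chi : DC chi -> natchar chi 1 = 1.
Proof. exact: dirichlet_character1. Qed.

Lemma natchar_period chi n : natchar chi (n + q) = natchar chi n.
Proof. by rewrite /natchar natrD pchar_Zp// addr0. Qed.

Lemma sum_natchar_le chi N : DC chi -> chi <> principal_character R q ->
  cmod (\sum_(0 <= n < N) natchar chi n) <= q%:R.
Proof.
move=> h np; elim/ltn_ind: N => N IH.
have [Nq|qN] := ltnP N q.
  apply: le_trans (cmod_sum _ _ _) _.
  apply: (@le_trans _ _ (\sum_(0 <= n < N) 1)); last first.
    by rewrite sumr_const_nat subn0 ler_nat ltnW.
  by apply: ler_sum => n _; exact: cmod_character_le1.
rewrite (@big_cat_nat _ _ _ q)//=.
have -> : \sum_(0 <= n < q) natchar chi n = 0.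
  rewrite -[RHS](sum_character_values h np) -[in LHS](Zp_cast q1) big_mkord.
  by apply: eq_bigr => x _; rewrite /natchar natr_Zp.
rewrite add0r -{1}[q]add0n big_addn.
under eq_bigr do rewrite natchar_period.
by apply: IH; rewrite ltn_subrL (ltnW q1) (leq_trans _ qN)// ltnW.
Qed.

Variable X : seq {ffun 'Z_q -> R[i]}.
Hypothesis uX : uniq X.
Hypothesis XP : forall chi, chi \in X <-> DC chi.

(** The Taylor polynomial is kept at a finite order [n], so that only finite sums are exchanged; the
    limit in [n] is taken in [prod_local_factors_le1] and [character_log_sum]. *)
Lemma character_local_log (a : {unit 'Z_q}) (b : 'Z_q) (x : R) n : 0 <= x <= 2^-1 ->
  cmod (\sum_(chi <- X) conjc (chi (val a)) * clog (1 - chi b * x%:C) +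
    ((totient q)%:R * \sum_(1 <= k < n.+1 | b ^+ k == val a) x ^+ k / k%:R)%:C)
  <= 4 * (size X)%:R * x ^+ n.+1.
Proof.
move=> /andP[x0 x2].
have E : ((totient q)%:R * \sum_(1 <= k < n.+1 | b ^+ k == val a) x ^+ k / k%:R)%:C =
    \sum_(chi <- X) conjc (chi (val a)) * \sum_(1 <= k < n.+1) (chi b * x%:C) ^+ k / k%:R.
  under [RHS]eq_bigr do rewrite mulr_sumr.
  rewrite exchange_big/= rmorphM rmorph_sum rmorph_nat mulr_sumr big_mkcond.
  apply: eq_bigr => k _.
  transitivity ((\sum_(chi <- X) conjc (chi (val a)) * chi (b ^+ k)) * (x ^+ k / k%:R)%:C).
    rewrite (character_orthogonality q1 uX XP); case: ifP => // _; by rewrite mul0r.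
  rewrite mulr_suml big_seq [RHS]big_seq; apply: eq_bigr => chi cX.
  rewrite (dirichlet_characterX _ _ ((XP chi).1 cX)) exprMn rmorphM rmorphXn fmorphV rmorph_nat.
  by rewrite !mulrA.
rewrite E -big_split/= big_seq; apply: le_trans (cmod_sum _ _ _) _.
rewrite -big_seq.
apply: (@le_trans _ _ (\sum_(chi <- X) 4 * x ^+ n.+1)); last first.
  by rewrite big_const_seq count_predT iter_addr_0 -[_ *+ size X]mulr_natr mulrAC.
rewrite big_seq [leRHS]big_seq; apply: ler_sum => chi cX; have h := (XP chi).1 cX.
rewrite -mulrDr cmodM.
have hx : cmod (chi b * x%:C) <= x.
  by rewrite cmodM cmod_real ger0_norm// ler_piMl// cmod_character_le1.
rewrite -[leRHS]mul1r; apply: ler_pM; rewrite ?cmod_ge0//.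
  have -> : cmod (conjc (chi (val a))) = cmod (chi (val a)).
    by apply: (@complexI R); rewrite -!cmodE normcJ.
  exact: cmod_character_le1.
apply: le_trans (clog_taylor_half _ (le_trans hx x2)) _.
by rewrite ler_wpM2l// lerXn2r ?nnegrE ?cmod_ge0.
Qed.

(** For a = 1 orthogonality makes the sum of the logarithms equal to minus a series with nonnegative
    terms. This positivity is the source of the lower bound in [prod_Lseries_lower]. *)
Lemma prod_local_factors_le1 (b : 'Z_q) (x : R) : 0 <= x <= 2^-1 ->
  \prod_(chi <- X) cmod (1 - chi b * x%:C) <= 1.
Proof.
move=> x2.
have R0 chi : chi \in X -> 0 < complex.Re (1 - chi b * x%:C).
  move=> cX; have := Re_le_cmod (chi b * x%:C).
  have : cmod (chi b * x%:C) <= x.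
    case/andP: x2 => x0 _.
    by rewrite cmodM cmod_real ger0_norm// ler_piMl// (cmod_character_le1 _ ((XP chi).1 cX)).
  have -> : complex.Re (1 - chi b * x%:C) = 1 - complex.Re (chi b * x%:C).
    by case: (chi b * _).
  by move=> h1 /ler_normlP[]; case/andP: x2; lra.
have c0 chi : chi \in X -> 0 < cmod (1 - chi b * x%:C).
  by move=> cX; apply: lt_le_trans (Re_le_cmod _); rewrite gtr0_norm ?R0.
have -> : \prod_(chi <- X) cmod (1 - chi b * x%:C) =
    expR (\sum_(chi <- X) ln (cmod (1 - chi b * x%:C))).
  rewrite expR_sum big_seq [RHS]big_seq; apply: eq_bigr => chi cX.
  by rewrite lnK// posrE c0.
rewrite -[leRHS]expR0 ler_expR.
have H n : \sum_(chi <- X) ln (cmod (1 - chi b * x%:C)) <= 4 * (size X)%:R * x ^+ n.+1.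
  have := le_trans (Re_le_cmod _) (character_local_log 1%g b n x2).
  move/(le_trans (ler_norm _)); apply: le_trans.
  rewrite ReD Re_sum /= -[leLHS]addr0 lerD//.
    rewrite big_seq [leRHS]big_seq; apply: ler_sum => chi cX; have h := (XP chi).1 cX.
    by rewrite (dirichlet_character1 h) conjc1 mul1r clog_atan ?R0.
  case/andP: x2 => x0 _.
  by rewrite mulr_ge0// sumr_ge0// => k _; rewrite divr_ge0 ?exprn_ge0.
have cv : (fun n => 4 * (size X)%:R * x ^+ n.+1) @ \oo --> (4 * (size X)%:R * 0 : R).
  apply: cvgM; first exact: cvg_cst.
  case/andP: x2 => x0 x2.
  by rewrite (@cvg_shiftS _ (fun n => x ^+ n)); apply: cvg_expr; rewrite ger0_norm//; lra.
apply: (@le_trans _ _ (limn (fun n => 4 * (size X)%:R * x ^+ n.+1))); last first.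
  by rewrite (cvg_lim (@Rhausdorff R) cv) mulr0.
apply: limr_ge; first exact: cvgP cv.
by apply: nearW => n; exact: H.
Qed.
End CharacterFacts.

(** * Non-vanishing of L(1,chi) *)

Section RealCharacter.
Variables (R : realType) (r : nat -> R) (Q C : R).
Hypothesis r1 : r 1%N = 1.
Hypothesis rM : forall m n, r (m * n)%N = r m * r n.
Hypothesis r3 : forall n, [\/ r n = 0, r n = 1 | r n = -1].
Hypothesis rQ : forall N, `|\sum_(0 <= n < N) r n| <= Q.

(** The Dirichlet convolution of [r] with the constant function 1. *)
Definition divisor_sum (n : nat) : R := \sum_(1 <= d < n.+1 | (d %| n)%N) r d.

Lemma divisor_sum_wide n M : (0 < n <= M)%N ->
  divisor_sum n = \sum_(1 <= d < M.+1 | (d %| n)%N) r d.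
Proof.
move=> /andP[n0 nM]; rewrite /divisor_sum [RHS](@big_cat_nat _ _ _ n.+1)//=.
rewrite [X in _ + X]big_nat_cond [X in _ + X]big1 ?addr0// => d /andP[/andP[nd _] dn].
by move: nd; rewrite ltnNge dvdn_leq.
Qed.

(** The divisors of p^(k+1) m that p divides are p times the divisors of p^k m; the others are the
    divisors of m. *)
Lemma divisor_sum_prime p k m : prime p -> (0 < m)%N -> ~~ (p %| m)%N ->
  divisor_sum (p ^ k.+1 * m) = r p * divisor_sum (p ^ k * m) + divisor_sum m.
Proof.
move=> pp m0 pm; set N := (p ^ k.+1 * m)%N; set n := (p ^ k * m)%N.
have p0 := prime_gt0 pp.
have n0 : (0 < n)%N by rewrite muln_gt0 expn_gt0 p0.
have NE : N = (p * n)%N by rewrite /N /n expnS mulnA.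
have mN : (m <= N)%N by rewrite leq_pmull// expn_gt0 p0.
rewrite (@divisor_sum_wide m N) ?m0// {1}/divisor_sum.
rewrite (bigID (fun d => (p %| d)%N))/=; congr (_ + _).
  rewrite (eq_bigl (fun d => (p %| d)%N && (d %| N)%N)); last by move=> d; rewrite andbC.
  rewrite big_mkcondr/= sum_multiples// NE mulKn// /divisor_sum mulr_sumr [RHS]big_mkcond.
  by apply: eq_bigr => d _; rewrite dvdn_pmul2l// rM.
apply: eq_bigl => d; apply/andP/idP => [[dN pd]|dm].
  move: dN; rewrite /N Gauss_dvdr// coprime_sym coprimeXl//.
  by rewrite prime_coprime.
split; first exact: dvdn_mull.
by apply: contra pm => /dvdn_trans; apply.
Qed.

Lemma divisor_sum_pfactor p m : prime p -> (0 < m)%N -> ~~ (p %| m)%N -> 0 <= divisor_sum m ->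
  (forall k, 0 <= divisor_sum (p ^ k * m)) /\
  (forall k, divisor_sum m <= divisor_sum (p ^ k.*2 * m)).
Proof.
move=> pp m0 pm; set g := divisor_sum m => g0.
have g00 : divisor_sum (p ^ 0 * m) = g by rewrite expn0 mul1n.
have S k := divisor_sum_prime k pp m0 pm.
(* For r p = 0 or 1 the values stay at least g; for r p = -1 they alternate between g and 0, with g
   at the even exponents. *)
suff [H|H] : (forall k, g <= divisor_sum (p ^ k * m)) \/
    (forall k, divisor_sum (p ^ k.*2 * m) = g /\ divisor_sum (p ^ k.*2.+1 * m) = 0).
- by split=> k; [apply: le_trans (H k)|].
- split=> k; last by rewrite (H k).1.
  rewrite -(odd_double_half k); case: (odd k); first by rewrite add1n (H _).2.
  by rewrite add0n (H _).1.
have [rp|rp|rp] := r3 p.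
- by left; case=> [|k]; rewrite ?g00// S rp mul0r add0r.
- left; elim=> [|k IH]; first by rewrite g00.
  by rewrite S rp mul1r lerDr; apply: le_trans IH.
right; elim=> [|k [IH1 IH2]]; first by rewrite g00 S g00 rp mulN1r addNr.
rewrite doubleS.
have h : divisor_sum (p ^ k.*2.+2 * m) = g by rewrite S IH2 mulr0 add0r.
by split=> //; rewrite S h rp mulN1r addNr.
Qed.

Lemma divisor_sum_ge n : (0 < n)%N -> 0 <= divisor_sum n /\ 1 <= divisor_sum (n ^ 2).
Proof.
elim/ltn_ind: n => n IH n0.
have [n1|n1] := leqP n 1.
  have -> : n = 1%N by apply/eqP; rewrite eqn_leq n1.
  by rewrite exp1n /divisor_sum big_mkcond big_nat1/= r1 ler01 lexx.
have pp := pdiv_prime n1; set p := pdiv n in pp.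
have [m pm nE] := pfactor_coprime pp n0.
have k0 : (0 < logn p n)%N by rewrite logn_gt0 mem_primes pp n0 pdiv_dvd.
have m0 : (0 < m)%N by move: n0; rewrite nE muln_gt0 => /andP[].
have mn : (m < n)%N.
  rewrite [X in (_ < X)%N]nE ltn_Pmulr//.
  by rewrite -(prednK k0) expnS (leq_trans (prime_gt1 pp))// leq_pmulr// expn_gt0 prime_gt0.
have [c0 c1] := IH _ mn m0.
have pm' : ~~ (p %| m)%N by rewrite -prime_coprime.
rewrite nE mulnC; split; first by have [h _] := divisor_sum_pfactor pp m0 pm' c0; exact: h.
have m2 : (0 < m ^ 2)%N by rewrite expn_gt0 m0.
have pm2 : ~~ (p %| m ^ 2)%N by rewrite -prime_coprime// coprimeXr.
have [_ h] := divisor_sum_pfactor pp m2 pm2 (le_trans ler01 c1).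
by rewrite expnMn -expnM muln2; apply: le_trans c1 (h _).
Qed.

Lemma sum_divisor_sum_squares (t : R) J : 0 <= t ->
  \sum_(1 <= j < J.+1) t ^+ (j ^ 2) <= \sum_(1 <= m < (J ^ 2).+1) divisor_sum m * t ^+ m.
Proof.
move=> t0; elim: J => [|J IH]; first by rewrite !big_geq.
rewrite big_nat_recr//= [leRHS](@big_cat_nat _ _ _ (J ^ 2).+1)//=; last by rewrite ltnS leq_sqr.
apply: lerD => //.
rewrite big_nat_recr/= ?ltn_sqr//.
apply: (@le_trans _ _ (divisor_sum (J.+1 ^ 2) * t ^+ (J.+1 ^ 2))).
  by rewrite ler_peMl ?exprn_ge0//; case: (divisor_sum_ge (ltn0Sn J)).
rewrite lerDr big_nat sumr_ge0// => m /andP[m0 _]; rewrite mulr_ge0 ?exprn_ge0//.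
by have [] := @divisor_sum_ge m (leq_ltn_trans (leq0n _) m0).
Qed.

Definition geom (t : R) (n : nat) : R := \sum_(0 <= i < n) t ^+ i.

Lemma geomE t n : (1 - t) * geom t n = 1 - t ^+ n.
Proof.
elim: n => [|n IH]; first by rewrite /geom big_geq// mulr0 expr0 subrr.
by rewrite /geom big_nat_recr//= mulrDr -/(geom t n) IH exprS; ring.
Qed.

Lemma geomS t n : geom t n.+1 = 1 + t * geom t n.
Proof.
rewrite /geom big_nat_recl//= expr0 mulr_sumr; congr (_ + _).
by apply: eq_bigr => i _; rewrite exprS.
Qed.

Lemma geom_ge1 t n : 0 <= t -> 1 <= geom t n.+1.
Proof.
by move=> t0; rewrite geomS lerDl mulr_ge0// sumr_ge0// => i _; rewrite exprn_ge0.
Qed.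

(* AM-GM applied to the pairs of terms of indices [i] and [n - i]. *)
Lemma geom_sqr_ge (u : R) n : n.+1%:R * u ^+ n <= geom (u ^+ 2) n.+1.
Proof.
have E : geom (u ^+ 2) n.+1 = \sum_(0 <= i < n.+1) (u ^+ (n - i)) ^+ 2.
  rewrite /geom big_nat_rev/=; apply: eq_big_nat => i /andP[_ iN].
  by rewrite add0n subSS -exprM mulnC exprM.
have E2 : geom (u ^+ 2) n.+1 = \sum_(0 <= i < n.+1) (u ^+ i) ^+ 2.
  by apply: eq_bigr => i _; rewrite -!exprM mulnC.
rewrite -(ler_pM2l (_ : 0 < 2))// [leRHS](_ : _ = (\sum_(0 <= i < n.+1) (u ^+ (n - i)) ^+ 2) +
  \sum_(0 <= i < n.+1) (u ^+ i) ^+ 2).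
  2: by rewrite -E -E2; ring.
rewrite -big_split/=.
have -> : 2 * (n.+1%:R * u ^+ n) = \sum_(0 <= i < n.+1) 2 * u ^+ n.
  by rewrite sumr_const_nat subn0 -[RHS]mulr_natl; ring.
apply: ler_sum_nat => i /andP[_ iN].
have -> : u ^+ n = u ^+ (n - i) * u ^+ i by rewrite -exprD subnK.
rewrite -subr_ge0.
have -> : (u ^+ (n - i)) ^+ 2 + (u ^+ i) ^+ 2 - 2 * (u ^+ (n - i) * u ^+ i) =
   (u ^+ (n - i) - u ^+ i) ^+ 2 by ring.
exact: sqr_ge0.
Qed.

Section Lambert.
Variable u : R.
Hypothesis u01 : 0 < u < 1.
(** [t] is a square so that [geom_sqr_ge], which involves the odd powers of [u], can be applied to
    the geometric sums in [t]. *)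
Let t := u ^+ 2.

Let u0 : 0 < u. Proof. by case/andP: u01. Qed.
Let u1 : u < 1. Proof. by case/andP: u01. Qed.
Let t0 : 0 < t. Proof. exact: exprn_gt0. Qed.
Let t1 : t < 1. Proof. by rewrite exprn_ilt1// ltW. Qed.
Let t10 : 0 < 1 - t. Proof. by rewrite subr_gt0. Qed.
Let u_ge0 : 0 <= u. Proof. exact: ltW. Qed.
Let t_ge0 : 0 <= t. Proof. exact: ltW. Qed.
Let t_le1 : t <= 1. Proof. exact: ltW. Qed.
Let u_le1 : u <= 1. Proof. exact: ltW. Qed.
Let t10_ge0 : 0 <= 1 - t. Proof. exact: ltW. Qed.

(* The difference between the polar part of [t^n / (1 - t^n)] at [t = 1] and
   this function; it is nonincreasing in [n]. *)
Let b n : R := n%:R^-1 / (1 - t) - t ^+ n / (1 - t ^+ n).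

Let bE n : b n.+1 = (n.+1%:R^-1 - t ^+ n.+1 / geom t n.+1) / (1 - t).
Proof.
have g0 := lt_le_trans ltr01 (geom_ge1 n t_ge0).
rewrite /b -(geomE t n.+1); field.
by rewrite !gt_eqF ?ltr0n.
Qed.

Let b_ge0 n : (1 <= n)%N -> 0 <= b n.
Proof.
case: n => // n _; rewrite bE divr_ge0// subr_ge0.
have g0 := lt_le_trans ltr01 (geom_ge1 n t_ge0).
rewrite ler_pdivrMr// mulrC ler_pdivlMr ?ltr0n// mulrC /geom.
apply: (@le_trans _ _ (\sum_(0 <= i < n.+1) t ^+ n.+1)).
  by rewrite sumr_const_nat subn0 mulr_natl.
apply: ler_sum_nat => i /andP[_ iN].
by rewrite ler_wiXn2l// ltnW.
Qed.

Let b_decr n : (1 <= n)%N -> b n.+1 <= b n.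
Proof.
case: n => // n _; rewrite !bE ler_pM2r ?invr_gt0// -subr_ge0.
have g0 := lt_le_trans ltr01 (geom_ge1 n t_ge0).
have g1 := lt_le_trans ltr01 (geom_ge1 n.+1 t_ge0).
have n0 : 0 < n.+1%:R :> R by rewrite ltr0n.
have -> : n.+1%:R^-1 - t ^+ n.+1 / geom t n.+1 - (n.+2%:R^-1 - t ^+ n.+2 / geom t n.+2) =
   (n.+1%:R * n.+2%:R)^-1 - t ^+ n.+1 / (geom t n.+1 * geom t n.+2).
  have -> : n.+2%:R = n.+1%:R + 1 :> R by rewrite natr1.
  move: g0 g1 n0; rewrite (geomS t n.+1) [t ^+ n.+2]exprS.
  move: (geom _ _) (n.+1%:R) (t ^+ n.+1) => A x y A0 A1 x0.
  by field; rewrite !gt_eqF//; lra.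
rewrite subr_ge0 ler_pdivrMr ?mulr_gt0// mulrC ler_pdivlMr ?mulr_gt0 ?ltr0n//.
(* The two lower bounds from [geom_sqr_ge] have exponents adding up to 2 n + 1, just below the
   exponent 2 n + 2 of t^(n+1) = u^(2n+2). *)
apply: (@le_trans _ _ ((n.+1%:R * u ^+ n) * (n.+2%:R * u ^+ n.+1))); last first.
  by apply: ler_pM; rewrite ?mulr_ge0 ?exprn_ge0// geom_sqr_ge.
rewrite mulrACA mulrC ler_wpM2l ?mulr_ge0// -exprD /t -exprM.
by rewrite ler_wiXn2l//; lia.
Qed.

(** t^n / (1 - t^n) is its polar part 1 / (n (1 - t)) minus [b n]. The polar parts add up to a
    partial sum of the series at 1, small by hypothesis; as [b] decreases from [b 1 = 1], summation
    by parts bounds the rest by 2 Q. *)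
Lemma lambert_bound N : 0 <= C -> (forall N, `|\sum_(1 <= n < N.+1) r n / n%:R| <= C / N.+1%:R) ->
  \sum_(1 <= n < N.+1) r n * (t ^+ n / (1 - t ^+ n)) <= C / N.+1%:R / (1 - t) + 2 * Q.
Proof.
move=> C0 /(_ N) hG.
have -> : \sum_(1 <= n < N.+1) r n * (t ^+ n / (1 - t ^+ n)) =
   (\sum_(1 <= n < N.+1) r n / n%:R) / (1 - t) - \sum_(1 <= n < N.+1) r n * b n.
  rewrite mulr_suml -sumrB; apply: eq_bigr => n _; rewrite /b; ring.
have := abel_bound rQ b_ge0 b_decr N.+1.
have -> : b 1 = 1 by rewrite /b invr1 expr1 -mulrBl divff// gt_eqF.
rewrite mulr1 => /ler_normlP[h _]; apply: lerD; last by [].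
by rewrite ler_pM2r ?invr_gt0//; case/ler_normlP: hG.
Qed.

(** Expanding the divisor sums gives the Lambert series with the multiples of each d cut at N. The
    cut costs at most t^N / (1 - t) for each of the N values of d. *)
Lemma divisor_series_le N :
  \sum_(1 <= m < N.+1) divisor_sum m * t ^+ m <=
  \sum_(1 <= n < N.+1) r n * (t ^+ n / (1 - t ^+ n)) + N%:R * (t ^+ N / (1 - t)).
Proof.
have -> : \sum_(1 <= m < N.+1) divisor_sum m * t ^+ m =
    \sum_(1 <= d < N.+1) r d * \sum_(1 <= k < (N %/ d).+1) t ^+ (d * k).
  under eq_big_nat => m /andP[m0 mN].
    rewrite (@divisor_sum_wide m N) ?m0// mulr_suml big_mkcond/=. over.
  rewrite exchange_big/=; apply: eq_big_nat => d /andP[d0 _].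
  rewrite -sum_multiples// mulr_sumr [RHS]big_mkcond; apply: eq_bigr => m _.
  by case: ifP.
have -> : N%:R * (t ^+ N / (1 - t)) = \sum_(1 <= n < N.+1) t ^+ N / (1 - t).
  by rewrite sumr_const_nat subn1 mulr_natl.
rewrite -big_split/=; apply: ler_sum_nat => d /andP[d0 dN].
have td : t ^+ d < 1 by rewrite exprn_ilt1// -lt0n.
have td0 : 0 < 1 - t ^+ d by rewrite subr_gt0.
have -> : \sum_(1 <= k < (N %/ d).+1) t ^+ (d * k) =
    t ^+ d / (1 - t ^+ d) - t ^+ (d * (N %/ d).+1) / (1 - t ^+ d).
  move: (N %/ d)%N => K; rewrite -mulrBl; apply: (canRL (mulfK _)); first by rewrite gt_eqF.
  elim: K => [|K IH]; first by rewrite big_geq// mul0r muln1 subrr.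
  by rewrite big_nat_recr//= mulrDl IH [(d * K.+2)%N]mulnS exprD; ring.
rewrite mulrBr lerD2l.
have h : t ^+ (d * (N %/ d).+1) / (1 - t ^+ d) <= t ^+ N / (1 - t).
  apply: ler_pM; rewrite ?invr_ge0 ?exprn_ge0 ?(ltW td0)//.
    by rewrite ler_wiXn2l// mulnC ltnW// ltn_ceil.
  rewrite lef_pV2 ?posrE// lerB// -[leRHS]expr1 ler_wiXn2l//.
have h0 : 0 <= t ^+ (d * (N %/ d).+1) / (1 - t ^+ d) by rewrite divr_ge0 ?exprn_ge0 ?(ltW td0).
by apply: le_trans h; case: (r3 d) => ->; lra.
Qed.
End Lambert.

Lemma bernoulli_ineq (x : R) n : 0 <= x <= 1 -> 1 - n%:R * x <= (1 - x) ^+ n.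
Proof.
move=> /andP[x0 x1]; elim: n => [|n IH]; first by rewrite mul0r subr0 expr0.
rewrite exprS -natr1.
have h : (1 - x) * (1 - n%:R * x) <= (1 - x) * (1 - x) ^+ n by rewrite ler_wpM2l// subr_ge0.
apply: le_trans h; have : 0 <= n%:R * x * x by rewrite !mulr_ge0.
by lra.
Qed.

Lemma real_character_L_neq0 :
  (forall N, `|\sum_(1 <= n < N.+1) r n / n%:R| <= C / N.+1%:R) -> False.
Proof.
move=> hC; have C0 : 0 <= C by have := hC 0; rewrite divr1; apply: le_trans.
have Q0 : 0 <= Q by apply: le_trans (rQ 0).
(* The estimates below lead to J / 2 <= C + 2 Q + 6, which this choice of J contradicts. *)
have [J JB] : exists J : nat, 2 * (2 * Q + C + 6) < J%:R by eexists; exact: truncnS_gt.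
(* With u = 1 - 1/m and t = u^2, the condition 4 J^2 <= m keeps t^(j^2) >= 1/2 for j <= J. The cut N
   = m^2 bounds the term in C by C and the truncation error by m^3 exp(-m) <= 6. *)
have [m m1 Jm] : exists2 m : nat, (1 < m)%N & (4 * J ^ 2 <= m)%N.
  by exists (4 * J ^ 2).+2; rewrite // ltnW.
pose M : R := m%:R.
have M1 : 1 < M by rewrite ltr1n.
have M0 : 0 < M by lra.
pose u : R := 1 - M^-1.
have Mi : 0 < M^-1 < 1 by rewrite invr_gt0 M0 invf_lt1.
have u01 : 0 < u < 1 by rewrite /u; case/andP: Mi => ? ?; apply/andP; split; lra.
have /andP[u0 u1] := u01.
set t := u ^+ 2.
have t0 : 0 <= t by rewrite exprn_ge0// ltW.
have tu : t <= u by rewrite /t expr2 ler_piMr// ltW.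
have t1 : 0 < 1 - t by lra.
have iM : (1 - t)^-1 <= M by rewrite -[leRHS]invrK lef_pV2 ?posrE ?invr_gt0//; move: tu;
  rewrite /u; lra.
have [N NE] : exists N, N = (m ^ 2)%N by eexists.
have mN : (m <= N)%N by rewrite NE -{1}(expn1 m) leq_pexp2l// ltnW.
have JN : (J ^ 2 <= N)%N by apply: leq_trans mN; apply: leq_trans Jm; rewrite leq_pmull.
have low : J%:R / 2 <= \sum_(1 <= k < N.+1) divisor_sum k * t ^+ k.
  apply: (@le_trans _ _ (\sum_(1 <= j < J.+1) t ^+ (j ^ 2))).
    apply: (@le_trans _ _ (\sum_(1 <= j < J.+1) 2^-1)).
      by rewrite sumr_const_nat subn1/= -[leRHS]mulr_natl.
    apply: ler_sum_nat => j /andP[j0 jJ].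
    apply: (@le_trans _ _ (1 - (2 * j ^ 2)%:R * M^-1)); last first.
      rewrite /t -exprM; apply: bernoulli_ineq.
      by case/andP: Mi => *; rewrite !ltW.
    have h : (2 * j ^ 2)%:R * M^-1 <= 2^-1.
      rewrite ler_pdivrMr// mulrC ler_pdivlMr// -natrM ler_nat; apply: leq_trans Jm.
      by rewrite mulnAC leq_mul2l leq_sqr.
    by lra.
  apply: le_trans (sum_divisor_sum_squares _ t0) _.
  rewrite [leRHS](@big_cat_nat _ _ _ (J ^ 2).+1)//= lerDl big_nat sumr_ge0// => k /andP[k0 _].
  rewrite mulr_ge0 ?(exprn_ge0 _ t0)//.
  by have [] := @divisor_sum_ge k (leq_ltn_trans (leq0n _) k0).
have up := le_trans (divisor_series_le u01 N) (lerD (lambert_bound u01 N C0 hC) (lexx _)).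
have := le_trans low up; rewrite -/t => hJ.
have h1 : C / N.+1%:R / (1 - t) <= C.
  rewrite -mulrA ler_piMr// mulrC ler_pdivrMr ?ltr0n// mul1r (le_trans iM)// ler_nat.
  exact: leqW.
have h2 : N%:R * (t ^+ N / (1 - t)) <= 6.
  have tN : t ^+ N <= expR (- M).
    apply: (@le_trans _ _ (u ^+ N)); first by rewrite lerXn2r ?nnegrE// ltW.
    have uE : u <= expR (- M^-1) by exact: expR_ge1Dx.
    apply: (@le_trans _ _ (expR (- M^-1) ^+ N)).
      by rewrite lerXn2r ?nnegrE ?expR_ge0// ltW.
    rewrite -expRM_natl ler_expR NE natrX -/M mulrN lerN2.
    by rewrite expr2 mulfK// gt_eqF.
  apply: (@le_trans _ _ (M ^+ 2 * (expR (- M) * M))).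
    rewrite {1}NE natrX -/M ler_wpM2l ?exprn_ge0 ?(ltW M0)//.
    by apply: ler_pM => //; [exact: exprn_ge0|rewrite invr_ge0 ltW].
  have := @expR_ge1Dxn R M 2 (ltW M0).
  have -> : (3`!%:R : R) = 6 by [].
  have -> : M ^+ 2 * (expR (- M) * M) = M ^+ 3 / expR M by rewrite expRN; ring.
  by rewrite ler_pdivrMr ?expR_gt0//; lra.
have := le_trans hJ (lerD (lerD h1 (lexx _)) h2).
by lra.
Qed.
End RealCharacter.

(** * Absolutely convergent series and bounds for limits *)

Section AbsoluteConvergence.
Variable R : realType.

Lemma nneg_bounded_cvg (w : nat -> R) (W : R) : (forall n, 0 <= w n) ->
  (forall N, \sum_(0 <= n < N) w n <= W) -> cvgn (series w).
Proof.
move=> w0 wW; apply: nondecreasing_is_cvgn.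
  exact: (@nondecreasing_series _ w xpredT 0).
by exists W => _ [N _ <-]; exact: wW.
Qed.

Lemma abs_bounded_cvg (a w : nat -> R) (W : R) : (forall n, `|a n| <= w n) ->
  (forall N, \sum_(0 <= n < N) w n <= W) -> cvgn (series a).
Proof.
move=> aw wW; apply: normed_cvg; apply: (@nneg_bounded_cvg _ W) => [n|N]; first exact: normr_ge0.
by apply: le_trans (wW N); apply: ler_sum => n _; exact: aw.
Qed.

Lemma abs_bounded_ccvg (f : nat -> R[i]) (w : nat -> R) (W : R) :
  (forall n, cmod (f n) <= w n) -> (forall N, \sum_(0 <= n < N) w n <= W) ->
  exists S : R[i],
    (fun N => \sum_(0 <= n < N) f n : (R[i] : numFieldType)) @ \oo --> (S : (R[i] : numFieldType)).
Proof.
move=> fw wW.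
have cR : cvgn (series (fun n => complex.Re (f n))).
  by apply: (abs_bounded_cvg _ wW) => n; apply: le_trans (Re_le_cmod _) (fw n).
have cI : cvgn (series (fun n => complex.Im (f n))).
  by apply: (abs_bounded_cvg _ wW) => n; apply: le_trans (Im_le_cmod _) (fw n).
exists (limn (series (fun n => complex.Re (f n))) +i* limn (series (fun n => complex.Im (f n)))).
apply: cvg_complex => /=.
  under eq_fun do rewrite Re_sum; exact: cR.
under eq_fun do rewrite Im_sum; exact: cI.
Qed.

Lemma finite_uniform_bound (T : eqType) (X : seq T) (P : T -> R -> Prop) :
  (forall x K K', K <= K' -> P x K -> P x K') ->
  (forall x, x \in X -> exists K, P x K) ->
  exists2 K, 1 <= K & forall x, x \in X -> P x K.
Proof.
move=> mono; elim: X => [|x X IH] H; first by exists 1.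
have [|K K1 hK] := IH; first by move=> y yX; apply: H; rewrite inE yX orbT.
have [K' hK'] := H x (mem_head _ _).
exists (Num.max K K'); first by rewrite le_max K1.
move=> y; rewrite inE => /predU1P[->|yX].
  by apply: mono hK'; rewrite le_max lexx orbT.
by apply: mono (hK _ yX); rewrite le_max lexx.
Qed.

Lemma cmod_lim_le (u : nat -> R[i]) (S : R[i]) (A B : R) :
  (u : nat -> (R[i] : numFieldType)) @ \oo --> (S : (R[i] : numFieldType)) ->
  (forall N, cmod (u N) <= A + B / N.+1%:R) -> cmod S <= A.
Proof.
move=> uS h; apply/ler_addgt0Pr => e e0.
have e2 : 0 < e / 2 by rewrite divr_gt0.
have [n0 _ hn] := cvg_complexP uS e2.
pose N := maxn n0 (Num.truncn (2 * `|B| / e)).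
have hN := hn N (leq_maxl _ _).
have BN : B / N.+1%:R <= e / 2.
  rewrite ler_pdivrMr ?ltr0n//; apply: le_trans (ler_norm _) _.
  have : 2 * `|B| / e < N.+1%:R.
    by apply: lt_le_trans (truncnS_gt _) _; rewrite ler_nat ltnS leq_maxr.
  rewrite ltr_pdivrMr//; move: (N.+1%:R) => x; lra.
have -> : S = (S - u N) + u N by rewrite subrK.
apply: le_trans (cmodD _ _) (le_trans (lerD (ltW hN) (h N)) _).
by move: BN; move: (B / _) => z; lra.
Qed.
End AbsoluteConvergence.

Section NonVanishing.
Variables (R : realType) (q : nat).
Hypothesis q1 : (1 < q)%N.
Local Notation DC := (@dirichlet_character R q).

Lemma natchar0 chi : DC chi -> natchar chi 0 = 0.
Proof.
move=> h; have := h.2 0; rewrite unitr0 => /negbFE/eqP h0.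
by rewrite /natchar mulr0n.
Qed.

Let f (chi : {ffun 'Z_q -> R[i]}) (e : R) (n : nat) : R[i] :=
  natchar chi n / n%:R * (npow e n)%:C.
Let w (e : R) (n : nat) : R := npow e n / n%:R.

Let fw chi e n : DC chi -> cmod (f chi e n) <= w e n.
Proof.
move=> h; rewrite /f natC_inv !cmodM !cmod_real ger0_norm ?invr_ge0//.
rewrite (ger0_norm (npow_ge0 _ _)) /w mulrC ler_wpM2l ?npow_ge0//.
by rewrite ler_piMl ?invr_ge0// cmod_character_le1.
Qed.

Let fM chi e m n : DC chi -> f chi e (m * n)%N = f chi e m * f chi e n.
Proof.
move=> h; have [->|m0] := posnP m; first by rewrite mul0n /f natchar0// !mul0r.
have [->|n0] := posnP n; first by rewrite muln0 /f natchar0// !mul0r mulr0.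
by rewrite /f natcharM// npowM// natrM rmorphM invfM; ring.
Qed.

Let f1 chi e : DC chi -> f chi e 1 = 1.
Proof. by move=> h; rewrite /f natchar1// npow1 invr1 !mulr1. Qed.

Let w_ge0 e n : 0 <= w e n. Proof. by rewrite divr_ge0 ?npow_ge0. Qed.

Let w_le N e : 0 < e -> \sum_(0 <= n < N) w e n <= 1 + e^-1.
Proof.
move=> e0; apply: le_trans (zeta_upper N e0).
case: N => [|N]; first by rewrite !big_geq.
rewrite big_ltn// {1}/w invr0 mulr0 add0r [leRHS]big_nat_recr//= lerDl; exact: w_ge0.
Qed.

Variable X : seq {ffun 'Z_q -> R[i]}.
Hypothesis uX : uniq X.
Hypothesis XP : forall chi, chi \in X <-> DC chi.

Lemma prod_Lseries_lower (e : R) (S : {ffun 'Z_q -> R[i]} -> R[i]) : 0 < e ->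
  (forall chi, chi \in X ->
    (fun N => \sum_(1 <= n < N.+1) natchar chi n / n%:R * (npow e n)%:C : (R[i] : numFieldType))
      @ \oo --> (S chi : (R[i] : numFieldType))) ->
  2^-1 ^+ size X <= \prod_(chi <- X) cmod (S chi).
Proof.
move=> e0 hS.
have cw : cvgn (series (w e)).
  by apply: (@nneg_bounded_cvg _ _ (1 + e^-1)) => [n|N]; [exact: w_ge0|exact: w_le].
pose W := limn (series (w e)).
have wW N : \sum_(1 <= n < N.+1) w e n <= W.
  have <- : series (w e) N.+1 = \sum_(1 <= n < N.+1) w e n.
    by rewrite /series/= big_ltn// {1}/w invr0 mulr0 add0r.
  apply: nondecreasing_cvgn_le => //.
  by apply: (@nondecreasing_series _ (w e) xpredT 0) => n _ _; exact: w_ge0.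
have [k k1 hk] : exists2 k, (1 < k)%N & W - \sum_(1 <= n < k) w e n <= 2^-1.
  move/cvgrPdist_lt : cw => /(_ 2^-1); rewrite invr_gt0 => /(_ (ltr0Sn R 1))[n0 _ hn].
  exists (maxn n0 2); first by rewrite leq_maxr.
  have := hn _ (leq_maxl n0 2); rewrite /= => /ltr_normlW/ltW; apply: le_trans.
  rewrite lerD2l lerN2 /series/= [leLHS]big_ltn ?(leq_trans _ (leq_maxr _ _))//.
  by rewrite {1}/w invr0 mulr0 add0r.
have low chi : chi \in X ->
    2^-1 <= cmod (S chi) * \prod_(0 <= p < k | prime p) cmod (1 - f chi e p).
  move=> cX; have h := (XP chi).1 cX.
  have := @euler_product_dist R (f chi e) (w e) W (f1 _ h) (fun m n => fM _ m n h)
    (fun n _ => fw _ n h) wW (S chi) (hS _ cX) k k1.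
  rewrite -cmod_prod -cmodM; set E := S chi * _ => hE.
  have := cmodD E (1 - E); rewrite addrC subrK cmod1.
  have -> : cmod (1 - E) = cmod (E - 1) by rewrite -cmodN opprB.
  by lra.
have x2 p : prime p -> 0 <= w e p <= 2^-1.
  move=> pp; rewrite w_ge0 /w ler_pdivrMr ?ltr0n ?prime_gt0//.
  apply: le_trans (npow_le1 _ (ltW e0)) _.
  by rewrite mulrC ler_pdivlMr// mul1r ler_nat prime_gt1.
have le1 p : prime p -> \prod_(chi <- X) cmod (1 - f chi e p) <= 1.
  move=> pp; apply: le_trans (prod_local_factors_le1 q1 uX XP p%:R (x2 _ pp)).
  rewrite le_eqVlt; apply/orP; left; apply/eqP; apply: eq_bigr => chi _.
  by rewrite /f /w natC_inv -mulrA -rmorphM [npow _ _ * _]mulrC.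
apply: (@le_trans _ _ (\prod_(chi <- X) (cmod (S chi) * \prod_(0 <= p < k | prime p) cmod (1 - f chi e p)))).
  have -> : 2^-1 ^+ size X = \prod_(chi <- X) 2^-1 :> R.
    by rewrite big_const_seq count_predT iter_mulr_1.
  rewrite big_seq [leRHS]big_seq; apply: ler_prod => chi cX.
  by rewrite low// invr_ge0 ler0n.
rewrite big_split/= exchange_big/=.
rewrite ler_piMr ?prodr_ge0// => [chi _|]; first exact: cmod_ge0.
apply: prodr_ile1 => p pp; rewrite le1// prodr_ge0// => chi _; exact: cmod_ge0.
Qed.

Definition conj_char (chi : {ffun 'Z_q -> R[i]}) : {ffun 'Z_q -> R[i]} :=
  [ffun x => conjc (chi x)].

Lemma Lpartial_conj chi N : Lpartial (natchar (conj_char chi)) N =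
  conjc (Lpartial (natchar chi) N).
Proof.
rewrite /Lpartial rmorph_sum; apply: eq_bigr => n _.
by rewrite rmorphM fmorphV /= conjc_nat /natchar ffunE.
Qed.

Lemma cmod_conj (z : R[i]) : cmod (conjc z) = cmod z.
Proof. by apply: (@complexI R); rewrite -!cmodE normcJ. Qed.

Lemma complex_character_L_neq0 psi C : DC psi -> psi <> principal_character R q ->
  conj_char psi <> psi ->
  (forall N, cmod (Lpartial (natchar psi) N) <= C / N.+1%:R) -> False.
Proof.
move=> hpsi np nreal hL.
have hpsi' : DC (conj_char psi) by exact: conjc_dirichlet_character.
have np' : conj_char psi <> principal_character R q.
  move=> /ffunP E; apply: np; apply/ffunP => x; have := E x; rewrite !ffunE.
  by move=> /(congr1 (@conjc R)); rewrite conjcK => ->; exact: conjc_nat.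
have C0 : 0 <= C by have := hL 0; rewrite divr1; apply: le_trans; exact: cmod_ge0.
(* [g chi e] is the expected order of magnitude of L(1 + e, chi): a pole at the principal character,
   a zero at [psi] and at its conjugate. The product of all of them is e. *)
pose g (chi : {ffun 'Z_q -> R[i]}) (e : R) := (if chi == principal_character R q then e^-1 else 1) *
  ((if chi == psi then e else 1) * (if chi == conj_char psi then e else 1)).
(* The term [K / N.+1%:R] is an error of truncation, which [cmod_lim_le] removes in the limit. *)
pose P (chi : {ffun 'Z_q -> R[i]}) (K : R) := forall e N, 0 < e <= 1 ->
  cmod (\sum_(1 <= n < N.+1) f chi e n) <= K * g chi e + K / N.+1%:R.
have g0 chi e : 0 < e -> 0 <= g chi e.
  move=> e0; have e1 := ltW e0; rewrite /g; apply: mulr_ge0; last apply: mulr_ge0;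
  by case: ifP => // _; rewrite ?invr_ge0.
have [K K1 hK] : exists2 K, 1 <= K & forall chi, chi \in X -> P chi K.
  apply: finite_uniform_bound.
    move=> chi K K' KK' hK e N e01; apply: le_trans (hK e N e01) _; apply: lerD.
      by apply: ler_wpM2r => //; apply: g0; case/andP: e01.
    by apply: ler_wpM2r.
  move=> chi cX; have h := (XP chi).1 cX.
  have zero (chi' : {ffun 'Z_q -> R[i]}) : (forall N, cmod (Lpartial (natchar chi') N) <=
    C / N.+1%:R) ->
      chi' <> principal_character R q -> (chi' == psi) != (chi' == conj_char psi) -> P chi' C.
    move=> hL' /eqP/negbTE npr hc e N /andP[e0 _].
    have -> : g chi' e = e.
      rewrite /g npr mul1r; move: hc.
      by case: (chi' == psi); case: (chi' == conj_char psi) => //= _; rewrite ?mulr1 ?mul1r.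
    by apply: perturbed_bound0 => //; exact: ltW.
  have [cp|cp] := eqVneq chi psi.
    exists C; rewrite cp; apply: zero => //; rewrite eqxx.
    by have /negbTE -> : psi != conj_char psi by apply/eqP => E; case: nreal.
  have [cp'|cp'] := eqVneq chi (conj_char psi).
    exists C; rewrite cp'; apply: zero => // [N|]; first by rewrite Lpartial_conj cmod_conj.
    by rewrite eqxx; have /eqP/negbTE -> := nreal.
  have [c0|c0] := eqVneq chi (principal_character R q).
    exists 2 => e N /andP[e0 e1]; rewrite /g c0 eqxx.
    rewrite -c0 (negbTE cp) (negbTE cp') !mulr1.
    have hz : cmod (\sum_(1 <= n < N.+1) f chi e n) <= 1 + e^-1.
      apply: le_trans (cmod_sum _ _ _) (le_trans _ (zeta_upper N e0)).
      by apply: ler_sum => n _; exact: fw.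
    apply: (le_trans hz); have : 1 <= e^-1 by rewrite invf_ge1.
    have : 0 <= 2 / N.+1%:R :> R by [].
    by move: (2 / N.+1%:R) => z; lra.
  have [L LC] := Lpartial_cvg (fun n => sum_natchar_le q1 n h (elimN eqP c0)).
  exists (cmod L + 4 * q%:R) => e N /andP[e0 e1].
  rewrite /g (negbTE c0) (negbTE cp) (negbTE cp') !mulr1.
  apply: le_trans (perturbed_bound (ltW e0) N (Lpartial_bounded LC)) _.
  by rewrite lerDl divr_ge0// addr_ge0 ?cmod_ge0.
have small (e : R) : 0 < e <= 1 -> 2^-1 ^+ size X <= K ^+ size X * e.
  move=> e01; have /andP[e0 e1] := e01.
  have hS chi : exists S : R[i], chi \in X ->
      (fun N => \sum_(1 <= n < N.+1) f chi e n : (R[i] : numFieldType)) @ \oo --> (S : (R[i] : numFieldType)).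
    have [cX|cX] := boolP (chi \in X); last by exists 0.
    have h := (XP chi).1 cX.
    have [S hS] := @abs_bounded_ccvg R (f chi e) (w e) (1 + e^-1) (fun n => fw _ n h) (fun N =>
      w_le N e0).
    exists S => _; rewrite -cvg_shiftS in hS.
    have E : (fun N => \sum_(1 <= n < N.+1) f chi e n) = (fun N => \sum_(0 <= n < N.+1) f chi e n).
      by apply/funext => N; rewrite [in RHS]big_ltn// {2}/f natchar0// !mul0r add0r.
    by rewrite E.
  have {hS}[S hS] := choice hS.
  apply: (le_trans (prod_Lseries_lower e0 hS)).
  have -> : K ^+ size X * e = \prod_(chi <- X) (K * g chi e).
    rewrite big_split/= big_const_seq count_predT iter_mulr_1; congr (_ * _).
    rewrite /g !big_split/=.
    have one (chi0 : {ffun 'Z_q -> R[i]}) (y : R) : DC chi0 ->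
      \prod_(chi <- X) (if chi == chi0 then y else 1) = y.
      move=> h0; rewrite (bigD1_seq chi0) ?uX//=; last by apply/XP.
      by rewrite eqxx big1 ?mulr1// => chi /negbTE ->.
    rewrite !one//; last exact: principal_characterP.
    by rewrite mulrA mulVf ?mul1r// gt_eqF.
  rewrite big_seq [leRHS]big_seq; apply: ler_prod => chi cX; rewrite cmod_ge0/=.
  exact: cmod_lim_le (hS _ cX) (fun N => hK _ cX e N e01).
(* At e = x / 2 the upper bound [K ^+ size X * e] is half of the lower bound. *)
pose x := (2^-1 / K) ^+ size X.
have K0 : 0 < K by apply: lt_le_trans K1.
have x0 : 0 < x by rewrite exprn_gt0// divr_gt0// invr_gt0.
have x1 : x <= 1.
  apply: exprn_ile1; first by rewrite divr_ge0 ?(ltW K0)// invr_ge0.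
  by rewrite ler_pdivrMr// mul1r; lra.
have KxE : K ^+ size X * x = 2^-1 ^+ size X by rewrite -exprMn mulrCA divff ?mulr1// gt_eqF.
have := small (x / 2); rewrite mulrA KxE => h.
have y0 : 0 < 2^-1 ^+ size X :> R by rewrite exprn_gt0// invr_gt0.
have : 0 < x / 2 <= 1 by apply/andP; split; lra.
by move=> /h; lra.
Qed.

Lemma real_dirichlet_L_neq0 psi C : DC psi -> psi <> principal_character R q ->
  conj_char psi = psi ->
  (forall N, cmod (Lpartial (natchar psi) N) <= C / N.+1%:R) -> False.
Proof.
move=> h np /ffunP real hL; pose r n := complex.Re (natchar psi n).
have rE n : natchar psi n = (r n)%:C.
  have := real n%:R; rewrite ffunE /r /natchar; case: (psi _) => a b [] /eqP.
  by rewrite -subr_eq0 -opprD oppr_eq0 -mulr2n mulrn_eq0/= => /eqP ->.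
have Q N : `|\sum_(0 <= n < N) r n| <= q%:R.
  by rewrite -Re_sum (le_trans (Re_le_cmod _))// sum_natchar_le.
apply: (@real_character_L_neq0 R r q%:R C _ _ _ Q).
- by rewrite /r natchar1.
- by move=> m n; apply: (@complexI R); rewrite -rE natcharM// !rE rmorphM.
- move=> n; have [xu|xu] := boolP ((n%:R : 'Z_q) \is a GRing.unit).
    have := dirichlet_character_norm q1 h xu; rewrite -/(natchar psi n) rE cmodE cmod_real.
    move=> /(@complexI R) /eqP; rewrite eqr_norml ler01 andbT => /orP[] /eqP ->.
      by constructor 2.
    by constructor 3.
  by constructor 1; have := h.2 n%:R; rewrite (negbTE xu) /r /natchar => /negbFE/eqP ->.
move=> N; apply: le_trans (hL N).
have -> : \sum_(1 <= n < N.+1) r n / n%:R = complex.Re (Lpartial (natchar psi) N).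
  by rewrite /Lpartial Re_sum; apply: eq_bigr => n _; rewrite natC_inv Re_mulr_real.
exact: Re_le_cmod.
Qed.

Lemma dirichlet_L_neq0 psi L C : DC psi -> psi <> principal_character R q ->
  (forall N, cmod (L - Lpartial (natchar psi) N) <= C / N.+1%:R) -> L != 0.
Proof.
move=> h np hL; apply/eqP => L0.
have {}hL N : cmod (Lpartial (natchar psi) N) <= C / N.+1%:R.
  by have := hL N; rewrite L0 sub0r cmodN.
have [real|nreal] := pselect (conj_char psi = psi).
  exact: real_dirichlet_L_neq0 hL.
exact: complex_character_L_neq0 hL.
Qed.
End NonVanishing.

(** * Mertens' second and third theorems *)

Section Mertens2.
Variable R : realType.

Lemma euler_gamma_cvg :
  (fun n : nat => \sum_(1 <= k < n.+1) k%:R^-1 - ln n%:R : R) @ \oo --> euler_gamma R.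
Proof.
set u := fun n : nat => _; suff cu : cvgn u by [].
(* The sequence decreases only from n = 1 on: its value at 0 is 0, because [ln 0 = 0]. *)
suff /cvg_ex[l hl] : cvgn (fun n => u n.+1) by apply/cvg_ex; exists l; rewrite -cvg_shiftS.
apply: nonincreasing_is_cvgn.
  apply/nonincreasing_seqP => n; have := @ln_natS_ge R _ (ltn0Sn n).
  have -> : u n.+2 = u n.+1 + (n.+2%:R^-1 - (ln n.+2%:R - ln n.+1%:R)).
    by rewrite /u [in LHS]big_nat_recr//=; ring.
  by move=> h; rewrite gerDl subr_le0.
have H n : ln n.+1%:R <= \sum_(1 <= k < n.+1) k%:R^-1 :> R.
  elim: n => [|n IH]; first by rewrite ln1 big_geq.
  rewrite big_nat_recr//=; have := lerD IH (@ln_natS_le R _ (ltn0Sn n)).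
  by rewrite subrKC.
exists 0 => _ [n _ <-]; rewrite /u subr_ge0 (le_trans (H n))//.
by rewrite [leRHS]big_nat_recr//= lerDl invr_ge0.
Qed.

Lemma ln_lt_ratio (x y : R) : 0 < y <= x ->
  (x - y) / x <= ln x - ln y /\ ln x - ln y <= (x - y) / y.
Proof.
move=> /andP[y0 yx]; have x0 : 0 < x by apply: lt_le_trans yx.
split.
  have : ln (1 + (- ((x - y) / x))) <= - ((x - y) / x).
    apply: le_ln1Dx; rewrite ltrN2 ltr_pdivrMr// mul1r; lra.
  have -> : 1 + (- ((x - y) / x)) = y / x by field; rewrite gt_eqF.
  by rewrite ln_div ?posrE//; lra.
rewrite -ln_div ?posrE//.
have -> : x / y = 1 + (x - y) / y by field; rewrite gt_eqF.
by apply: le_ln1Dx; apply: lt_le_trans (ltrN10 R) _; rewrite divr_ge0 ?subr_ge0// ltW.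
Qed.

(** The function [a] is ln p / p on the primes minus the increments of ln n; its partial sums are
    bounded by Mertens' first theorem, and Dirichlet's test with weights 1 / ln n applies. There
    remains the sum of (ln n - ln (n - 1)) / ln n, which differs from the increments of ln ln n by
    the summable [d]. *)
Lemma mertens2 : exists c : R,
  (fun N : nat => \sum_(0 <= p < N.+1 | prime p) p%:R^-1 - ln (ln N%:R) : R) @ \oo --> c.
Proof.
have [C hC] := mertens1 R.
pose a n : R := (if prime n then ln n%:R / n%:R else 0) -
  (if (2 <= n)%N then ln n%:R - ln n.-1%:R else 0).
pose b n : R := (ln n%:R)^-1.
have aE N : \sum_(0 <= n < N.+1) a n = \sum_(0 <= p < N.+1 | prime p) ln p%:R / p%:R - ln N%:R.
  rewrite /a sumrB -big_mkcond; congr (_ - _).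
  elim: N => [|[|N] IH]; first by rewrite big_nat1/= ln0.
    by rewrite !big_nat_recr//= big_geq// !add0r ln1.
  by rewrite big_nat_recr//= IH addrC subrK.
have C0 : 0 <= C by apply: le_trans (hC 1%N isT).
have aC N : `|\sum_(0 <= n < N) a n| <= C.
  case: N => [|[|N]]; [by rewrite big_geq// normr0| |by rewrite aE hC].
  by rewrite big_nat1 /a /= subrr normr0.
have [cab _] := dirichlet_test aC (fun n => @inv_ln_decr R n) (@cvg_inv_ln R).
pose d n : R := if (3 <= n)%N then (ln n%:R - ln n.-1%:R) / ln n%:R -
   (ln (ln n%:R) - ln (ln n.-1%:R)) else 0.
(* Since ln n - ln (n - 1) <= 1, the comparison error is at most the decrement of 1 / ln n, which
   telescopes. *)
pose w n : R := if (3 <= n)%N then (ln n.-1%:R)^-1 - (ln n%:R)^-1 else 0.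
have lp n : (2 <= n)%N -> 0 < ln n%:R :> R by move=> n2; rewrite ln_gt0// ltr1n.
have dw n : `|d n| <= w n.
  rewrite /d /w; case: ifPn => [n3|_]; last by rewrite normr0.
  case: n n3 => // n n2 /=.
  have x0 := lp n n2; have y0 := lp n.+1 (ltnW (n2 : (2 < n.+1)%N)).
  have xy : ln n%:R <= ln n.+1%:R :> R by exact: ler_ln_natS.
  have xy1 : ln n.+1%:R - ln n%:R <= 1 :> R.
    apply: le_trans (ln_natS_le R (ltnW n2)) _.
    by rewrite invf_le1 ?ltr0n ?ler1n// ltnW.
  move: (ln n%:R) (ln n.+1%:R) x0 y0 xy xy1 => x y x0 y0 xy xy1.
  have [|h1 h2] := @ln_lt_ratio y x; first by rewrite x0.
  have h3 : (y - x) / x - (y - x) / y <= x^-1 - y^-1.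
    have yx : y^-1 <= x^-1 by rewrite lef_pV2 ?posrE.
    by rewrite -mulrBr ler_piMl// subr_ge0.
  by apply/ler_normlP; split; lra.
have wE N : \sum_(0 <= n < N.+3) w n = (ln 2)^-1 - (ln N.+2%:R)^-1.
  elim: N => [|N IH]; first by rewrite !big_nat_recr//= big_geq// /w/= !addr0 subrr.
  by rewrite big_nat_recr//= IH /w/= addrA subrK.
have wC N : \sum_(0 <= n < N) w n <= (ln 2)^-1.
  have w0 n : 0 <= w n by apply: le_trans (dw n).
  have : \sum_(0 <= n < N) w n <= \sum_(0 <= n < N.+3) w n.
    by rewrite 3?big_nat_recr//= -!addrA lerDl !addr_ge0.
  move/le_trans; apply; rewrite wE gerBl invr_ge0; exact: ln_nat_ge0.
have cd := abs_bounded_cvg dw wC.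
(* The 1 is the term n = 2 of (ln n - ln (n - 1)) / ln n, and - ln (ln 2) comes from starting the
   increments of ln ln n at 2. *)
exists (limn (series (fun n => a n * b n)) + limn (series d) + (1 - ln (ln 2))).
rewrite -cvg_shiftS -cvg_shiftS.
have -> : (fun n => \sum_(0 <= p < n.+3 | prime p) p%:R^-1 - ln (ln n.+2%:R)) =
   (fun n => series (fun n => a n * b n) n.+3 + series d n.+3 + (1 - ln (ln 2))).
  apply/funext => N; rewrite /series/=.
  pose e n : R := if (2 <= n)%N then (ln n%:R - ln n.-1%:R) / ln n%:R else 0.
  have abE n : a n * b n = (if prime n then n%:R^-1 else 0) - e n.
    rewrite /a /b /e mulrBl; congr (_ - _); last by case: ifP => //; rewrite mul0r.
    case: ifPn => [pn|_]; last by rewrite mul0r.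
    by rewrite mulrAC mulfV ?mul1r// gt_eqF// lp// prime_gt1.
  have eE : \sum_(0 <= n < N.+3) e n = 1 + \sum_(0 <= n < N.+3) d n + (ln (ln N.+2%:R) - ln (ln 2)).
    elim: N => [|N IH].
      rewrite !big_nat_recr//= !big_geq// /e /d /= ln1 subr0 divff ?subrr//.
        by rewrite !addr0 !add0r.
      by rewrite gt_eqF// lp.
    by rewrite big_nat_recr//= IH [in RHS]big_nat_recr//= /e /d /=; ring.
  under [X in _ = X + _ + _]eq_bigr do rewrite abE.
  by rewrite sumrB -big_mkcond eE; ring.
apply: cvgD; last exact: cvg_cst.
apply: cvgD.
  by rewrite (cvg_shiftS (fun n => series (fun n => a n * b n) n.+2)) (cvg_shiftS (fun n =>
    series (fun n => a n * b n) n.+1)) cvg_shiftS.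
by rewrite (cvg_shiftS (fun n => series d n.+2)) (cvg_shiftS (fun n => series d n.+1)) cvg_shiftS.
Qed.
End Mertens2.

(** * Abel means, dyadic blocks and the remainder of the logarithm *)

Section LogRemainder.
Variable R : realType.

(** Abel's theorem, stated for long truncated sums to match [dyadic_estimate]. After summation by
    parts, the indices below [m0] contribute O(1 - r) and each later deviation of the partial sums
    is at most delta / 4. *)
Lemma abel_limit (a : nat -> R) (s : R) :
  (fun M => \sum_(1 <= m < M.+1) a m) @ \oo --> s ->
  forall delta, 0 < delta -> exists2 eta, 0 < eta & forall r, 0 < r < 1 -> 1 - eta <= r ->
    \forall M \near \oo, `|\sum_(1 <= m < M.+1) a m * r ^+ m - s| <= delta.
Proof.
move=> as_ delta d0; have d4 : 0 < delta / 4 by rewrite divr_gt0.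
pose S M := \sum_(1 <= m < M.+1) a m.
move/cvgrPdist_le : as_ => /(_ _ d4)[m0 _ h0].
have {}h0 m : (m0 <= m)%N -> `|S m - s| <= delta / 4.
  by move=> mm; rewrite distrC; exact: h0.
pose K := \sum_(0 <= m < m0) `|S m - s|.
have K0 : 0 <= K by apply: sumr_ge0.
have hK m : (m < m0)%N -> `|S m - s| <= K.
  move=> mm; rewrite /K (bigD1_seq m) ?mem_index_iota ?iota_uniq//= lerDl.
  exact: sumr_ge0.
pose D := `|s| + K * m0%:R + 1.
have D0 : 0 < D by rewrite ltr_wpDl// addr_ge0// mulr_ge0.
exists (delta / 4 / D) => [|r /andP[r0 r1] hr]; first by rewrite divr_gt0.
exists m0 => // M /= m0M.
(* The weights r^m - r^(m+1) for m >= 1 and the last weight r^(N+1) add up to r instead of 1, whence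
   the term [s * (r - 1)]. *)
have E N : \sum_(1 <= m < N.+1) a m * r ^+ m - s =
    \sum_(1 <= m < N.+1) (S m - s) * (r ^+ m - r ^+ m.+1) + (S N - s) * r ^+ N.+1 + s * (r - 1).
  elim: N => [|N IH]; first by rewrite /S !big_geq// expr1; ring.
  have SS : S N.+1 = S N + a N.+1 by rewrite /S big_nat_recr.
  have E1 : \sum_(1 <= m < N.+2) a m * r ^+ m =
    (\sum_(1 <= m < N.+1) a m * r ^+ m - s) + s + a N.+1 * r ^+ N.+1
      by rewrite big_nat_recr//= subrK.
  have E2 : \sum_(1 <= m < N.+2) (S m - s) * (r ^+ m - r ^+ m.+1) =
    \sum_(1 <= m < N.+1) (S m - s) * (r ^+ m - r ^+ m.+1) +
    (S N.+1 - s) * (r ^+ N.+1 - r ^+ N.+2) by rewrite big_nat_recr.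
  by rewrite E1 E2 SS IH; ring.
have rm m : 0 <= r ^+ m - r ^+ m.+1 by rewrite subr_ge0 exprS ler_piMl ?exprn_ge0 ?(ltW r0) ?(ltW r1).
have rm1 m : r ^+ m - r ^+ m.+1 <= 1 - r.
  have -> : r ^+ m - r ^+ m.+1 = r ^+ m * (1 - r) by rewrite exprS; ring.
  by rewrite ler_piMl ?subr_ge0 ?exprn_ile1// ltW.
have h1 : `|\sum_(1 <= m < M.+1) (S m - s) * (r ^+ m - r ^+ m.+1)| <=
    delta / 4 + K * m0%:R * (1 - r).
  apply: le_trans (ler_norm_sum _ _ _) _.
  apply: (@le_trans _ _ (\sum_(1 <= m < M.+1) delta / 4 * (r ^+ m - r ^+ m.+1) +
     \sum_(0 <= m < M.+1 | (m < m0)%N) K * (1 - r))); last first.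
    apply: lerD.
      rewrite -mulr_sumr ler_piMr ?(ltW d4)//.
      have -> : \sum_(1 <= m < M.+1) (r ^+ m - r ^+ m.+1) = r - r ^+ M.+1.
        elim: (M) => [|N IH]; first by rewrite big_geq// expr1 subrr.
        by rewrite big_nat_recr//= IH addrA subrK.
      by rewrite lerBlDr (le_trans (ltW r1))// lerDl exprn_ge0// ltW.
    rewrite -(@big_nat_widen _ _ _ 0 m0 M.+1 predT) ?leqW// sumr_const_nat subn0 -[leLHS]mulr_natl.
    by rewrite le_eqVlt; apply/orP; left; apply/eqP; ring.
  rewrite [X in _ <= _ + X]big_mkcond [X in _ <= _ + X]big_ltn// addrCA -big_split/=.
  apply: ler_wpDl; first by case: ifP => // _; rewrite mulr_ge0 ?subr_ge0 ?(ltW r1).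
  apply: ler_sum => m _; rewrite normrM (ger0_norm (rm m)).
  case: ifPn => [mm|]; last by rewrite -leqNgt addr0 => mm; apply: ler_wpM2r (rm m) _ _ (h0 _ mm).
  apply: ler_wpDl; first by rewrite mulr_ge0 ?(ltW d4).
  by apply: ler_pM => //; exact: hK.
have h2 : `|(S M - s) * r ^+ M.+1| <= delta / 4.
  rewrite normrM (ger0_norm (exprn_ge0 _ (ltW r0))); apply: le_trans _ (h0 _ m0M).
  by rewrite ler_piMr// exprn_ile1 ?(ltW r0) ?(ltW r1).
have h3 : `|s * (r - 1)| = `|s| * (1 - r).
  by rewrite normrM distrC (gtr0_norm (_ : 0 < 1 - r)) ?subr_gt0.
have h4 : D * (1 - r) <= delta / 4.
  by rewrite mulrC -ler_pdivlMr//; lra.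
have h5 : (`|s| + K * m0%:R) * (1 - r) <= delta / 4.
  by apply: le_trans h4; rewrite ler_wpM2r ?subr_ge0 ?(ltW r1)// /D lerDl.
rewrite E; apply: (le_trans (ler_normD _ _)); rewrite h3.
apply: (le_trans (lerD (le_trans (ler_normD _ _) (lerD h1 h2)) (lexx _))).
by lra.
Qed.

Lemma sum_dyadic_blocks (F : nat -> R) M :
  \sum_(1 <= m < M.+1) \sum_((2 ^ m.-1).+1 <= p < (2 ^ m).+1 | prime p) F p =
  \sum_(0 <= p < (2 ^ M).+1 | prime p) F p.
Proof.
elim: M => [|M IH].
  by rewrite big_geq// expn0 [RHS]big_nat_cond [RHS]big1// => -[|[|p]].
rewrite big_nat_recr//= IH -big_cat_nat//= ltnS leq_exp2l//.
Qed.

(** For |x| < 1, the sum of x^k / k over k >= 2: what the local factor adds to 1/p. *)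
Definition log_remainder (x : R) : R := - ln (1 - x) - x.

Lemma log_remainder_diff (x y : R) : 0 <= y <= x -> x <= 2^-1 ->
  0 <= log_remainder x - log_remainder y <= 2 * x * (x - y).
Proof.
move=> /andP[y0 yx] x2.
have [|h1 h2] := @ln_lt_ratio R (1 - y) (1 - x); first by apply/andP; split; lra.
have E : 1 - y - (1 - x) = x - y by ring.
rewrite E in h1 h2; rewrite /log_remainder.
have h3 : x - y <= (x - y) / (1 - y).
  by rewrite ler_pdivlMr ?ler_piMr ?subr_ge0//; lra.
have h4 : (x - y) / (1 - x) <= (x - y) + 2 * x * (x - y).
  have : 0 <= (x - y) * (x * (1 - 2 * x)) by rewrite !mulr_ge0 ?subr_ge0//; lra.
  by rewrite ler_pdivrMr; lra.
by apply/andP; split; lra.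
Qed.

Lemma log_remainder0 : log_remainder 0 = 0.
Proof. by rewrite /log_remainder !subr0 ln1 oppr0. Qed.

Lemma log_remainder_ge0 x : 0 <= x <= 2^-1 -> 0 <= log_remainder x <= 2 * x ^+ 2.
Proof.
move=> /andP[x0 x2]; have := @log_remainder_diff x 0; rewrite lexx x0 log_remainder0 !subr0.
by rewrite -mulrA -expr2; apply.
Qed.

Lemma npow2X e m : npow e (2 ^ m) = (npow e 2 : R) ^+ m.
Proof.
elim: m => [|m IH]; first by rewrite expn0 npow1 expr0.
by rewrite expnS npowM ?expn_gt0// IH exprS.
Qed.

Lemma prime_inv_le2 p : prime p -> 0 < (p%:R^-1 : R) <= 2^-1.
Proof.
move=> pp; rewrite invr_gt0 ltr0n prime_gt0//= lef_pV2 ?posrE ?ltr0n ?prime_gt0//.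
by rewrite ler_nat prime_gt1.
Qed.

(** For 2^(m-1) < p <= 2^m the weight p^(-e) lies between r^m and r^(m-1), where r = 2^(-e);
    replacing it by r^m changes the sum by a factor between r and 1. *)
Lemma dyadic_compare (e : R) M : 0 <= e ->
  let Y := \sum_(1 <= m < M.+1)
     (\sum_((2 ^ m.-1).+1 <= p < (2 ^ m).+1 | prime p) p%:R^-1) * npow e 2 ^+ m in
  let Z := \sum_(0 <= p < (2 ^ M).+1 | prime p) npow e p / p%:R in
  Y <= Z /\ npow e 2 * Z <= Y.
Proof.
move=> e0 Y Z; rewrite /Y /Z -sum_dyadic_blocks mulr_sumr; split.
  apply: ler_sum => m _; rewrite mulr_suml -npow2X big_nat_cond [leRHS]big_nat_cond.
  apply: ler_sum => p /andP[/andP[_ pm] _]; rewrite mulrC ler_wpM2r ?invr_ge0//.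
  exact: npow_decr.
apply: ler_sum_nat => -[//|m] _ /=; rewrite mulr_sumr mulr_suml big_nat_cond [leRHS]big_nat_cond.
apply: ler_sum => p /andP[/andP[pm _] _]; rewrite mulrA [leRHS]mulrC ler_wpM2r ?invr_ge0//.
by rewrite exprS ler_wpM2l ?npow_ge0// -npow2X; apply: npow_decr => //; exact: ltnW.
Qed.

Lemma npow2_bounds (e : R) : 0 < e ->
  [/\ 1 - npow e 2 <= e, 0 < npow e 2 < 1 &
   ln (ln 2) - e <= ln ((1 - npow e 2) / e) <= ln (ln (2 : R))].
Proof.
move=> e0; set r := npow e 2; have r0 : 0 < r := npow_gt0 e 2.
have l2 : 0 < ln 2 :> R by rewrite ln_gt0// ltr1n.
have l21 : ln 2 <= 1 :> R.
  by have -> : 2 = 1 + 1 :> R; [lra|apply: le_ln1Dx; lra].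
have el : 0 < e * ln 2 by rewrite mulr_gt0.
have h1 : 1 - r <= e * ln 2 by have := expR_ge1Dx (- e * ln 2); rewrite -/r /r /npow; lra.
have r1 : r < 1 by rewrite /r /npow expR_lt1 mulNr oppr_lt0.
have h2 : r * (e * ln 2) <= 1 - r.
  have h : 1 + e * ln 2 <= r^-1.
    by apply: (le_trans (expR_ge1Dx _)); rewrite -expRN mulNr opprK.
  by have := ler_wpM2l (ltW r0) h; rewrite mulfV ?gt_eqF//; lra.
split; [|by rewrite r0 r1|].
  by apply: (le_trans h1); rewrite ler_piMr// ltW.
have q0 : 0 < (1 - r) / e by rewrite divr_gt0// subr_gt0.
apply/andP; split; last by rewrite ler_ln ?posrE// ler_pdivrMr// mulrC.
have : ln (r * ln 2) <= ln ((1 - r) / e).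
  have rl0 : 0 < r * ln 2 by rewrite mulr_gt0.
  by rewrite ler_ln ?posrE// ler_pdivlMr//; move: h2; lra.
apply: le_trans; rewrite lnM ?posrE// /r /npow expRK addrC lerD2r mulNr lerN2.
by rewrite ler_piMr// ltW.
Qed.
End LogRemainder.

Section Mertens3.
Variable R : realType.

Lemma npow_cvg0 (e : R) : 0 < e -> (fun n => npow e n) @ \oo --> (0 : R).
Proof.
move=> e0; apply/cvgrPdist_le => d d0.
have [n0 h] := ln_nat_large (- ln d / e).
exists n0 => // n /= /h hn; rewrite sub0r normrN ger0_norm ?npow_ge0//.
rewrite -[leRHS]lnK ?posrE// ler_expR mulNr lerNl mulrC.
by rewrite -ler_pdivrMr.
Qed.

Lemma zeta_euler (e : R) : 0 < e -> exists W : R,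
  [/\ e^-1 <= W <= 1 + e^-1,
   (fun N => \sum_(1 <= n < N.+1) npow e n / n%:R) @ \oo --> W &
   forall k, (1 < k)%N ->
     `|W * \prod_(0 <= p < k | prime p) (1 - npow e p / p%:R) - 1| <=
     W - \sum_(1 <= n < k) npow e n / n%:R].
Proof.
move=> e0; pose w n := npow e n / n%:R.
have w0 n : 0 <= w n by rewrite divr_ge0// npow_ge0.
pose S N := \sum_(1 <= n < N.+1) w n.
have Sle N : S N <= 1 + e^-1 by exact: zeta_upper.
have cS : cvgn S.
  apply: nondecreasing_is_cvgn; last by exists (1 + e^-1) => _ [N _ <-].
  by apply/nondecreasing_seqP => N; rewrite /S [leRHS]big_nat_recr//= lerDl.
pose W := limn S.
have SW N : S N <= W.
  apply: nondecreasing_cvgn_le => //.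
  by apply/nondecreasing_seqP => M; rewrite /S [leRHS]big_nat_recr//= lerDl.
exists W; split => //.
  apply/andP; split; last by apply: limr_le => //; apply: nearW.
  have c : (fun N => (1 - npow e N.+1) / e) @ \oo --> ((1 - 0) / e : R).
    apply: cvgM; last exact: cvg_cst.
    apply: cvgB; first exact: cvg_cst.
    by rewrite (cvg_shiftS (npow e)); exact: npow_cvg0.
  have -> : e^-1 = (1 - 0) / e by rewrite subr0 mul1r.
  rewrite -(cvg_lim (@Rhausdorff R) c); apply: ler_lim => //; first exact: cvgP c.
  by apply: nearW => N; exact: zeta_lower.
move=> k k1.
have := @euler_product_dist R (fun n => (w n)%:C) w W _ _ _ SW (W%:C) _ k k1.
have -> : \prod_(0 <= p < k | prime p) (1 - (w p)%:C) =
    (\prod_(0 <= p < k | prime p) (1 - w p))%:C.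
  by rewrite rmorph_prod; apply: eq_bigr => p _; rewrite rmorphB.
rewrite -rmorphM -[1 in X in X -> _](rmorph1 (real_complex R)) -rmorphB cmod_real; apply.
- by rewrite /w npow1 invr1 mulr1.
- move=> m n; rewrite -rmorphM /w; congr (_%:C).
  have [->|m0] := posnP m; first by rewrite mul0n invr0 !mulr0 mul0r.
  have [->|n0] := posnP n; first by rewrite muln0 invr0 !mulr0.
  by rewrite npowM// natrM invfM mulrACA.
- by move=> n _; rewrite cmod_real ger0_norm.
apply: cvg_complex => /=.
  under eq_fun do rewrite Re_sum /=; exact: cS.
under eq_fun do rewrite Im_sum /= big1//; exact: cvg_cst.
Qed.

Lemma npow_div_le (e : R) p : 0 <= e -> npow e p / p%:R <= p%:R^-1.
Proof. by move=> e0; rewrite ler_piMl ?invr_ge0// npow_le1. Qed.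

Lemma log_remainder_inv_ge0 p : prime p -> 0 <= log_remainder (p%:R^-1 : R).
Proof.
move=> /(prime_inv_le2 R)/andP[a b].
have := @log_remainder_ge0 R (p%:R^-1); rewrite b (ltW a) => /(_ isT).
by case/andP.
Qed.

Lemma log_remainder_inv_le p : prime p -> log_remainder (p%:R^-1 : R) <= 2 * (p%:R * p.-1%:R)^-1.
Proof.
move=> pp; have /andP[a b] := prime_inv_le2 R pp.
have := @log_remainder_ge0 R (p%:R^-1); rewrite b (ltW a) => /(_ isT)/andP[_ h].
apply: (le_trans h); rewrite ler_wpM2l// expr2 -invfM.
have p1 : 0 < p.-1%:R :> R by rewrite ltr0n -ltnS prednK ?prime_gt1 ?prime_gt0.
have p0 : 0 < p%:R :> R by rewrite ltr0n prime_gt0.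
by rewrite lef_pV2 ?posrE ?mulr_gt0// ler_pM2l// ler_nat leq_pred.
Qed.

Lemma log_remainder_cvg :
  cvgn (fun N => \sum_(0 <= p < N | prime p) log_remainder (p%:R^-1 : R)).
Proof.
have -> : (fun N => \sum_(0 <= p < N | prime p) log_remainder (p%:R^-1 : R)) =
  series (fun p => if prime p then log_remainder (p%:R^-1 : R) else 0).
  by apply/funext => N; rewrite /series/= big_mkcond.
apply: (@nneg_bounded_cvg _ _ 2) => [p|N].
  by case: ifP => // /log_remainder_inv_ge0.
rewrite -big_mkcond; case: N => [|N]; first by rewrite big_geq.
apply: (@le_trans _ _ (\sum_(0 <= p < N.+1 | prime p) 2 * (p%:R * p.-1%:R)^-1)).
  by apply: ler_sum => p; exact: log_remainder_inv_le.
rewrite -mulr_sumr ler_piMr//; apply: le_trans (sum_inv_consecutive R N).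
by apply: sum_primes_le => n _; rewrite invr_ge0 mulr_ge0.
Qed.

Lemma log_remainder_perturb e N : 0 <= e ->
  0 <= \sum_(0 <= p < N | prime p) log_remainder (p%:R^-1 : R) -
       \sum_(0 <= p < N | prime p) log_remainder (npow e p / p%:R) <= 4 * e.
Proof.
move=> e0; rewrite -sumrB.
have H p : prime p -> 0 <= log_remainder (p%:R^-1 : R) - log_remainder (npow e p / p%:R) <=
    2 * e * (ln p%:R / (p%:R * p.-1%:R)).
  move=> pp; have /andP[a b] := prime_inv_le2 R pp.
  have v1 : npow e p / p%:R <= p%:R^-1 by exact: npow_div_le.
  have := @log_remainder_diff R (p%:R^-1) (npow e p / p%:R).
  rewrite v1 divr_ge0 ?npow_ge0// => /(_ isT b)/andP[-> h]/=.
  apply: (le_trans h); have h2 : 1 - npow e p <= e * ln p%:R.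
    by have := expR_ge1Dx (- e * ln p%:R); rewrite -/(npow e p); lra.
  have -> : 2 * p%:R^-1 * (p%:R^-1 - npow e p / p%:R) = 2 * (1 - npow e p) * (p%:R * p%:R)^-1.
    by rewrite invfM; ring.
  have -> : 2 * e * (ln p%:R / (p%:R * p.-1%:R)) = 2 * (e * ln p%:R) * (p%:R * p.-1%:R)^-1 by ring.
  have p1 : 0 < p.-1%:R :> R by rewrite ltr0n -ltnS prednK ?prime_gt1 ?prime_gt0.
  have p0 : 0 < p%:R :> R by rewrite ltr0n prime_gt0.
  apply: ler_pM; rewrite ?invr_ge0 ?mulr_ge0 ?(ltW p0)//.
  - by rewrite subr_ge0 npow_le1.
  - by rewrite ler_wpM2l.
  - by rewrite lef_pV2 ?posrE ?mulr_gt0// ler_pM2l// ler_nat leq_pred.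
apply/andP; split; first by apply: sumr_ge0 => p /H/andP[].
case: N => [|N]; first by rewrite big_geq// mulr_ge0.
apply: (@le_trans _ _ (\sum_(0 <= p < N.+1 | prime p) 2 * e * (ln p%:R / (p%:R * p.-1%:R)))).
  by apply: ler_sum => p /H/andP[].
rewrite -mulr_sumr; have -> : 4 * e = 2 * e * 2 by ring.
by rewrite ler_wpM2l ?mulr_ge0// sum_ln_prime_consecutive.
Qed.

(** The logarithm of the Euler product of zeta(1 + e), cut at 2^M, gives Z = ln W - H1 + O(d), with
    ln W = - ln e + O(e) and H1 = g0 + O(d). Passing from Z to the dyadic sum Y costs O(d), and the
    sum of r^m / m is - ln (1 - r) + O(d). The difference is thus ln ((1 - r) / e) - g0, close to ln
    (ln 2) - g0; 20 exceeds the total of the implied constants. *)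
Lemma dyadic_estimate (g0 d : R) :
  (fun N => \sum_(0 <= p < N | prime p) log_remainder (p%:R^-1 : R)) @ \oo --> g0 ->
  0 < d <= 2^-1 ->
  \forall M \near \oo, `|\sum_(1 <= m < M.+1)
     (\sum_((2 ^ m.-1).+1 <= p < (2 ^ m).+1 | prime p) p%:R^-1 - m%:R^-1) * npow (d ^+ 2) 2 ^+ m
     - (ln (ln 2) - g0)| <= 20 * d.
Proof.
move=> hg0 /andP[d0 d2].
(* With e = d^2, the loss (1 - 2^-e) ln(1/e) in [dyadic_compare] is O(d). *)
set e := d ^+ 2.
have e0 : 0 < e by rewrite exprn_gt0.
have ed : e <= d by rewrite /e expr2 ler_piMr ?(ltW d0)//; lra.
have [r1e r01 /andP[lr1 lr2]] := npow2_bounds e0.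
have [W [/andP[W1 W2] cW hW]] := zeta_euler e0.
set r := npow e 2 in r1e r01 lr1 lr2 *; have /andP[r0 r1] := r01.
have pow_cvg : (fun M => (2 ^ M).+1)%N @ \oo --> \oo.
  move=> A [n0 _ hA]; exists n0 => // n /= nn; apply: hA => /=.
  by apply: leq_trans nn _; apply: ltnW; apply: leq_trans (ltn_expl n (ltnSn 1)) _.
have ev1 : \forall M \near \oo, `|ln (1 - r) + \sum_(1 <= m < M.+1) r ^+ m / m%:R| <= d.
  have c : (fun M => 2 * (r ^+ M.+1 / (1 - r))) @ \oo --> (2 * (0 / (1 - r)) : R).
    apply: cvgM; first exact: cvg_cst.
    apply: cvgM; last exact: cvg_cst.
    by rewrite (cvg_shiftS (fun n => r ^+ n)); apply: cvg_expr; rewrite gtr0_norm.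
  move/cvgrPdist_le : c => /(_ _ d0); apply: filterS => M.
  rewrite mul0r mulr0 sub0r normrN => /(le_trans (ler_norm _)); apply: le_trans.
  by apply: ln_taylor; rewrite r1 ltW.
have ev2 : \forall M \near \oo, W - \sum_(1 <= n < (2 ^ M).+1) npow e n / n%:R <= d.
  have c : (fun M => \sum_(1 <= n < (2 ^ M).+1) npow e n / n%:R) @ \oo --> W.
    apply: (cvg_comp (fun M => 2 ^ M)%N (fun N => \sum_(1 <= n < N.+1) npow e n / n%:R)) cW.
    by move: pow_cvg => /= h A [n0 _ hA]; exists n0 => // n /= nn; apply: hA => /=;
      apply: leq_trans nn _; apply: ltnW; exact: ltn_expl.
  move/cvgrPdist_le : c => /(_ _ d0); apply: filterS => M.
  by move=> /(le_trans (ler_norm _)).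
have ev3 : \forall M \near \oo, `|g0 -
  \sum_(0 <= p < (2 ^ M).+1 | prime p) log_remainder (p%:R^-1 : R)| <= d.
  have c := cvg_comp _ _ pow_cvg hg0.
  by move/cvgrPdist_le : c => /(_ _ d0).
near=> M.
have t1 : `|ln (1 - r) + \sum_(1 <= m < M.+1) r ^+ m / m%:R| <= d by near: M.
have t2 : W - \sum_(1 <= n < (2 ^ M).+1) npow e n / n%:R <= d by near: M.
have t3 : `|g0 - \sum_(0 <= p < (2 ^ M).+1 | prime p) log_remainder (p%:R^-1 : R)| <= d by near: M.
have k1 : (1 < (2 ^ M).+1)%N by rewrite ltnS expn_gt0.
have := le_trans (hW _ k1) t2.
set k := (2 ^ M).+1 in t3 k1 *; set E := W * _ => hE.
have [hY1 hY2] := dyadic_compare M (ltW e0).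
have hp := log_remainder_perturb k (ltW e0).
move: hY1 hY2 hp t3; rewrite -/r -/k.
set Y := \sum_(1 <= m < M.+1) _; set Z := \sum_(0 <= p < k | prime p) npow e p / p%:R.
set H0 := \sum_(0 <= p < k | prime p) log_remainder (p%:R^-1).
set H1 := \sum_(0 <= p < k | prime p) log_remainder _ => hY1 hY2 /andP[hp1 hp2] t3.
have W0 : 0 < W by apply: lt_le_trans W1; rewrite invr_gt0.
have w1 p : prime p -> 0 < 1 - npow e p / p%:R.
  move=> pp; have /andP[a b] := prime_inv_le2 R pp.
  have : npow e p / p%:R <= p%:R^-1 by apply: npow_div_le; exact: ltW.
  by lra.
have lnE : ln E = ln W - Z - H1.
  have P0 : 0 < \prod_(0 <= p < k | prime p) (1 - npow e p / p%:R) by rewrite prodr_gt0.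
  rewrite /E lnM ?posrE//.
  rewrite -[RHS]addrA; congr (_ + _); rewrite /Z /H1 -opprD -big_split/= -sumrN.
  apply: expR_inj; rewrite lnK ?posrE//.
  rewrite expR_sum; apply: eq_bigr => p pp.
  rewrite /log_remainder -[LHS]lnK ?posrE ?w1//; congr expR; ring.
clearbody E.
have E0 : 2^-1 <= E by move: hE => /ler_normlP[]; lra.
have lnE1 : ln E <= d.
  have := @le_ln1Dx R (E - 1); rewrite addrCA subrr addr0 => h.
  by apply: le_trans (h _) _; [lra|move: hE => /ler_normlP[]; lra].
have lnE2 : - (2 * d) <= ln E.
  have := @le_ln1Dx R (E^-1 - 1); rewrite addrCA subrr addr0 lnV ?posrE; last lra.
  have Ei : 0 < E^-1 by rewrite invr_gt0; lra.
  have h : E^-1 <= 1 + 2 * d.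
    rewrite -[E^-1]mul1r ler_pdivrMr; last lra.
    by move: hE => /ler_normlP[]; nra.
  by move=> /(_ _); lra.
have lnW : 0 <= ln W + ln e <= e.
  rewrite -lnM ?posrE//; apply/andP; split.
    by rewrite ln_ge0// mulrC -ler_pdivrMl// mulr1.
  apply: (@le_trans _ _ (ln (1 + e))); last by apply: le_ln1Dx; lra.
  rewrite ler_ln ?posrE ?mulr_gt0//; last lra.
  apply: le_trans (ler_wpM2r (ltW e0) W2) _.
  by rewrite mulrDl mul1r mulVf ?gt_eqF// addrC.
have lq : ln ((1 - r) / e) = ln (1 - r) - ln e by rewrite ln_div ?posrE ?subr_gt0.
rewrite lq in lr1 lr2.
have lnWd : ln W <= 2 / d.
  apply: (@le_trans _ _ (ln ((1 + d^-1) ^+ 2))).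
    rewrite ler_ln ?posrE//; last by rewrite exprn_gt0// addr_gt0 ?invr_gt0.
    apply: (le_trans W2); rewrite /e -exprVn.
    have : 0 < d^-1 by rewrite invr_gt0.
    by move: (d^-1) => x x0; nra.
  rewrite lnXn ?addr_gt0 ?invr_gt0// -[_ *+ 2]mulr_natl ler_wpM2l//.
  by apply: le_ln1Dx; apply: lt_trans (ltrN10 R) _; rewrite invr_gt0.
have ZY : 0 <= Z - Y <= 3 * d.
  rewrite subr_ge0 hY1/=; apply: (@le_trans _ _ (e * (2 / d + 2 * d))); last first.
    have -> : e * (2 / d + 2 * d) = 2 * d + 2 * e * d by rewrite /e; field; rewrite gt_eqF.
    by nra.
  have H10 : 0 <= H1.
    apply: sumr_ge0 => p pp; have /andP[a b] := prime_inv_le2 R pp.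
    have v1 : npow e p / p%:R <= p%:R^-1 by apply: npow_div_le; exact: ltW.
    have := @log_remainder_ge0 R (npow e p / p%:R).
    by rewrite divr_ge0 ?npow_ge0// (le_trans v1 b) => /(_ isT)/andP[].
  have Z0 : 0 <= Z by apply: sumr_ge0 => p _; rewrite divr_ge0 ?npow_ge0.
  have ZB : Z <= 2 / d + 2 * d by lra.
  apply: (@le_trans _ _ ((1 - r) * Z)); first lra.
  by apply: ler_pM => //; rewrite subr_ge0 ltW.
have -> : \sum_(1 <= m < M.+1)
     (\sum_((2 ^ m.-1).+1 <= p < (2 ^ m).+1 | prime p) p%:R^-1 - m%:R^-1) * r ^+ m =
   Y - \sum_(1 <= m < M.+1) r ^+ m / m%:R.
  by rewrite /Y -sumrB; apply: eq_bigr => m _; rewrite mulrBl [m%:R^-1 * _]mulrC.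
move: t1; set V := \sum_(1 <= m < M.+1) _ => t1.
clearbody V Y Z H0 H1.
move: t1 t3 => /ler_normlP[t11 t12] /ler_normlP[t31 t32].
case/andP: ZY => zy1 zy2; case/andP: lnW => lw1 lw2.
by apply/ler_normlP; split; lra.
Unshelve. all: by end_near. Qed.

(** At N = 2^M the sum of 1/p is ln M + ln (ln 2) + c + o(1), and the harmonic sum is ln M + gamma +
    o(1), so the block differences [a] have sum s = c - gamma + ln (ln 2). By [dyadic_estimate]
    their Abel means tend to ln (ln 2) - g0. Equating the two gives c = gamma - g0. *)
Lemma mertens3 :
  (fun N => \sum_(0 <= p < N.+1 | prime p) ln (1 - p%:R^-1) + ln (ln N%:R)) @ \oo -->
  - euler_gamma R.
Proof.
have [c hc] := mertens2 R.
have /cvg_ex[/= g0 hg] := log_remainder_cvg.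
set gam := euler_gamma R; have hgam := @euler_gamma_cvg R.
pose a m : R := \sum_((2 ^ m.-1).+1 <= p < (2 ^ m).+1 | prime p) p%:R^-1 - m%:R^-1.
pose s := c - gam + ln (ln 2).
have as_ : (fun M => \sum_(1 <= m < M.+1) a m) @ \oo --> s.
  have c1 : (fun M => (\sum_(0 <= p < (2 ^ M).+1 | prime p) p%:R^-1 - ln (ln (2 ^ M)%:R)) -
     (\sum_(1 <= k < M.+1) k%:R^-1 - ln M%:R) + ln (ln 2)) @ \oo --> s.
    apply: cvgD; last exact: cvg_cst.
    apply: cvgB hgam.
    apply: (cvg_comp (fun M => 2 ^ M)%N
      (fun N => \sum_(0 <= p < N.+1 | prime p) p%:R^-1 - ln (ln N%:R))) hc.
    move=> A [n0 _ hA]; exists n0 => // n /= nn; apply: hA => /=.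
    by apply: leq_trans nn _; apply: ltnW; exact: ltn_expl.
  have E M : \sum_(1 <= m < M.+2) a m =
     (\sum_(0 <= p < (2 ^ M.+1).+1 | prime p) p%:R^-1 - ln (ln (2 ^ M.+1)%:R)) -
     (\sum_(1 <= k < M.+2) k%:R^-1 - ln M.+1%:R) + ln (ln 2).
    have l2 : 0 < ln 2 :> R by rewrite ln_gt0// ltr1n.
    rewrite /a sumrB sum_dyadic_blocks natrX lnXn// -[ln 2 *+ _]mulr_natl lnM ?posrE ?ltr0n//.
    by ring.
  by rewrite -cvg_shiftS (eq_cvg _ _ E); rewrite -cvg_shiftS in c1.
have sE : s = ln (ln 2) - g0.
  apply/eqP; rewrite -subr_eq0 -normr_eq0; apply/eqP/le_anti; rewrite normr_ge0 andbT.
  apply/ler_addgt0Pr => eta eta0; rewrite add0r.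
  have eta2 : 0 < eta / 2 by rewrite divr_gt0.
  have [x x0 hx] := abel_limit as_ eta2.
  (* eta / 40 turns the error 20 d into eta / 2; the bound [x] brings r = 2^(-d^2) into the range of
     [abel_limit]. *)
  pose d := Num.min (Num.min 2^-1 (eta / 40)) x.
  have d0 : 0 < d by rewrite !lt_min x0 andbT invr_gt0 ltr0n/= divr_gt0.
  have d2 : d <= 2^-1 by rewrite /d !ge_min lexx.
  have d40 : d <= eta / 40 by rewrite /d !ge_min lexx orbT.
  have dx : d <= x by rewrite /d ge_min lexx orbT.
  have [r1 r01 _] := npow2_bounds (exprn_gt0 2 d0).
  have rx : 1 - x <= npow (d ^+ 2) 2.
    have : d ^+ 2 <= d by rewrite expr2 ler_piMr ?(ltW d0)//; lra.
    by lra.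
  have d02 : 0 < d <= 2^-1 by rewrite d0.
  have [n1 _ h1] := hx _ r01 rx.
  have [n2 _ h2] := dyadic_estimate hg d02.
  have := h1 (maxn n1 n2) (leq_maxl _ _); have := h2 (maxn n1 n2) (leq_maxr _ _).
  rewrite /=; move: (\sum_(1 <= m < _) _) => y k2 k1.
  have -> : s - (ln (ln 2) - g0) = (y - (ln (ln 2) - g0)) - (y - s) by ring.
  apply: (le_trans (ler_normB _ _)); lra.
have cE : c = gam - g0 by move: sE; rewrite /s; lra.
have -> : - gam = - c - g0 by rewrite cE; ring.
have c2 : (fun N => - (\sum_(0 <= p < N.+1 | prime p) p%:R^-1 - ln (ln N%:R)) -
   \sum_(0 <= p < N.+1 | prime p) log_remainder (p%:R^-1 : R)) @ \oo --> - c - g0.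
  apply: cvgB; first exact: cvgN hc.
  by rewrite (cvg_shiftS (fun N => \sum_(0 <= p < N | prime p) log_remainder (p%:R^-1 : R))).
suff E N : \sum_(0 <= p < N.+1 | prime p) ln (1 - p%:R^-1) + ln (ln N%:R) =
   - (\sum_(0 <= p < N.+1 | prime p) p%:R^-1 - ln (ln N%:R)) -
   \sum_(0 <= p < N.+1 | prime p) log_remainder (p%:R^-1 : R) by rewrite (eq_cvg _ _ E).
rewrite opprB addrAC -addrA -opprD -big_split/= addrC; congr (_ + _).
by rewrite -sumrN; apply: eq_bigr => p _; rewrite /log_remainder; ring.
Qed.
End Mertens3.

(** * The logarithm of L(1,chi) *)

Section PowerSums.
Variables (R : realType) (q : nat).
Implicit Types (a b : 'Z_q) (x : R).

(** [fseries t s] is the case of a residue class of exponents. A general predicate also covers the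
    exponents n with b^n = a, before any order or residue is known. *)
Definition powsum (P : pred nat) (x : R) : R := \big[+%R/0]_(1 <= n <oo | P n) (x ^+ n / n%:R).

Lemma powsum_partial_le (P : pred nat) x N : 0 <= x <= 2^-1 ->
  \sum_(1 <= n < N | P n) x ^+ n / n%:R <= 2 * x.
Proof.
move=> /andP[x0 x2]; apply: (@le_trans _ _ (\sum_(1 <= n < N.+1) x ^+ n)).
  rewrite [leLHS]big_mkcond/=.
  apply: (@le_trans _ _ (\sum_(1 <= n < N) x ^+ n)).
    apply: ler_sum_nat => n /andP[n0 _]; case: ifP => _; last exact: exprn_ge0.
    by rewrite ler_piMr ?exprn_ge0// invf_le1 ?ler1n ?ltr0n.
  case: N => [|N]; first by rewrite !big_geq.
  by rewrite [leRHS]big_nat_recr//= lerDl exprn_ge0.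
suff H : \sum_(1 <= n < N.+1) x ^+ n <= 2 * x - 2 * x ^+ N.+1.
  by apply: le_trans H _; rewrite gerBl mulr_ge0// exprn_ge0.
elim: N => [|N IH]; first by rewrite big_geq// expr1 subrr.
rewrite big_nat_recr//=; have h : 0 <= x ^+ N.+1 by rewrite exprn_ge0.
have h2 : 2 * x ^+ N.+2 <= x ^+ N.+1.
  by rewrite exprS mulrA ler_piMl//; lra.
by move: IH h2; move: (x ^+ N.+2) (x ^+ N.+1) (\sum_(1 <= n < N.+1) _) => *; lra.
Qed.

Lemma powsum_cvg (P : pred nat) x : 0 <= x <= 2^-1 ->
  (fun N => \sum_(1 <= n < N | P n) x ^+ n / n%:R) @ \oo --> powsum P x.
Proof.
move=> x2; have /andP[x0 _] := x2.
suff : cvgn (fun N => \sum_(1 <= n < N | P n) x ^+ n / n%:R) by [].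
apply: nondecreasing_is_cvgn; last by exists (2 * x) => _ [N _ <-]; exact: powsum_partial_le.
by apply: nondecreasing_series => n _ _; rewrite divr_ge0 ?exprn_ge0.
Qed.

Lemma powsum_ge0 (P : pred nat) x : 0 <= x <= 2^-1 -> 0 <= powsum P x.
Proof.
move=> x2; have /andP[x0 _] := x2.
apply: limr_ge; first exact: cvgP (powsum_cvg x2).
by apply: nearW => N; apply: sumr_ge0 => n _; rewrite divr_ge0 ?exprn_ge0.
Qed.

Lemma powsum_eq0 (P : pred nat) x : (forall n, ~~ P n) -> powsum P x = 0.
Proof.
move=> P0; rewrite /powsum (_ : (fun N : nat => _) = fun=> 0) ?lim_cst//.
by apply/funext => N; rewrite big1// => n; rewrite (negbTE (P0 n)).
Qed.

Lemma eq_powsum (P P' : pred nat) x : (forall n, (0 < n)%N -> P n = P' n) ->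
  powsum P x = powsum P' x.
Proof.
move=> PP; rewrite /powsum; congr (limn _); apply/funext => N.
rewrite big_nat_cond [RHS]big_nat_cond; apply: eq_bigl => n.
by case: (posnP n) => [->//|n0]; rewrite PP.
Qed.

Lemma powsum_le_sqr (P : pred nat) x : ~~ P 1%N -> 0 <= x <= 2^-1 -> powsum P x <= 2 * x ^+ 2.
Proof.
move=> P1 x2; have /andP[x0 x2'] := x2.
apply: limr_le; first exact: cvgP (powsum_cvg x2).
apply: nearW => N; have [N1|N1] := leqP N 1; first by rewrite big_geq// mulr_ge0// exprn_ge0.
rewrite big_ltn_cond// (negbTE P1) [leLHS]big_mkcond/=.
apply: (@le_trans _ _ (\sum_(2 <= n < N) x ^+ n)).
  apply: ler_sum_nat => n /andP[n0 _]; case: ifP => _; last exact: exprn_ge0.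
  by rewrite ler_piMr ?exprn_ge0// invf_le1 ?ler1n ?ltr0n// ltnW.
suff H M : \sum_(2 <= n < M.+2) x ^+ n <= 2 * x ^+ 2 - 2 * x ^+ M.+2.
  by case: N N1 => [|[|N]]// _; apply: le_trans (H N) _; rewrite gerBl mulr_ge0// exprn_ge0.
elim: M => [|M IH]; first by rewrite big_geq// subrr.
rewrite big_nat_recr//=; have h : 0 <= x ^+ M.+2 by rewrite exprn_ge0.
have h2 : 2 * x ^+ M.+3 <= x ^+ M.+2.
  by rewrite exprS mulrA ler_piMl//; lra.
by move: IH h2; move: (x ^+ M.+3) (x ^+ M.+2) (\sum_(2 <= n < M.+2) _) => *; lra.
Qed.
End PowerSums.

Section LogL1.
Variables (R : realType) (q : nat).
Hypothesis q1 : (1 < q)%N.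
Local Notation DC := (@dirichlet_character R q).
Variable X : seq {ffun 'Z_q -> R[i]}.
Hypothesis uX : uniq X.
Hypothesis XP : forall chi, chi \in X <-> DC chi.

Lemma character_log_sum (a : {unit 'Z_q}) (b : 'Z_q) (x : R) : 0 <= x <= 2^-1 ->
  \sum_(chi <- X) conjc (chi (val a)) * clog (1 - chi b * x%:C) =
  - ((totient q)%:R * powsum (fun n => b ^+ n == val a) x)%:C.
Proof.
move=> x2; have /andP[x0 x2'] := x2.
set U := \sum_(chi <- X) _; set F := powsum _ x; set phi : R := (totient q)%:R.
pose S n := \sum_(1 <= k < n | b ^+ k == val a) x ^+ k / k%:R.
have cv : (fun n => 4 * (size X)%:R * x ^+ n.+1 + phi * `|F - S n.+1|) @ \oo -->
    (4 * (size X)%:R * 0 + phi * `|F - F| : R).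
  apply: cvgD; apply: cvgM; try exact: cvg_cst.
    rewrite (@cvg_shiftS _ (fun n => x ^+ n)); apply: cvg_expr; rewrite ger0_norm//; lra.
  apply: cvg_norm; apply: cvgB; first exact: cvg_cst.
  by rewrite (@cvg_shiftS _ S); exact: powsum_cvg.
suff : cmod (U + (phi * F)%:C) <= 0.
  move=> h; apply/eqP; rewrite -subr_eq0 opprK -cmod_eq0; apply/eqP/le_anti.
  by rewrite h cmod_ge0.
have -> : 0 = 4 * (size X)%:R * 0 + phi * `|F - F| by rewrite subrr normr0 !mulr0 addr0.
rewrite -(cvg_lim (@Rhausdorff R) cv); apply: limr_ge; first exact: cvgP cv.
apply: nearW => n.
have -> : U + (phi * F)%:C = (U + (phi * S n.+1)%:C) + (phi * (F - S n.+1))%:C.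
  by rewrite -addrA -rmorphD/=; congr (_ + _%:C); ring.
apply: le_trans (cmodD _ _) _; apply: lerD; first exact: character_local_log.
by rewrite cmod_real normrM ger0_norm.
Qed.

(** The logarithm is - chi(p) / p up to a term bounded by 4 / p^2, and [dirichlet_prime_sum] takes
    care of the real and imaginary parts of the sum of chi(p) / p. *)
Lemma logL1_cvg (chi : {ffun 'Z_q -> R[i]}) : DC chi -> chi <> principal_character R q ->
  exists l : R[i],
   (fun n => \sum_(0 <= p < n | prime p) clog (1 - chi p%:R / p%:R) : (R[i] : numFieldType)) @ \oo -->
   (l : (R[i] : numFieldType)).
Proof.
move=> h np.
have [L LC] := Lpartial_cvg (fun N => sum_natchar_le q1 N h np).
have L0 := dirichlet_L_neq0 q1 uX XP h np LC.
have [K hK] := sum_chi_prime_ln_bounded (fun m n => natcharM m n h)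
  (fun n => cmod_character_le1 q1 n%:R h) (fun N => sum_natchar_le q1 N h np) LC L0.
have cR : cvgn (fun N => \sum_(0 <= p < N | prime p) complex.Re (natchar chi p) / p%:R).
  apply: (@dirichlet_prime_sum _ _ K) => N; apply: le_trans (hK N).
  apply: le_trans _ (Re_le_cmod _); rewrite Re_sum.
  by under [X in _ <= `|X|]eq_bigr do rewrite Re_mulr_real.
have cI : cvgn (fun N => \sum_(0 <= p < N | prime p) complex.Im (natchar chi p) / p%:R).
  apply: (@dirichlet_prime_sum _ _ K) => N; apply: le_trans (hK N).
  apply: le_trans _ (Im_le_cmod _); rewrite Im_sum.
  by under [X in _ <= `|X|]eq_bigr do rewrite Im_mulr_real.
pose rem p : R[i] := if prime p then clog (1 - chi p%:R / p%:R) + chi p%:R / p%:R else 0.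
pose w p : R := if prime p then 4 * (p%:R * p.-1%:R)^-1 else 0.
have remw p : cmod (rem p) <= w p.
  rewrite /rem /w; case: ifPn => pp; last by rewrite cmod0.
  have /andP[a b] := prime_inv_le2 R pp.
  have z1 : cmod (chi p%:R / p%:R) <= p%:R^-1.
    by rewrite natC_inv cmodM cmod_real (ger0_norm (ltW a)) ler_piMl ?(ltW a)// cmod_character_le1.
  have := clog_taylor_half 1 (le_trans z1 b); rewrite big_nat1 expr1 divr1 => /le_trans; apply.
  rewrite ler_wpM2l//; apply: (@le_trans _ _ (p%:R^-1 ^+ 2)).
    by rewrite lerXn2r ?nnegrE ?cmod_ge0 ?(ltW a).
  have p1 : 0 < p.-1%:R :> R by rewrite ltr0n -ltnS prednK ?prime_gt1 ?prime_gt0.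
  have p0 : 0 < p%:R :> R by rewrite ltr0n prime_gt0.
  by rewrite expr2 -invfM lef_pV2 ?posrE ?mulr_gt0// ler_pM2l// ler_nat leq_pred.
have wW N : \sum_(0 <= p < N) w p <= 4.
  rewrite -big_mkcond; case: N => [|N]; first by rewrite big_geq.
  rewrite -mulr_sumr ler_piMr//; apply: le_trans (sum_inv_consecutive R N).
  by apply: sum_primes_le => n _; rewrite invr_ge0 mulr_ge0.
have [S hS] := abs_bounded_ccvg remw wW.
have c2 : (fun N => \sum_(0 <= p < N | prime p) chi p%:R / p%:R : (R[i] : numFieldType)) @ \oo -->
   ((limn (fun N => \sum_(0 <= p < N | prime p) complex.Re (natchar chi p) / p%:R) +i*
    limn (fun N => \sum_(0 <= p < N | prime p) complex.Im (natchar chi p) / p%:R)) : (R[i] : numFieldType)).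
  apply: cvg_complex => /=.
    under eq_fun do (rewrite Re_sum; under eq_bigr do rewrite natC_inv Re_mulr_real).
    exact: cR.
  under eq_fun do (rewrite Im_sum; under eq_bigr do rewrite natC_inv Im_mulr_real).
  exact: cI.
exists (S - (limn (fun N => \sum_(0 <= p < N | prime p) complex.Re (natchar chi p) / p%:R) +i*
    limn (fun N => \sum_(0 <= p < N | prime p) complex.Im (natchar chi p) / p%:R))).
have E N : \sum_(0 <= p < N | prime p) clog (1 - chi p%:R / p%:R) =
    \sum_(0 <= p < N) rem p - \sum_(0 <= p < N | prime p) chi p%:R / p%:R.
  rewrite /rem -big_mkcond -sumrB; apply: eq_bigr => p _; by rewrite addrK.
rewrite (eq_cvg _ _ E); exact: cvgB hS c2.
Qed.
End LogL1.

Lemma cvg_finite_sum (K : numFieldType) (I : eqType) (r : seq I) (P : pred I)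
    (u : I -> nat -> K) (l : I -> K) :
  (forall i, i \in r -> P i -> u i @ \oo --> l i) ->
  (fun n => \sum_(i <- r | P i) u i n) @ \oo --> \sum_(i <- r | P i) l i.
Proof.
elim: r => [|i r IH] h.
  rewrite big_nil (_ : (fun n : nat => _) = fun=> 0); first exact: cvg_cst.
  by apply/funext => n; rewrite big_nil.
have {}IH : (fun n => \sum_(i <- r | P i) u i n) @ \oo --> \sum_(i <- r | P i) l i.
  by apply: IH => j jr; apply: h; rewrite inE jr orbT.
have E n : \sum_(j <- i :: r | P j) u j n = (if P i then u i n else 0) + \sum_(j <- r | P j) u j n.
  by rewrite big_cons; case: ifP; rewrite ?add0r.
rewrite (eq_cvg _ _ E) big_cons; case: ifPn => Pi.
  by apply: cvgD => //; apply: h => //; exact: mem_head.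
by under eq_fun do rewrite add0r.
Qed.

(** * The constant c(q,a) *)

Section Totient.
Variable R : realType.

Lemma prod_primes_totient (q n : nat) : (0 < q < n)%N ->
  \prod_(0 <= p < n | prime p && (p %| q)%N) (1 - p%:R^-1) = (totient q)%:R / q%:R :> R.
Proof.
move=> /andP[q0 qn].
have pE (T : comRingType) (F : nat -> T) : \prod_(0 <= p < n | prime p && (p %| q)%N) F p =
    \prod_(p <- primes q) F p.
  rewrite -big_filter; apply: perm_big; apply: uniq_perm.
  - by rewrite filter_uniq// iota_uniq.
  - exact: primes_uniq.
  move=> p; rewrite mem_filter mem_index_iota mem_primes q0/=.
  case: (boolP (prime p)) => //= pp; case: (boolP (p %| q)%N) => //= pq.
  by rewrite (leq_ltn_trans (dvdn_leq q0 pq)).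
have qE : q%:R = \prod_(p <- primes q) (p ^ logn p q)%:R :> R.
  rewrite -pE -{1}(partnT q0) (@widen_partn n.-1 predT q);
    last by rewrite -ltnS prednK// (leq_trans _ qn).
  rewrite prednK ?(leq_ltn_trans _ qn)// natr_prod big_mkcond [RHS]big_mkcond.
  apply: eq_bigr => p _; case: ifPn => //=; case: (boolP (prime p)) => /= pp.
    by move=> pq; rewrite lognE pp q0 (negbTE pq) expn0.
  by rewrite lognE (negbTE pp) expn0.
rewrite pE totientE// qE natr_prod -prodf_div big_seq [RHS]big_seq.
apply: eq_bigr => p; rewrite mem_primes => /and3P[pp _ pq].
have p0 := prime_gt0 pp; have l0 : (0 < logn p q)%N by rewrite logn_gt0 mem_primes pp q0.
have -> : (p ^ logn p q = p * p ^ (logn p q).-1)%N by rewrite -expnS prednK.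
have pn : p%:R != 0 :> R by rewrite pnatr_eq0 -lt0n.
have pkn : (p ^ (logn p q).-1)%:R != 0 :> R by rewrite pnatr_eq0 -lt0n expn_gt0 p0.
have pE1 : p.-1%:R = p%:R - 1 :> R by rewrite -[in RHS](prednK p0) -natr1 addrK.
rewrite !natrM pE1 -mulf_div divff// mulr1 mulrBl divff// mul1r //.
Qed.
End Totient.

Section RealLimit.
Variable R : realType.

Lemma truncn_cvg : (fun x : R => Num.truncn x) @ +oo --> \oo.
Proof.
move=> A [n0 _ hA]; exists n0%:R; split; first exact: num_real.
by move=> x xn; apply: hA => /=; rewrite truncn_ge_nat ltW// (le_lt_trans _ xn).
Qed.

(** C(q,a) is a limit over real x, the prime sums are indexed by integers: ln ln x exceeds ln ln of
    the integer part of x by at most the inverse of the logarithm of that integer part. *)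
Lemma cvg_loglog_real (u : nat -> R) (c mu : R) :
  (fun N => u N + c * ln (ln N%:R)) @ \oo --> mu ->
  (fun x : R => u (Num.truncn x) + c * ln (ln x)) @ +oo --> mu.
Proof.
move=> hu.
have h1 : (fun x : R => u (Num.truncn x) + c * ln (ln (Num.truncn x)%:R)) @ +oo --> mu.
  exact: (cvg_comp _ _ truncn_cvg hu).
have h2 : (fun x : R => ln (ln x) - ln (ln (Num.truncn x)%:R)) @ +oo --> (0 : R).
  have h3 : (fun x : R => (ln (Num.truncn x)%:R)^-1) @ +oo --> (0 : R).
    exact: (cvg_comp _ _ truncn_cvg (@cvg_inv_ln R)).
  apply: (squeeze_cvgr _ (cvg_cst 0) h3).
  near=> x.
  have x2 : 2 <= x by near: x; apply: nbhs_pinfty_ge; exact: num_real.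
  have x0 : 0 <= x by apply: le_trans x2.
  have /andP[t1 t2] := truncn_itv x0.
  have n2 : (2 <= Num.truncn x)%N by rewrite truncn_ge_nat.
  move: (Num.truncn x) t1 t2 n2 => N t1 t2 n2.
  have N0 : (0 < N)%N by apply: leq_trans n2.
  have Nr : 0 < N%:R :> R by rewrite ltr0n.
  have xr : 0 < x by apply: lt_le_trans x2.
  have l0 : 0 < ln N%:R :> R by rewrite ln_gt0// ltr1n.
  have l1 : ln N%:R <= ln x by rewrite ler_ln ?posrE.
  have l2 : ln x - ln N%:R <= 1.
    apply: (@le_trans _ _ (ln N.+1%:R - ln N%:R)).
      by rewrite lerD2r ler_ln ?posrE ?ltr0n// ltW.
    by apply: le_trans (ln_natS_le R N0) _; rewrite invf_le1 ?ler1n.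
  have [|h4 h5] := @ln_lt_ratio R (ln x) (ln N%:R); first by rewrite l0.
  apply/andP; split.
    by apply: le_trans h4; rewrite divr_ge0 ?subr_ge0// (le_trans _ l1)// ltW.
  by apply: (le_trans h5); rewrite ler_pdivrMr// mulVf ?gt_eqF.
have E x : u (Num.truncn x) + c * ln (ln x) =
  (u (Num.truncn x) + c * ln (ln (Num.truncn x)%:R)) + c * (ln (ln x) - ln (ln (Num.truncn x)%:R)).
  by ring.
have h := cvgD h1 (cvgM (cvg_cst c) h2).
rewrite mulr0 addr0 in h; rewrite (eq_cvg _ _ E); exact: h.
Unshelve. all: by end_near. Qed.
End RealLimit.

Section Powsum1.
Variable R : realType.

Lemma powsum_sub1 (P : pred nat) (x : R) : P 1%N -> 0 <= x <= 2^-1 ->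
  powsum P x - x = powsum (fun n => P n && (n != 1)%N) x.
Proof.
move=> P1 x2; apply/eqP; rewrite subr_eq; apply/eqP.
have h := cvgD (powsum_cvg (P := fun n => P n && (n != 1)%N) x2) (cvg_cst x).
apply: (cvg_lim (@Rhausdorff R)); rewrite -cvg_shiftS -cvg_shiftS.
rewrite -cvg_shiftS -cvg_shiftS in h.
suff E N : \sum_(1 <= n < N.+2 | P n) x ^+ n / n%:R =
   \sum_(1 <= n < N.+2 | P n && (n != 1)%N) x ^+ n / n%:R + x.
  by rewrite (eq_cvg _ _ E); exact: h.
rewrite big_ltn_cond// P1 [X in _ = X + _]big_ltn_cond//= andbF expr1 divr1 addrC.
congr (_ + _); rewrite big_nat_cond [RHS]big_nat_cond; apply: eq_bigl => n.
by case: n => [|[|n]] //=; rewrite andbT.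
Qed.

Lemma prime_sum_cvg (P : pred nat) (g : nat -> R) : (forall p, P p -> prime p) ->
  (forall p, prime p -> `|g p| <= 2 * (p%:R^-1) ^+ 2) ->
  cvgn (fun N => \sum_(0 <= p < N | P p) g p).
Proof.
move=> Pp hg; have -> : (fun N => \sum_(0 <= p < N | P p) g p) =
    series (fun p => if P p then g p else 0).
  by apply/funext => N; rewrite /series/= big_mkcond.
pose w p : R := if prime p then 2 * (p%:R * p.-1%:R)^-1 else 0.
apply: (@abs_bounded_cvg _ _ w 2) => [p|N].
  rewrite /w; case: ifPn => [/Pp pp|_]; last first.
    by rewrite normr0; case: ifP => // _; rewrite mulr_ge0// invr_ge0 mulr_ge0.
  rewrite pp; apply: (le_trans (hg _ pp)); rewrite ler_wpM2l//.
  have p1 : 0 < p.-1%:R :> R by rewrite ltr0n -ltnS prednK ?prime_gt1 ?prime_gt0.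
  have p0 : 0 < p%:R :> R by rewrite ltr0n prime_gt0.
  by rewrite expr2 -invfM lef_pV2 ?posrE ?mulr_gt0// ler_pM2l// ler_nat leq_pred.
rewrite -big_mkcond; case: N => [|N]; first by rewrite big_geq.
rewrite -mulr_sumr ler_piMr//; apply: le_trans (sum_inv_consecutive R N).
by apply: sum_primes_le => n _; rewrite invr_ge0 mulr_ge0.
Qed.
End Powsum1.

(** * The logarithm of Pi(q,a) *)

Section NonprincipalLogSum.
Variables (R : realType) (q : nat).
Hypothesis q1 : (1 < q)%N.
Variable ua : {unit 'Z_q}.
Local Notation DC := (@dirichlet_character R q).
Local Notation chi0 := (principal_character R q).
Local Notation phi := ((totient q)%:R : R).

Definition unit_powsum (b : 'Z_q) (x : R) : R := powsum (fun n => b ^+ n == val ua) x.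

Lemma prime_unit_Zp p : prime p -> ((p%:R : 'Z_q) \is a GRing.unit) = ~~ (p %| q)%N.
Proof. by move=> pp; rewrite unitZpE// coprime_sym prime_coprime. Qed.

Variable X : seq {ffun 'Z_q -> R[i]}.
Hypothesis uX : uniq X.
Hypothesis XP : forall chi, chi \in X <-> DC chi.

(** The sum over all characters, evaluated by orthogonality, minus the contribution of the principal
    one. Being real, it forces Pi(q,a) to be real in [PiL1_expR]. *)
Definition log_rest (n : nat) : R :=
  - (phi * \sum_(0 <= p < n | prime p) unit_powsum p%:R (p%:R^-1)) -
    \sum_(0 <= p < n | prime p && ~~ (p %| q)%N) ln (1 - p%:R^-1).

Lemma nonprincipal_log_sum n :
  \sum_(chi <- X | chi != chi0) conjc (chi (val ua)) *
     \sum_(0 <= p < n | prime p) clog (1 - chi p%:R / p%:R) = (log_rest n)%:C.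
Proof.
have E : \sum_(chi <- X) conjc (chi (val ua)) * \sum_(0 <= p < n | prime p) clog (1 - chi p%:R / p%:R) =
    (- (phi * \sum_(0 <= p < n | prime p) unit_powsum p%:R (p%:R^-1)))%:C.
  under eq_bigr do rewrite mulr_sumr.
  rewrite exchange_big/= mulr_sumr -sumrN rmorph_sum; apply: eq_bigr => p pp.
  have /andP[a b] := prime_inv_le2 R pp.
  rewrite rmorphN -(character_log_sum q1 uX XP); last by rewrite b ltW.
  by apply: eq_bigr => chi _; rewrite natC_inv.
have E0 : conjc (chi0 (val ua)) * \sum_(0 <= p < n | prime p) clog (1 - chi0 p%:R / p%:R) =
    (\sum_(0 <= p < n | prime p && ~~ (p %| q)%N) ln (1 - p%:R^-1))%:C.
  rewrite ffunE (valP ua) conjc1 mul1r big_mkcondr rmorph_sum; apply: eq_bigr => p pp.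
  have /andP[a b] := prime_inv_le2 R pp.
  rewrite ffunE prime_unit_Zp//; case: ifPn => pq.
    by rewrite mul1r natC_inv clog_real//; lra.
  by rewrite mul0r -(rmorph0 (real_complex R)) clog_real ?subr0 ?ln1.
move: E; rewrite (bigD1_seq chi0) ?uX//=; last by apply/XP; exact: principal_characterP.
by rewrite E0 addrC => /eqP; rewrite eq_sym -subr_eq => /eqP <-; rewrite -rmorphB.
Qed.

Lemma PiL1_expR : exists r : R, log_rest @ \oo --> r /\ PiL1 R ua = (expR r)%:C.
Proof.
have H chi : exists l : R[i], chi \in X -> chi != chi0 ->
   (fun n => \sum_(0 <= p < n | prime p) clog (1 - chi p%:R / p%:R) : (R[i] : numFieldType)) @ \oo -->
   (l : (R[i] : numFieldType)).
  have [cX|_] := boolP (chi \in X); last by exists 0.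
  have [_|/eqP c0] := eqVneq chi chi0; first by exists 0.
  by have [l hl] := logL1_cvg q1 uX XP ((XP chi).1 cX) c0; exists l.
have [l hl] := choice H.
pose lam : R[i] := \sum_(chi <- X | chi != chi0) conjc (chi (val ua)) * l chi.
have c1 : (fun n => (log_rest n)%:C : (R[i] : numFieldType)) @ \oo --> (lam : (R[i] : numFieldType)).
  rewrite -(eq_cvg _ _ nonprincipal_log_sum).
  apply: cvg_finite_sum => chi cX c0; apply: cvgM; first exact: cvg_cst.
  exact: hl.
have Rlam : log_rest @ \oo --> complex.Re lam.
  apply/cvgrPdist_lt => e e0; have := cvg_complexP c1 e0; apply: filterS => n.
  apply: le_lt_trans; have := Re_le_cmod (lam - (log_rest n)%:C).
  by case: (lam) => a b.
have Ilam : complex.Im lam = 0.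
  apply/eqP; rewrite -normr_eq0; apply/eqP/le_anti; rewrite normr_ge0 andbT.
  apply/ler_addgt0Pr => e e0; rewrite add0r; have [n _ /(_ n (leqnn n))/= h] := cvg_complexP c1 e0.
  apply: le_trans (ltW h); have := Im_le_cmod (lam - (log_rest n)%:C).
  by case: (lam) => a b /=; rewrite subr0.
exists (complex.Re lam); split => //.
rewrite -cexp_real; have -> : (complex.Re lam)%:C = lam by move: Ilam; case: (lam) => a b /= ->.
rewrite /PiL1.
have -> : @nonprincipal_characters R q = [set` [seq chi <- X | chi != chi0]].
  apply/seteqP; split=> chi /=; rewrite mem_filter.
    by move=> [h /eqP ->]; apply/XP.
  by move=> /andP[/eqP c0 /XP h].
rewrite -fsbig_seq ?filter_uniq// big_filter /lam cexp_sum big_seq_cond [RHS]big_seq_cond.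
apply: eq_bigr => chi /andP[cX c0]; rewrite /powL1; congr cexp.
have -> : logL1 chi = - l chi.
  by rewrite /logL1; congr (- _); exact: (cvg_lim (@norm_hausdorff (R[i] : numFieldType) (R[i] : numFieldType)) (hl _ cX c0)).
(* The sign in the definition of [logL1] cancels that of the exponent in [PiL1]. *)
by rewrite mulrNN.
Qed.
End NonprincipalLogSum.

(** * The classes that have a as a power *)

Section Splitting.
Variables (R : realType) (q : nat).
Variables (ua : {unit 'Z_q}) (t s : {unit 'Z_q} -> nat).
Hypothesis ua1 : ua != 1%g.
Hypothesis hst : forall b : {unit 'Z_q}, b \in Bset ua ->
  (1 <= s b <= t b)%N /\
  forall y : int, power_solutions b ua y <-> (y = s b %[mod t b])%Z.

Lemma fseries_Bset b (x : R) : b \in Bset ua -> fseries (t b) (s b) x = unit_powsum ua (val b) x.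
Proof.
move=> bB; have [_ H] := hst bB; apply: eq_powsum => n _; have {}H := H n%:Z.
apply/idP/idP => [/eqP e|/eqP e].
  by apply/eqP; apply: H.2; rewrite !modz_nat e.
by have := H.1 e; rewrite !modz_nat => -[->].
Qed.

Lemma fseries_order (x : R) : fseries #[ua]%g 1 x = unit_powsum ua (val ua) x.
Proof.
apply: eq_powsum => n _.
by rewrite -eq_expg_mod_order expg1 -(inj_eq val_inj) FinRing.val_unitX.
Qed.

(** A class with a positive power equal to a is a unit; it cannot be 1 because a is not 1, so it is
    a or belongs to B(q,a). The exponent 0 is ruled out for the same reason. *)
Lemma unit_powsum_eq0 (b : 'Z_q) (x : R) :
  (forall u : {unit 'Z_q}, val u = b -> u \notin ua |: Bset ua) -> unit_powsum ua b x = 0.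
Proof.
move=> hb; apply: powsum_eq0 => n; apply/negP => /eqP e.
have n0 : (0 < n)%N.
  case: n e => [|//] /eqP; rewrite expr0 eq_sym => e; case/negP: ua1.
  by rewrite -(inj_eq val_inj).
have bu : b \is a GRing.unit by rewrite -(unitrX_pos _ n0) e (valP ua).
have := hb (FinRing.unit 'Z_q bu) erefl; rewrite !inE negb_or => /andP[bua].
rewrite bua /= negb_and negbK => /orP[/eqP b1|/asboolPn]; last by apply; exists n%:Z.
case/negP: ua1; rewrite -(inj_eq val_inj) -e /=.
by have /= -> := congr1 val b1; rewrite expr1n.
Qed.

Lemma unit_powsum_split n :
  \sum_(0 <= p < n | prime p) unit_powsum ua p%:R (p%:R^-1 : R) =
  \sum_(b in Bset ua) \sum_(0 <= p < n | prime_in b p) fseries (t b) (s b) p%:R^-1 +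
  \sum_(0 <= p < n | prime_in ua p) fseries #[ua]%g 1 p%:R^-1.
Proof.
have uB : ua \notin Bset ua by rewrite inE eqxx andbF.
pose F (b : {unit 'Z_q}) (p : nat) : R := if p%:R == val b then unit_powsum ua p%:R p%:R^-1 else 0.
have E (b : {unit 'Z_q}) (g : R -> R) : (forall x, g x = unit_powsum ua (val b) x) ->
    \sum_(0 <= p < n | prime_in b p) g (p%:R^-1 : R) = \sum_(0 <= p < n | prime p) F b p.
  move=> gE; rewrite big_mkcondr; apply: eq_bigr => p _; rewrite /F.
  by case: ifP => // /eqP ->; rewrite gE.
rewrite (E _ _ fseries_order).
under [X in _ = X + _]eq_bigr => b bB do rewrite (E _ _ (fun x => fseries_Bset x bB)).
rewrite addrC -(big_setU1 _ uB) exchange_big/=; apply: eq_bigr => p _.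
have [[u uE uU]|nu] := pselect (exists2 u : {unit 'Z_q}, val u = p%:R & u \in ua |: Bset ua).
  rewrite (bigD1 u)//= {1}/F -uE eqxx big1 ?addr0// => v /andP[_ vu].
  by rewrite /F -uE (inj_eq val_inj) eq_sym (negbTE vu).
rewrite unit_powsum_eq0; last first.
  by move=> u uE; apply/negP => uU; apply: nu; exists u.
by rewrite big1// => v _; rewrite /F unit_powsum_eq0 ?if_same// => u uE; apply/negP => uU;
  apply: nu; exists u.
Qed.
End Splitting.

(** * From logarithms to the formula for c(q,a) *)

Section MertensFormula.
Variables (R : realType) (q : nat).
Hypothesis q1 : (1 < q)%N.
Variables (ua : {unit 'Z_q}) (t s : {unit 'Z_q} -> nat).
Hypothesis ua1 : ua != 1%g.
Hypothesis hst : forall b : {unit 'Z_q}, b \in Bset ua ->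
  (1 <= s b <= t b)%N /\
  forall y : int, power_solutions b ua y <-> (y = s b %[mod t b])%Z.
Local Notation phi := ((totient q)%:R : R).

Lemma phi_gt0 : 0 < phi.
Proof. by rewrite ltr0n totient_gt0 ltnW. Qed.

Lemma expR_prod_lim (P : pred nat) (c : R) (f : nat -> R) :
  cvgn (fun N => \sum_(0 <= p < N | P p) f p) ->
  \big[*%R/1]_(0 <= p <oo | P p) expR (c * f p) = expR (c * \big[+%R/0]_(0 <= p <oo | P p) f p).
Proof.
move=> cf; apply: (cvg_lim (@Rhausdorff R)).
have E N : \prod_(0 <= p < N | P p) expR (c * f p) = expR (c * \sum_(0 <= p < N | P p) f p).
  by rewrite mulr_sumr expR_sum.
rewrite (eq_cvg _ _ E).
have h := cvgM (cvg_cst c) cf.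
exact: (continuous_cvg _ (@continuous_expR R _) (h _ _)).
Qed.

Lemma fseries_Bset_cvg b : b \in Bset ua ->
  cvgn (fun N => \sum_(0 <= p < N | prime_in b p) fseries (t b) (s b) (p%:R^-1 : R)).
Proof.
move=> bB; apply: prime_sum_cvg => [p /andP[]//|p pp].
have /andP[a2 b2] := prime_inv_le2 R pp.
have x2 : 0 <= (p%:R^-1 : R) <= 2^-1.
  by apply/andP; split; first exact: ltW.
rewrite (fseries_Bset hst)// ger0_norm ?powsum_ge0//; apply: powsum_le_sqr => //.
by move: bB; rewrite inE expr1 (inj_eq val_inj) => /and3P[].
Qed.

Lemma fseries_sub_cvg :
  cvgn (fun N => \sum_(0 <= p < N | prime_in ua p) (fseries #[ua]%g 1 p%:R^-1 - p%:R^-1 : R)).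
Proof.
apply: prime_sum_cvg => [p /andP[]//|p pp].
have /andP[a2 b2] := prime_inv_le2 R pp.
have x2 : 0 <= (p%:R^-1 : R) <= 2^-1.
  by apply/andP; split; first exact: ltW.
rewrite fseries_order /unit_powsum powsum_sub1 ?expr1//.
by rewrite ger0_norm ?powsum_ge0//; apply: powsum_le_sqr => //; rewrite andbF.
Qed.

Lemma Bsum_cvg :
  cvgn (fun N => \sum_(0 <= p < N | prime_in ua p) (p%:R^-1 + ln (1 - p%:R^-1) : R)).
Proof.
apply: prime_sum_cvg => [p /andP[]//|p pp].
have /andP[a2 b2] := prime_inv_le2 R pp.
have x2 : 0 <= (p%:R^-1 : R) <= 2^-1.
  by apply/andP; split; first exact: ltW.
have /andP[h0 h1] := log_remainder_ge0 x2.
have -> : p%:R^-1 + ln (1 - p%:R^-1) = - log_remainder (p%:R^-1 : R).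
  by rewrite /log_remainder; ring.
by rewrite normrN ger0_norm.
Qed.

(** The logarithm of the right-hand side of the theorem, when [r] is that of Pi(q,a). *)
Definition log_constant (r : R) : R := r +
  phi * (\sum_(b in Bset ua) \big[+%R/0]_(0 <= p <oo | prime_in b p) fseries (t b) (s b) p%:R^-1 +
         \big[+%R/0]_(0 <= p <oo | prime_in ua p) (fseries #[ua]%g 1 p%:R^-1 - p%:R^-1) +
         Bsum R ua).

(** In the class of a, the term 1/p is taken out of [fseries] and given back in [Bsum], so that both
    series are dominated by 2 / p^2; in the finite sums the two occurrences cancel. *)
Lemma prime_class_log_cvg r : @log_rest R q ua @ \oo --> r ->
  (fun N => phi * \sum_(0 <= p < N | prime_in ua p) ln (1 - p%:R^-1) -
     \sum_(0 <= p < N | prime p && ~~ (p %| q)%N) ln (1 - p%:R^-1)) @ \oo --> log_constant r.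
Proof.
move=> hr.
have cB : (fun N => \sum_(b in Bset ua) \sum_(0 <= p < N | prime_in b p) fseries (t b) (s b) (p%:R^-1 : R)) @ \oo -->
   \sum_(b in Bset ua) \big[+%R/0]_(0 <= p <oo | prime_in b p) fseries (t b) (s b) (p%:R^-1 : R).
  by apply: cvg_finite_sum => b _ bB; exact: fseries_Bset_cvg.
have h := cvgD hr (cvgM (cvg_cst phi) (cvgD (cvgD cB fseries_sub_cvg) Bsum_cvg)).
suff E N : phi * \sum_(0 <= p < N | prime_in ua p) ln (1 - p%:R^-1) -
     \sum_(0 <= p < N | prime p && ~~ (p %| q)%N) ln (1 - p%:R^-1) =
   log_rest R ua N + phi * (\sum_(b in Bset ua) \sum_(0 <= p < N | prime_in b p) fseries (t b) (s b) (p%:R^-1 : R) +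
     \sum_(0 <= p < N | prime_in ua p) (fseries #[ua]%g 1 p%:R^-1 - p%:R^-1 : R) +
     \sum_(0 <= p < N | prime_in ua p) (p%:R^-1 + ln (1 - p%:R^-1) : R)).
  by rewrite (eq_cvg _ _ E); exact: h.
rewrite /log_rest (unit_powsum_split _ ua1 hst) sumrB big_split/=.
by ring.
Qed.

(** By Mertens' third theorem the primes not dividing q contribute - gamma - ln (phi / q) - ln (ln
    N) + o(1), the primes dividing q having the product phi / q. The constants are those of the
    definition of c(q,a) and cancel against it. *)
Lemma mertensc_expR r : @log_rest R q ua @ \oo --> r -> mertensc R ua = expR (log_constant r).
Proof.
move=> hr; have q0 : (0 < q)%N by rewrite ltnW.
have ph0 := phi_gt0; have phn : phi != 0 by rewrite gt_eqF.
have qr0 : 0 < q%:R :> R by rewrite ltr0n.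
pose A N : R := \sum_(0 <= p < N.+1 | prime_in ua p) ln (1 - p%:R^-1).
pose S N : R := \sum_(0 <= p < N.+1 | prime p && ~~ (p %| q)%N) ln (1 - p%:R^-1).
pose K := log_constant r - euler_gamma R - ln (phi / q%:R).
(* From N = q on, all prime divisors of q are within the range of summation. *)
have SE N : (q <= N)%N -> \sum_(0 <= p < N.+1 | prime p) ln (1 - p%:R^-1) =
  S N + ln (phi / q%:R) :> R.
  move=> qN; rewrite -(prod_primes_totient R (n := N.+1)) ?q0//.
  have H : 0 < \prod_(0 <= p < N.+1 | prime p && (p %| q)%N) (1 - p%:R^-1) :> R /\
     ln (\prod_(0 <= p < N.+1 | prime p && (p %| q)%N) (1 - p%:R^-1)) =
     \sum_(0 <= p < N.+1 | prime p && (p %| q)%N) ln (1 - p%:R^-1) :> R.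
    apply: (big_rec2 (fun x y => 0 < x /\ ln x = y)); first by rewrite ln1.
    move=> p y x /andP[pp _] [x0 e]; have /andP[a2 b2] := prime_inv_le2 R pp.
    have h : (0 : R) < 1 - p%:R^-1 by lra.
    by rewrite mulr_gt0// lnM ?posrE// e.
  rewrite H.2 (bigID (fun p => p %| q)%N)/= addrC; congr (_ + _).
have cA : (fun N => A N + phi^-1 * ln (ln N%:R)) @ \oo --> K / phi.
  have h1 : (fun N => phi * A N - S N) @ \oo --> log_constant r.
    by have := prime_class_log_cvg hr; rewrite -cvg_shiftS.
  have h : (fun N => ((phi * A N - S N) +
    (\sum_(0 <= p < N.+1 | prime p) ln (1 - p%:R^-1) + ln (ln N%:R)) -
      ln (phi / q%:R)) * phi^-1) @ \oo --> K / phi.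
    exact: (cvgM (cvgB (cvgD h1 (@mertens3 R)) (cvg_cst (ln (phi / q%:R)))) (cvg_cst phi^-1)).
  apply: cvg_trans _ h; apply: near_eq_cvg; near=> N.
  have qN : (q <= N)%N by near: N; exact: nbhs_infty_ge.
  by rewrite SE//; field; exact: phn.
have h := cvg_loglog_real cA.
have -> : mertensc R ua = expR (K / phi) ^+ totient q / (expR (- euler_gamma R) * (q%:R / phi)).
  rewrite /mertensc; congr (_ ^+ _ / _); apply: (cvg_lim (@Rhausdorff R)).
  have h2 : (fun x : R => expR (A (Num.truncn x) + phi^-1 * ln (ln x))) @ +oo --> expR (K / phi).
    exact: (continuous_cvg _ (@continuous_expR R _) h).
  apply: cvg_trans _ h2; apply: near_eq_cvg; near=> x.
  have x1 : 1 < x by near: x; apply: nbhs_pinfty_gt; exact: num_real.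
  rewrite /= /powR gt_eqF ?ln_gt0// addrC expRD; congr (_ * _).
  rewrite expR_sum; apply: eq_bigr => p /andP[pp _]; have /andP[a2 b2] := prime_inv_le2 R pp.
  by rewrite lnK// posrE; lra.
rewrite -expRM_natl (mulrC phi) divfK// /K !expRD !expRN lnK ?posrE ?divr_gt0//.
by field; rewrite phn !gt_eqF ?expR_gt0.
Unshelve. all: by end_near. Qed.
End MertensFormula.

(** * Residue classes of integers *)

Lemma intr_Zp (q : nat) (a : int) : (1 < q)%N -> a%:~R = (`|(a %% q)%Z|%N)%:R :> 'Z_q.
Proof.
move=> q1; have q0 : (q%:Z != 0) by rewrite -lt0n ltnW.
rewrite {1}(divz_eq a q) intrD intrM -pmulrn char_Zp// mulr0 add0r.
by rewrite [in LHS](_ : (a %% q)%Z = `|(a %% q)%Z|%N%:Z)// gez0_abs ?modz_ge0.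
Qed.

Lemma val_residue (q : nat) (a : int) : (1 < q)%N -> coprimez q a ->
  val (residue q a) = a%:~R :> 'Z_q.
Proof.
move=> q1 qa; rewrite /residue insubdK// intr_Zp// unfold_in/= unitZpE//.
move: qa; rewrite /coprimez -gcdz_modr /gcdz /coprime absz_nat.
by move=> /eqP[->].
Qed.

Lemma residue_neq1 (q : nat) (a : int) : (1 < q)%N -> coprimez q a ->
  (a != 1 %[mod q])%Z -> residue q a != 1%g.
Proof.
move=> q1 qa; apply: contra => /eqP/(congr1 val); rewrite val_residue//= intr_Zp//.
have q0 : (q%:Z != 0) by rewrite -lt0n ltnW.
move=> /(congr1 val) /=; rewrite val_Zp_nat// => e.
have a0 : (0 <= a %% q)%Z by exact: modz_ge0.
have aq : (a %% q < q)%Z by rewrite ltz_pmod// ltz_nat ltnW.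
case: (a %% q)%Z a0 aq e => // m _; rewrite ltz_nat absz_nat => mq.
by rewrite modn_small// => ->; rewrite modz_small.
Qed.

Local Close Scope classical_set_scope.

Theorem theorem2 (R : realType) (q : nat) (a : int)
  (hq : (3 <= q)%N)
  (hqa : coprimez q a)
  (ha1 : (a != 1 %[mod q])%Z)
  (t s : {unit 'Z_q} -> nat)
  (hst : forall b : {unit 'Z_q}, b \in Bset (residue q a) ->
     (1 <= s b <= t b)%N /\
     forall y : int,
       power_solutions b (residue q a) y <-> (y = s b %[mod t b])%Z) :
  let ua := residue q a in
  let phi : R := (totient q)%:R in
  (mertensc R ua)%:C =
    PiL1 R ua *
    (\prod_(b in Bset ua)
        (\big[*%R/1]_(0 <= p <oo | prime_in b p)
           expR (phi * fseries (t b) (s b) p%:R^-1)) *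
     expR (phi * Bsum R ua) *
     expR (phi *
       \big[+%R/0]_(0 <= p <oo | prime_in ua p)
          (fseries #[ua]%g 1 p%:R^-1 - p%:R^-1)))%:C.
Proof.
have q1 : (1 < q)%N by exact: ltnW.
have ua1 := residue_neq1 q1 hqa ha1.
move=> ua phi; have [X [uX XP]] := @dirichlet_charactersP R q q1.
have [r [hr ->]] := PiL1_expR q1 ua uX XP.
rewrite (mertensc_expR q1 ua1 hst hr) -rmorphM; congr (_%:C).
(* As [lim] is total, the product over p becomes the exponential of a series only by virtue of the
   convergence [fseries_Bset_cvg]; both sides are then exponentials of the same real number. *)
under eq_bigr => b bB do rewrite (expR_prod_lim _ (fseries_Bset_cvg hst bB)).
rewrite -expR_sum -!expRD /log_constant -mulr_sumr; congr expR; rewrite -/phi -/ua.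
by ring.
Qed.
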